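(* Let $k$ be a commutative ring and let $d\ge 0$. Then, in $\mathsf D(\mathsf{Rep}\,\Gamma^d_k)$, $$\Lambda^d\otimes^{\mathbf L}_{\Gamma^d_k}\Lambda^d\cong S^d.$$
   Context: $\mathsf P_k$ is the category of finitely generated projective $k$-modules; $\otimes$ and $\operatorname{Hom}$ are over $k$. For $V\in\mathsf P_k$, $\Gamma^dV=(V^{\otimes d})^{\mathfrak S_d}$ (symmetric tensors; $\Gamma^0V=k$). $\Gamma^d\mathsf P_k$: objects are those of $\mathsf P_k$, and $\operatorname{Hom}_{\Gamma^d\mathsf P_k}(V,W)=\Gamma^d\operatorname{Hom}(V,W)$, identified with the $\mathfrak S_d$-equivariant $k$-linear maps $V^{\otimes d}\to W^{\otimes d}$, composed as maps. The tensor product of $\mathsf P_k$ induces one on $\Gamma^d\mathsf P_k$ with the same values on objects. $\mathsf{Rep}\,\Gamma^d_k$ is the abelian category of $k$-linear functors $\Gamma^d\mathsf P_k\to\{k\text{-modules}\}$, and $\Gamma^{d,V}=\operatorname{Hom}_{\Gamma^d\mathsf P_k}(V,-)$. The internal tensor product is $X\otimes_{\Gamma^d_k}Y=\operatorname{colim}_{\Gamma^{d,V}\to X}\operatorname{colim}_{\Gamma^{d,W}\to Y}\Gamma^{d,V\otimes W}$ (Day convolution). Its left derived functor is $X\otimes^{\mathbf L}_{\Gamma^d_k}Y=X\otimes_{\Gamma^d_k}\mathbf pY$ on the unbounded derived category $\mathsf D(\mathsf{Rep}\,\Gamma^d_k)$, with $\mathbf pY\to Y$ a K-projective resolution. $\Lambda^d,S^d\in\mathsf{Rep}\,\Gamma^d_k$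 are the exterior and symmetric power functors: $\Lambda^dV$ and $S^dV$ are the usual quotients of $V^{\otimes d}$, on which an equivariant map $V^{\otimes d}\to W^{\otimes d}$ acts by the induced map. Objects of $\mathsf{Rep}\,\Gamma^d_k$ are viewed as complexes concentrated in degree $0$. *)

(* Defs.v *)
From HB Require Import structures.
From mathcomp Require Import all_boot all_fingroup all_algebra.
From mathcomp Require Import boolp functions.
From mathcomp Require Import generic_quotient mxtens.

Set Implicit Arguments.
Unset Strict Implicit.
Unset Printing Implicit Defensive.

Import GRing.Theory.
Local Open Scope ring_scope.
Local Open Scope quotient_scope.

Section QuotientModule.
Variables (k : comPzRingType) (M : lmodType k) (R : M -> Prop).

Inductive span : M -> Prop :=
| span0 : span 0
| spanZD a x y : R x -> span y -> span (a *: x + y).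

Lemma span_gen x : R x -> span x.
Proof. by move=> /(spanZD 1)/(_ span0); rewrite scale1r addr0. Qed.

Lemma spanD x y : span x -> span y -> span (x + y).
Proof.
by elim=> [|a z t Rz _ IH] sy; rewrite ?add0r// -addrA; apply: spanZD => //; exact: IH.
Qed.

Lemma spanZ b x : span x -> span (b *: x).
Proof.
elim=> [|a z t Rz _ IH]; rewrite ?scaler0; first exact: span0.
by rewrite scalerDr scalerA; exact: spanZD.
Qed.

Lemma spanN x : span x -> span (- x).
Proof. by move=> /(spanZ (-1)); rewrite scaleN1r. Qed.

Lemma spanB x y : span x -> span y -> span (x - y).
Proof. by move=> sx sy; apply: spanD => //; exact: spanN. Qed.

Lemma span_sum I (r : seq I) (P : pred I) (F : I -> M) :
  (forall i, P i -> span (F i)) -> span (\sum_(i <- r | P i) F i).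
Proof.
by move=> h; elim/big_ind: _ => //; [exact: span0 | move=> *; exact: spanD].
Qed.

Definition qeq : rel M := fun x y => `[< span (x - y) >].

Lemma qeq_refl : reflexive qeq.
Proof. by move=> x; apply/asboolP; rewrite subrr; exact: span0. Qed.

Lemma qeq_sym : symmetric qeq.
Proof.
by move=> x y; apply/asboolP/asboolP => /spanN; rewrite opprB.
Qed.

Lemma qeq_trans : transitive qeq.
Proof.
move=> y x z /asboolP sxy /asboolP syz; apply/asboolP.
by move: (spanD sxy syz); rewrite addrA subrK.
Qed.

Canonical qeq_equiv := EquivRel qeq qeq_refl qeq_sym qeq_trans.
Canonical qeq_equiv_direct := defaultEncModRel qeq.

(* M / span R *)
Definition quotmod := {eq_quot qeq}.

HB.instance Definition _ := Choice.on quotmod.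
HB.instance Definition _ := EqQuotient.on quotmod.

Local Open Scope quotient_scope.

Lemma qpiP (x y : M) : (\pi_quotmod x = \pi_quotmod y) <-> span (x - y).
Proof.
split=> [/eqquotP h|h]; first exact/asboolP.
by apply/eqquotP; apply/asboolP.
Qed.

Lemma qW (P : quotmod -> Prop) : (forall x, P (\pi_quotmod x)) -> forall u, P u.
Proof. by move=> h u; rewrite -[u]reprK; exact: h. Qed.

Lemma qrepr x : span (repr (\pi_quotmod x) - x).
Proof. by apply/qpiP; rewrite reprK. Qed.

Definition qadd (u v : quotmod) : quotmod := \pi_quotmod (repr u + repr v).
Definition qopp (u : quotmod) : quotmod := \pi_quotmod (- repr u).
Definition qscale (a : k) (u : quotmod) : quotmod := \pi_quotmod (a *: repr u).

Lemma qaddE x y : qadd (\pi_quotmod x) (\pi_quotmod y) = \pi_quotmod (x + y).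
Proof.
by apply/qpiP; rewrite opprD addrACA; apply: spanD; exact: qrepr.
Qed.
Lemma qoppE x : qopp (\pi_quotmod x) = \pi_quotmod (- x).
Proof. by apply/qpiP; rewrite -opprD; apply: spanN; exact: qrepr. Qed.
Lemma qscaleE a x : qscale a (\pi_quotmod x) = \pi_quotmod (a *: x).
Proof. by apply/qpiP; rewrite -scalerBr; apply: spanZ; exact: qrepr. Qed.

Lemma qaddA : associative qadd.
Proof.
apply: qW => u; apply: qW => v; apply: qW => w.
by rewrite !qaddE addrA.
Qed.
Lemma qaddC : commutative qadd.
Proof. by move=> u v; rewrite /qadd addrC. Qed.
Lemma qadd0 : left_id (\pi_quotmod 0) qadd.
Proof. by apply: qW => u; rewrite qaddE add0r. Qed.
Lemma qaddN : left_inverse (\pi_quotmod 0) qopp qadd.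
Proof. by apply: qW => u; rewrite qoppE qaddE addNr. Qed.

HB.instance Definition _ := GRing.isZmodule.Build quotmod qaddA qaddC qadd0 qaddN.

Lemma qscaleA a b u : qscale a (qscale b u) = qscale (a * b) u.
Proof. by move: u; apply: qW => u; rewrite !qscaleE scalerA. Qed.
Lemma qscale1 : left_id 1 qscale.
Proof. by apply: qW => u; rewrite qscaleE scale1r. Qed.
Lemma qscaleDr : right_distributive qscale +%R.
Proof.
move=> a; apply: qW => u; apply: qW => v.
by rewrite -[\pi_quotmod _ + \pi_quotmod _]/(qadd _ _) qaddE !qscaleE -[RHS]/(qadd _ _) qaddE scalerDr.
Qed.
Lemma qscaleDl u : {morph qscale^~ u : a b / a + b}.
Proof.
move=> a b; move: u; apply: qW => u; rewrite !qscaleE.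
by rewrite -[RHS]/(qadd _ _) qaddE scalerDl.
Qed.

HB.instance Definition _ :=
  GRing.Zmodule_isLmodule.Build k quotmod qscaleA qscale1 qscaleDr qscaleDl.

Definition qproj (x : M) : quotmod := \pi_quotmod x.

Lemma qproj_linear : linear qproj.
Proof.
move=> a x y; rewrite /qproj -[RHS]/(qadd (qscale a _) _).
by rewrite qscaleE qaddE.
Qed.
HB.instance Definition _ := GRing.isLinear.Build k M quotmod *:%R qproj qproj_linear.

Lemma qprojP x y : qproj x = qproj y <-> span (x - y).
Proof. exact: qpiP. Qed.

Lemma qproj_gen x : R x -> qproj x = 0.
Proof. by move=> Rx; rewrite -(linear0 qproj); apply/qprojP; rewrite subr0; exact: span_gen. Qed.

Lemma qprojW (P : quotmod -> Prop) : (forall x, P (qproj x)) -> forall u, P u.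
Proof. by move=> h u; rewrite -[u]reprK; exact: h. Qed.

Section Lift.
Variables (N : lmodType k) (f : {linear M -> N}) (f0 : forall x, R x -> f x = 0).

Definition qlift (u : quotmod) : N := f (repr u).

Lemma span_ker x : span x -> f x = 0.
Proof.
by elim=> [|a y z Ry _ fz]; rewrite ?linear0// linearP fz f0// scaler0 addr0.
Qed.

Lemma qlift_proj x : qlift (qproj x) = f x.
Proof.
apply/eqP; rewrite -subr_eq0 -linearB; apply/eqP/span_ker; exact: qrepr.
Qed.

Lemma qlift_linear : linear qlift.
Proof.
move=> a; apply: qprojW => x; apply: qprojW => y.
by rewrite -linearP !qlift_proj linearP.
Qed.
End Lift.

End QuotientModule.

Definition qlin (k : comPzRingType) (M : lmodType k) (R : M -> Prop) (N : lmodType k)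
    (f : {linear M -> N}) (f0 : forall x, R x -> f x = 0) : quotmod R -> N :=
  @qlift k M R N f.
HB.instance Definition _ (k : comPzRingType) (M : lmodType k) (R : M -> Prop)
    (N : lmodType k) (f : {linear M -> N}) (f0 : forall x, R x -> f x = 0) :=
  GRing.isLinear.Build k (quotmod R) N *:%R (qlin f0) (qlift_linear f0).

Section FreeModule.
Variables (k : comPzRingType) (G : choiceType).

Definition finsupp : {pred G -> k^o} :=
  fun f => `[< exists s : seq G, forall g, g \notin s -> f g = 0 >].

Lemma finsupp_closed : submod_closed finsupp.
Proof.
split=> [|a f g]; first by apply/asboolP; exists [::].
move=> /asboolP[s fs] /asboolP[t gt]; apply/asboolP; exists (s ++ t) => x.
rewrite mem_cat negb_or => /andP[xs xt].
by rewrite -[LHS]/(a *: f x + g x) fs// gt// scaler0 addr0.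
Qed.
HB.instance Definition _ :=
  GRing.isSubmodClosed.Build k (G -> k^o) finsupp finsupp_closed.

Record freemod := Free { coef :> G -> k^o; coefP : coef \in finsupp }.

HB.instance Definition _ := [isSub for coef].
HB.instance Definition _ := [Choice of freemod by <:].
HB.instance Definition _ := [SubChoice_isSubLmodule of freemod by <:].

Lemma delta_subproof (g : G) : (fun h => (g == h)%:R : k^o) \in finsupp.
Proof.
apply/asboolP; exists [:: g] => h; rewrite inE => gh.
by rewrite eq_sym (negbTE gh).
Qed.

Definition delta g := Free (delta_subproof g).

Lemma freeDE a (f g : freemod) x : (a *: f + g) x = a * f x + g x.
Proof. by rewrite -[LHS]/(val (a *: f + g) x) linearP. Qed.

Section Lift.
Variables (N : lmodType k) (F : G -> N).

Lemma supp_ex (f : freemod) :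
  exists s : seq G, uniq s /\ forall g, g \notin s -> f g = 0.
Proof.
case: (asboolP _ (coefP f)) => s fs; exists (undup s); split; first exact: undup_uniq.
by move=> g; rewrite mem_undup; exact: fs.
Qed.

Definition supp (f : freemod) : seq G := projT1 (cid (supp_ex f)).

(* the linear map sending the basis element delta g to F g *)
Definition flift (f : freemod) : N := \sum_(g <- supp f) (f g : k) *: F g.

Lemma fliftE (f : freemod) s : uniq s ->
  (forall g, g \notin s -> f g = 0) ->
  flift f = \sum_(g <- s) (f g : k) *: F g.
Proof.
move=> us fs; rewrite /flift /supp; case: cid => /= t [ut ft].
have red (r : seq G) : \sum_(g <- r) (f g : k) *: F g =
    \sum_(g <- [seq g <- r | f g != 0]) (f g : k) *: F g.
  rewrite big_filter [RHS]big_mkcond; apply: eq_bigr => g _.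
  by case: eqP => // ->; rewrite scale0r.
rewrite [LHS]red [RHS]red; apply: perm_big; apply: uniq_perm;
  rewrite ?filter_uniq// => g; rewrite !mem_filter.
case: eqP => //= fg; case: (boolP (g \in t)) => gt; case: (boolP (g \in s)) => gs //.
  by case: fg; exact: fs.
by case: fg; exact: ft.
Qed.

Lemma flift_linear : linear flift.
Proof.
move=> a f g; have [s [us fs]] := supp_ex f; have [t [ut gt]] := supp_ex g.
pose r := undup (s ++ t).
have rE h : h \notin r -> f h = 0 /\ g h = 0.
  by rewrite mem_undup mem_cat negb_or => /andP[hs ht]; rewrite fs// gt.
have ur : uniq r by exact: undup_uniq.
rewrite (@fliftE (a *: f + g) r)// => [|h /rE[fh gh]]; last first.
  by rewrite freeDE fh gh mulr0 addr0.
rewrite (@fliftE f r)// => [|h /rE[]//]; rewrite (@fliftE g r)// => [|h /rE[]//].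
rewrite scaler_sumr -big_split /=; apply: eq_bigr => h _.
transitivity ((a * f h + g h : k) *: F h); last by rewrite scalerDl scalerA.
by congr (_ *: _); exact: freeDE.
Qed.
HB.instance Definition _ := GRing.isLinear.Build k freemod N *:%R flift flift_linear.

Lemma flift_delta g : flift (delta g) = F g.
Proof.
rewrite (@fliftE (delta g) [:: g])// => [|h].
  by rewrite big_seq1 /= eqxx scale1r.
by rewrite inE /= eq_sym => /negbTE->.
Qed.
End Lift.

Lemma free_span (f : freemod) : f = flift delta f.
Proof.
apply/val_inj/funext => h /=; rewrite /flift.
rewrite -[LHS]/(coef f h).
have -> : val (\sum_(g <- supp f) (f g : k) *: delta g) h
   = \sum_(g <- supp f) f g * (g == h)%:R.
  elim/big_rec2: _ => [|g y u _ IH]; first by rewrite linear0.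
  by rewrite linearP /= -IH.
rewrite /supp; case: cid => s /= [us fs].
case: (boolP ((h) \in s)) => hs.
  rewrite (bigD1_seq (h))//= eqxx mulr1 big1 ?addr0// => g gh.
  by rewrite (negbTE gh) mulr0.
rewrite fs// big1_seq// => g /= gs; case: eqP => [e|_]; last by rewrite mulr0.
by rewrite -e gs in hs.
Qed.

End FreeModule.

Section Projective.
Variable k : comPzRingType.

(* A small model of the category of finitely generated projective k-modules:
   every such module is, up to isomorphism, the image of an idempotent matrix
   acting on row vectors (lemma pk_complete). *)
Record pk := Pk { pk_dim : nat; pk_mx : 'M[k]_pk_dim;
                  pk_idem : pk_mx *m pk_mx = pk_mx }.

Definition pkmod_pred (V : pk) : {pred 'rV[k]_(pk_dim V)} :=
  fun v => v *m pk_mx V == v.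

Lemma pkmod_closed V : submod_closed (@pkmod_pred V).
Proof.
split=> [|a v w]; rewrite !unfold_in ?mul0mx// => /eqP vE /eqP wE.
by rewrite mulmxDl -scalemxAl vE wE.
Qed.
HB.instance Definition _ V := GRing.isSubmodClosed.Build k 'rV[k]_(pk_dim V)
  (@pkmod_pred V) (pkmod_closed V).

Record pkmod (V : pk) := PkMod { pkval :> 'rV[k]_(pk_dim V); pkvalP : pkval \in @pkmod_pred V }.
HB.instance Definition _ V := [isSub for @pkval V].
HB.instance Definition _ V := [Choice of pkmod V by <:].
HB.instance Definition _ V := [SubChoice_isSubLmodule of pkmod V by <:].

Lemma pkmodE V (v : pkmod V) : v *m pk_mx V = v.
Proof. exact/eqP/(pkvalP v). Qed.

Lemma pkgen_subproof V (l : 'I_(pk_dim V)) : row l (pk_mx V) \in @pkmod_pred V.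
Proof. by rewrite unfold_in -row_mul pk_idem. Qed.
Definition pkgen V l := PkMod (pkgen_subproof (V := V) l).

Definition fg_projective (M : lmodType k) :=
  exists n (i : {linear M -> 'rV[k]_n}) (p : {linear 'rV[k]_n -> M}), cancel i p.

Lemma pk_fg_projective V : fg_projective (pkmod V).
Proof.
have mP (v : 'rV[k]_(pk_dim V)) : v *m pk_mx V \in @pkmod_pred V.
  by rewrite unfold_in -mulmxA pk_idem.
pose p v := PkMod (mP v).
have pl : linear p.
  by move=> a v w; apply: val_inj; rewrite /= mulmxDl -scalemxAl.
pose P := HB.pack_for {linear 'rV[k]_(pk_dim V) -> pkmod V} p
  (GRing.isLinear.Build k _ _ *:%R p pl).
exists (pk_dim V), val, P => v; apply: val_inj; exact: pkmodE.
Qed.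

Lemma pk_complete (M : lmodType k) : fg_projective M ->
  exists V (f : {linear M -> pkmod V}), bijective f.
Proof.
move=> [n [i [p ipK]]].
have E v : v *m lin1_mx (i \o p) = i (p v) by rewrite mul_rV_lin1.
have idem : lin1_mx (i \o p) *m lin1_mx (i \o p) = lin1_mx (i \o p).
  by apply/row_matrixP => l; rewrite row_mul rowE !E ipK.
pose V := Pk idem.
have fP x : i x \in @pkmod_pred V by rewrite unfold_in /= E ipK.
pose f x := PkMod (fP x).
have fl : linear f by move=> a x y; apply: val_inj; rewrite /= linearP.
exists V, (HB.pack_for {linear M -> pkmod V} f (GRing.isLinear.Build k _ _ *:%R f fl)).
exists (fun v : pkmod V => p (pkval v)) => [x|v] /=; first exact: ipK.
by apply: val_inj; rewrite /= -E; exact: pkmodE v.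
Qed.

Lemma pktens_idem (V W : pk) :
  tensmx (pk_mx V) (pk_mx W) *m tensmx (pk_mx V) (pk_mx W) = tensmx (pk_mx V) (pk_mx W).
Proof. by rewrite tensmx_mul !pk_idem. Qed.

(* The tensor product V (x) W: the image of the Kronecker product. *)
Definition pktens (V W : pk) : pk := Pk (pktens_idem V W).

End Projective.

Section TensorPower.
Variables (k : comPzRingType) (d : nat).

(* The d-th tensor power of k^n, in coordinates: basis tensors are indexed by
   d-tuples of elements of 'I_n. *)
Definition ten (n : nat) := {ffun {ffun 'I_d -> 'I_n} -> k^o}.
HB.instance Definition _ n := GRing.Lmodule.on (ten n).

(* A^{(x) d} for A : k^n -> k^m, acting on row vectors *)
Definition tpow n m (A : 'M[k]_(n, m)) (t : ten n) : ten m :=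
  [ffun j : {ffun 'I_d -> 'I_m} => \sum_i t i * \prod_a A (i a) (j a)].

(* the place permutation action of the symmetric group *)
Definition sact n (s : 'S_d) (t : ten n) : ten n :=
  [ffun i : {ffun 'I_d -> 'I_n} => t [ffun a => i (s a)]].

Lemma tenDE n a (t u : ten n) i : (a *: t + u) i = a * t i + u i.
Proof. by rewrite !ffunE. Qed.

Lemma tpow_linear n m (A : 'M[k]_(n, m)) : linear (tpow A).
Proof.
move=> a t u; apply/ffunP => j; rewrite tenDE !ffunE.
rewrite mulr_sumr -big_split; apply: eq_bigr => i _ /=.
by rewrite tenDE mulrDl mulrA.
Qed.
HB.instance Definition _ n m A :=
  GRing.isLinear.Build k (ten n) (ten m) *:%R (@tpow n m A) (tpow_linear A).

Lemma sact_linear n s : linear (@sact n s).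
Proof. by move=> a t u; apply/ffunP => j; rewrite tenDE !ffunE. Qed.
HB.instance Definition _ n s :=
  GRing.isLinear.Build k (ten n) (ten n) *:%R (@sact n s) (sact_linear s).

Lemma tpow_mul n m p (A : 'M[k]_(n, m)) (B : 'M_(m, p)) t :
  tpow (A *m B) t = tpow B (tpow A t).
Proof.
apply/ffunP => j; rewrite !ffunE.
under [RHS]eq_bigr do rewrite ffunE mulr_suml.
rewrite exchange_big; apply: eq_bigr => i _ /=.
under [RHS]eq_bigr do rewrite -mulrA -big_split /=.
rewrite -mulr_sumr; congr (_ * _).
under eq_bigr do rewrite mxE.
by rewrite bigA_distr_bigA.
Qed.

Lemma perm_idxK n (s : 'S_d) : cancel (fun i : {ffun 'I_d -> 'I_n} => [ffun a => i (s a)])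
  (fun i : {ffun 'I_d -> 'I_n} => [ffun a => i (s^-1 a)%g]).
Proof. by move=> i; apply/ffunP => a; rewrite !ffunE permKV. Qed.

Lemma perm_idxVK n (s : 'S_d) : cancel (fun i : {ffun 'I_d -> 'I_n} => [ffun a => i (s^-1 a)%g])
  (fun i : {ffun 'I_d -> 'I_n} => [ffun a => i (s a)]).
Proof. by move=> i; apply/ffunP => a; rewrite !ffunE permK. Qed.

Lemma sact_tpow n m (A : 'M[k]_(n, m)) s t : sact s (tpow A t) = tpow A (sact s t).
Proof.
apply/ffunP => j; rewrite !ffunE.
rewrite (reindex (fun i : {ffun 'I_d -> 'I_n} => [ffun a => i (s a)])) /=; last first.
  exists (fun i : {ffun 'I_d -> 'I_n} => [ffun a => i (s^-1 a)%g]) => i _.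
    exact: perm_idxK.
  exact: perm_idxVK.
apply: eq_bigr => i _; rewrite ffunE; congr (_ * _).
rewrite [RHS](reindex_inj (@perm_inj _ s)); apply: eq_bigr => a _.
by rewrite !ffunE.
Qed.

Definition tens_pred (V : pk k) : {pred ten (pk_dim V)} :=
  fun t => tpow (pk_mx V) t == t.

Lemma tens_closed V : submod_closed (@tens_pred V).
Proof.
split=> [|a t u]; rewrite !unfold_in ?linear0// => /eqP tE /eqP uE.
by rewrite linearP /= tE uE.
Qed.
HB.instance Definition _ V := GRing.isSubmodClosed.Build k (ten (pk_dim V))
  (@tens_pred V) (tens_closed V).

(* The tensor power V^{(x) d}: the image of the idempotent e^{(x) d}, where V
   is the image of e. *)
Record tens (V : pk k) := Tens { tval :> ten (pk_dim V); tvalP : tval \in @tens_pred V }.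
HB.instance Definition _ V := [isSub for @tval V].
HB.instance Definition _ V := [Choice of tens V by <:].
HB.instance Definition _ V := [SubChoice_isSubLmodule of tens V by <:].

Lemma tensE V (t : tens V) : tpow (pk_mx V) t = t.
Proof. exact/eqP/(tvalP t). Qed.

Definition pure n (v : 'I_d -> 'rV[k]_n) : ten n := [ffun i : {ffun 'I_d -> 'I_n} => \prod_a v a 0 (i a)].

Lemma tpow_pure n m (A : 'M[k]_(n, m)) v : tpow A (pure v) = pure (fun a => v a *m A).
Proof.
apply/ffunP => j; rewrite !ffunE.
transitivity (\sum_(i : {ffun 'I_d -> 'I_n}) \prod_a (v a 0 (i a) * A (i a) (j a))).
  by apply: eq_bigr => i _; rewrite /pure ffunE big_split.
under [RHS]eq_bigr do rewrite mxE.
by rewrite bigA_distr_bigA.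
Qed.

Lemma tprod_subproof V (v : 'I_d -> pkmod V) : pure (fun a => v a : 'rV_ _) \in @tens_pred V.
Proof.
rewrite unfold_in tpow_pure; apply/eqP; congr pure; apply/funext => a.
exact: pkmodE.
Qed.
(* the decomposable tensor v_1 (x) ... (x) v_d *)
Definition tprod V (v : 'I_d -> pkmod V) : tens V := Tens (tprod_subproof v).

Lemma tsact_subproof V s (t : tens V) : sact s t \in @tens_pred V.
Proof. by rewrite unfold_in -sact_tpow tensE. Qed.
Definition tsact V s (t : tens V) : tens V := Tens (tsact_subproof s t).

Lemma tsact_linear V s : linear (@tsact V s).
Proof. by move=> a t u; apply: val_inj; rewrite /= linearP. Qed.
HB.instance Definition _ V s :=
  GRing.isLinear.Build k (tens V) (tens V) *:%R (@tsact V s) (tsact_linear s).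

Definition tgen V (i : {ffun 'I_d -> 'I_(pk_dim V)}) : tens V :=
  tprod (fun a => pkgen (i a)).

Lemma tens_tgen V (t : tens V) : t = \sum_i (tval t i : k) *: tgen i.
Proof.
apply: val_inj; rewrite raddf_sum /= -[LHS](tensE t); apply/ffunP => j.
rewrite ffunE sum_ffunE; apply: eq_bigr => i _; rewrite !ffunE.
by congr (_ * _); apply: eq_bigr => a _; rewrite mxE.
Qed.

End TensorPower.

Section DividedPowerCategory.
Variables (k : comPzRingType) (d : nat).
Local Notation pk := (pk k).
Local Notation tens := (@tens k d).

Definition ghom_pred (V W : pk) : {pred tens V -> tens W} := fun f =>
  `[< linear f /\ forall (s : 'S_d) t, f (tsact s t) = tsact s (f t) >].

Lemma ghom_closed V W : submod_closed (@ghom_pred V W).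
Proof.
split=> [|a f g /asboolP[fl fs] /asboolP[gl gs]]; apply/asboolP; split.
- by move=> b t u; rewrite scaler0 addr0.
- by move=> s t; rewrite linear0.
- move=> b t u; rewrite -[LHS]/(a *: f _ + g _) -[RHS]/(b *: (a *: f t + g t) + (a *: f u + g u)).
  by rewrite fl gl !scalerDr addrACA !scalerA mulrC.
- by move=> s t; rewrite -[LHS]/(a *: f _ + g _) fs gs -linearP.
Qed.
HB.instance Definition _ V W := GRing.isSubmodClosed.Build k (tens V -> tens W)
  (@ghom_pred V W) (@ghom_closed V W).

(* Morphisms of Gamma^d P_k: equivariant linear maps of tensor powers. *)
Record ghom (V W : pk) := GHom { gfun :> tens V -> tens W; gfunP : gfun \in @ghom_pred V W }.
HB.instance Definition _ V W := [isSub for @gfun V W].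
HB.instance Definition _ V W := [Choice of ghom V W by <:].
HB.instance Definition _ V W := [SubChoice_isSubLmodule of ghom V W by <:].

Lemma ghom_linear V W (f : ghom V W) : linear f.
Proof. by case/asboolP: (gfunP f). Qed.
HB.instance Definition _ V W f :=
  GRing.isLinear.Build k (tens V) (tens W) *:%R (@gfun V W f) (@ghom_linear V W f).

Lemma ghom_sact V W (f : ghom V W) s t : f (tsact s t) = tsact s (f t).
Proof. by case/asboolP: (gfunP f) => _; exact. Qed.

Lemma ghomP V W (f g : ghom V W) : f =1 g -> f = g.
Proof. by move=> fg; apply/val_inj/funext. Qed.

Lemma gidm_subproof V : (@id (tens V)) \in @ghom_pred V V.
Proof. exact/asboolP. Qed.
Definition gidm V := GHom (gidm_subproof V).

Lemma gcomp_subproof U V W (g : ghom V W) (f : ghom U V) : g \o f \in @ghom_pred U W.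
Proof.
apply/asboolP; split=> [a t u|s t] /=; first by rewrite !linearP.
by rewrite !ghom_sact.
Qed.
Definition gcomp U V W (g : ghom V W) (f : ghom U V) := GHom (gcomp_subproof g f).

Definition fst_idx n m (K : {ffun 'I_d -> 'I_(n * m)}) : {ffun 'I_d -> 'I_n} :=
  [ffun a => (mxtens_unindex (K a)).1].
Definition snd_idx n m (K : {ffun 'I_d -> 'I_(n * m)}) : {ffun 'I_d -> 'I_m} :=
  [ffun a => (mxtens_unindex (K a)).2].
Definition pair_idx n m (p : {ffun 'I_d -> 'I_n} * {ffun 'I_d -> 'I_m}) :
    {ffun 'I_d -> 'I_(n * m)} :=
  [ffun a => mxtens_index (p.1 a, p.2 a)].

Lemma sum_pair_idx n m (N : nmodType) (F : {ffun 'I_d -> 'I_(n * m)} -> N) :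
  \sum_K F K = \sum_i \sum_p F (pair_idx (i, p)).
Proof.
rewrite pair_bigA /= (reindex (@pair_idx n m)) /=.
  by apply: eq_bigr => -[].
exists (fun K => (fst_idx K, snd_idx K)) => [[i p] _|K _].
  by congr (_, _); apply/ffunP => a; rewrite !ffunE mxtens_indexK.
by apply/ffunP => a; rewrite !ffunE -[RHS]mxtens_unindexK; congr mxtens_index;
  case: (mxtens_unindex _).
Qed.

Lemma fst_pair_idx n m i p : fst_idx (@pair_idx n m (i, p)) = i.
Proof. by apply/ffunP => a; rewrite !ffunE mxtens_indexK. Qed.
Lemma snd_pair_idx n m i p : snd_idx (@pair_idx n m (i, p)) = p.
Proof. by apply/ffunP => a; rewrite !ffunE mxtens_indexK. Qed.

Definition tmul n m (t : ten k d n) (u : ten k d m) : ten k d (n * m) :=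
  [ffun K => t (fst_idx K) * u (snd_idx K)].

Lemma tpow_tmul n m p q (A : 'M[k]_(n, p)) (B : 'M[k]_(m, q)) t u :
  tpow (tensmx A B) (tmul t u) = tmul (tpow A t) (tpow B u).
Proof.
apply/ffunP => K; rewrite !ffunE sum_pair_idx big_distrlr /=.
apply: eq_bigr => i _; apply: eq_bigr => j _.
rewrite ffunE fst_pair_idx snd_pair_idx mulrACA -big_split /=; congr (_ * _).
by apply: eq_bigr => a _; rewrite !mxE !ffunE mxtens_indexK.
Qed.

Lemma tenstens_subproof V W (t : tens V) (u : tens W) :
  tmul t u \in @tens_pred k d (pktens V W).
Proof. by rewrite unfold_in /= tpow_tmul !tensE. Qed.
(* the canonical bilinear map V^{(x) d} x W^{(x) d} -> (V (x) W)^{(x) d},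
   (v_1 (x) ... (x) v_d, w_1 (x) ... (x) w_d) |-> (v_1 (x) w_1) (x) ... (x) (v_d (x) w_d) *)
Definition tenstens V W (t : tens V) (u : tens W) : tens (pktens V W) :=
  Tens (tenstens_subproof t u).

Lemma tenstensPl V W a (t t' : tens V) (u : tens W) :
  tenstens (a *: t + t') u = a *: tenstens t u + tenstens t' u.
Proof. by apply/val_inj/ffunP => K; rewrite /= !ffunE mulrDl; congr (_ + _); rewrite -mulrA. Qed.
Lemma tenstensPr V W a (t : tens V) (u u' : tens W) :
  tenstens t (a *: u + u') = a *: tenstens t u + tenstens t u'.
Proof. by apply/val_inj/ffunP => K; rewrite /= !ffunE mulrDr; congr (_ + _); exact: mulrCA. Qed.

Lemma tsact_tenstens V W s (t : tens V) (u : tens W) :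
  tsact s (tenstens t u) = tenstens (tsact s t) (tsact s u).
Proof.
apply/val_inj/ffunP => K; rewrite /= !ffunE.
by congr (_ * _); congr (tval _ _); apply/ffunP => a; rewrite !ffunE.
Qed.

Definition gtens_fun V V' W W' (f : ghom V V') (g : ghom W W')
    (x : tens (pktens V W)) : tens (pktens V' W') :=
  \sum_K (tval x K : k) *:
    tenstens (f (tgen (V := V) (fst_idx K))) (g (tgen (V := W) (snd_idx K))).

Lemma tsact_tgen (V : pk) s (i : {ffun 'I_d -> 'I_(pk_dim V)}) :
  tsact s (tgen (V := V) [ffun a => i (s a)]) = tgen (V := V) i.
Proof.
apply/val_inj/ffunP => j; rewrite /= !ffunE.
rewrite [RHS](reindex_inj (@perm_inj _ s)); apply: eq_bigr => a _.
by rewrite !ffunE.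
Qed.

Lemma gtens_subproof V V' W W' (f : ghom V V') (g : ghom W W') :
  gtens_fun f g \in @ghom_pred (pktens V W) (pktens V' W').
Proof.
apply/asboolP; split=> [a x y|s x].
  rewrite /gtens_fun scaler_sumr -big_split /=; apply: eq_bigr => K _.
  by rewrite !ffunE scalerDl scalerA.
rewrite /gtens_fun linear_sum /=.
rewrite [RHS](reindex (fun K : {ffun 'I_d -> _} => [ffun a => K (s a)])) /=; last first.
  exists (fun i : {ffun 'I_d -> _} => [ffun a => i (s^-1 a)%g]) => i _.
    exact: perm_idxK.
  exact: perm_idxVK.
apply: eq_bigr => K _; rewrite linearZ /= ffunE tsact_tenstens -!ghom_sact.
have -> : fst_idx [ffun a => K (s a)] = [ffun a => fst_idx K (s a)].
  by apply/ffunP => a; rewrite !ffunE.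
have -> : snd_idx [ffun a => K (s a)] = [ffun a => snd_idx K (s a)].
  by apply/ffunP => a; rewrite !ffunE.
by rewrite !tsact_tgen.
Qed.
Definition gtens V V' W W' (f : ghom V V') (g : ghom W W') :
  ghom (pktens V W) (pktens V' W') := GHom (gtens_subproof f g).

(* characterizes the tensor product of morphisms of Gamma^d P_k *)
Lemma gtensE V V' W W' (f : ghom V V') (g : ghom W W') t u :
  gtens f g (tenstens t u) = tenstens (f t) (g u).
Proof.
have hl (y : tens W') : linear (fun z : tens V' => tenstens z y).
  by move=> a z z'; exact: tenstensPl.
have hr (z : tens V') : linear (tenstens z : tens W' -> _).
  by move=> a y y'; exact: tenstensPr.
pose Hl y := HB.pack_for {linear tens V' -> tens (pktens V' W')} (fun z => tenstens z y)
  (GRing.isLinear.Build k _ _ *:%R _ (hl y)).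
pose Hr z := HB.pack_for {linear tens W' -> tens (pktens V' W')} (tenstens z)
  (GRing.isLinear.Build k _ _ *:%R _ (hr z)).
rewrite [in RHS](tens_tgen t) [in RHS](tens_tgen u) !linear_sum.
rewrite -[RHS]/(Hl _ _) linear_sum /= /gtens_fun sum_pair_idx.
apply: eq_bigr => i _; rewrite -[RHS]/(Hr _ _) linear_sum /=.
apply: eq_bigr => p _; rewrite ffunE fst_pair_idx snd_pair_idx.
rewrite !linearZ -[tenstens (_ *: _) _]/(Hl _ _) linearZ /=.
by rewrite -[tenstens _ (_ *: _)]/(Hr _ _) linearZ /= scalerA mulrC.
Qed.

End DividedPowerCategory.

Lemma linear_ext (k : comPzRingType) (M N : lmodType k) (f g : {linear M -> N}) :
  f =1 g -> f = g.
Proof.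
case: f g => f [[a1] [a2]] [g [[b1] [b2]]] /= /funext fg; subst g.
by rewrite (Prop_irrelevance a1 b1) (Prop_irrelevance a2 b2).
Qed.

Section StrictPolynomialFunctors.
Variables (k : comPzRingType) (d : nat).
Local Notation pk := (pk k).
Local Notation tens := (@tens k d).
Local Notation ghom := (@ghom k d).

(* k-linear functors from Gamma^d P_k to k-modules *)
Record rep := Rep {
  robj :> pk -> lmodType k;
  rmap : forall V W, ghom V W -> {linear robj V -> robj W};
  rmap_linear : forall V W a (f g : ghom V W) x,
    rmap (a *: f + g) x = a *: rmap f x + rmap g x;
  rmap_id : forall V x, rmap (gidm d V) x = x;
  rmap_comp : forall U V W (g : ghom V W) (f : ghom U V) x,
    rmap (gcomp g f) x = rmap g (rmap f x) }.

Record nat_trans (X Y : rep) := NatTrans {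
  ntr :> forall V, {linear X V -> Y V};
  ntr_nat : forall V W (f : ghom V W) x, ntr W (rmap X f x) = rmap Y f (ntr V x) }.

Lemma nt_ext X Y (f g : nat_trans X Y) : (forall V x, f V x = g V x) -> f = g.
Proof.
case: f g => [f fn] [g gn] /= fg.
have e : f = g.
  by apply: functional_extensionality_dep => V; apply: linear_ext; exact: fg.
by subst g; congr NatTrans; exact: Prop_irrelevance.
Qed.

Definition nt_id X : nat_trans X X := @NatTrans X X (fun V => idfun) (fun _ _ _ _ => erefl).

Lemma nt_comp_subproof X Y Z (g : nat_trans Y Z) (f : nat_trans X Y) V W (h : ghom V W) x :
  (g W \o f W) (rmap X h x) = rmap Z h ((g V \o f V) x).
Proof. by rewrite /= !ntr_nat. Qed.
Definition nt_comp X Y Z (g : nat_trans Y Z) (f : nat_trans X Y) : nat_trans X Z :=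
  @NatTrans X Z (fun V => g V \o f V) (nt_comp_subproof g f).

Definition zero_fun (M N : lmodType k) (x : M) : N := 0.
Lemma zero_fun_linear (M N : lmodType k) : linear (@zero_fun M N).
Proof. by move=> a x y; rewrite scaler0 addr0. Qed.
HB.instance Definition _ (M N : lmodType k) :=
  GRing.isLinear.Build k M N *:%R (@zero_fun M N) (@zero_fun_linear M N).

Lemma nt_zero_subproof (X Y : rep) V W (f : ghom V W) (x : X V) :
  @zero_fun (X W) (Y W) (rmap X f x) = rmap Y f (@zero_fun (X V) (Y V) x).
Proof. by rewrite /zero_fun linear0. Qed.
Definition nt_zero (X Y : rep) : nat_trans X Y :=
  @NatTrans X Y (fun V => @zero_fun (X V) (Y V)) (@nt_zero_subproof X Y).

Definition rep0 : rep.
Proof.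
by refine (@Rep (fun=> 'rV[k]_0) (fun _ _ _ => idfun) _ _ _) => // *; exact: thinmx0 || apply/rowP => -[].
Defined.

(* Gamma^{d,V} = Hom(V, -) *)
Section Representable.
Variable V : pk.

Definition gcompl U W (g : ghom U W) (f : ghom V U) : ghom V W := gcomp g f.
Lemma gcompl_linear U W (g : ghom U W) : linear (gcompl g).
Proof. by move=> a f f'; apply: ghomP => t /=; rewrite linearP. Qed.
HB.instance Definition _ U W g :=
  GRing.isLinear.Build k (ghom V U) (ghom V W) *:%R (@gcompl U W g) (gcompl_linear g).

Definition Gamma : rep.
Proof.
refine (@Rep (fun W => ghom V W) (fun U W g => gcompl g) _ _ _).
- by move=> *; apply: ghomP.
- by move=> *; apply: ghomP.
- by move=> *; apply: ghomP.
Defined.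
End Representable.

(* f : V -> W induces Gamma^{d,W} -> Gamma^{d,V}; by Yoneda every morphism
   between these functors is of this form *)
Section RepresentableMap.
Variables (V W : pk) (f : ghom V W).
Definition gcompr U (g : ghom W U) : ghom V U := gcomp g f.
Lemma gcompr_linear U : linear (@gcompr U).
Proof. by move=> a g g'; apply: ghomP. Qed.
HB.instance Definition _ U :=
  GRing.isLinear.Build k (ghom W U) (ghom V U) *:%R (@gcompr U) (@gcompr_linear U).
Lemma gcompr_nat U U' (h : ghom U U') g :
  gcompr (rmap (Gamma W) h g) = rmap (Gamma V) h (gcompr g).
Proof. exact: ghomP. Qed.
Definition Gamma_map : nat_trans (Gamma W) (Gamma V) :=
  @NatTrans (Gamma W) (Gamma V) (fun U => @gcompr U) gcompr_nat.
End RepresentableMap.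

(* Quotients of the d-th tensor power functor *)
Section TensorQuotient.
Variable R : forall V, tens V -> Prop.
Hypothesis R_stable : forall V W (f : ghom V W) t, R t -> span (@R W) (f t).

Lemma tq_subproof V W (f : ghom V W) t : R t -> (qproj (@R W) \o f) t = 0.
Proof. by move=> Rt; rewrite /= -(linear0 (qproj (@R W))); apply/qprojP; rewrite subr0; exact: R_stable. Qed.

Definition tq_map V W (f : ghom V W) : {linear quotmod (@R V) -> quotmod (@R W)} :=
  qlin (tq_subproof f).

Lemma tq_mapE V W (f : ghom V W) t : tq_map f (qproj (@R V) t) = qproj (@R W) (f t).
Proof. exact: (qlift_proj (tq_subproof f)). Qed.

Definition tensor_quotient : rep.
Proof.
refine (@Rep (fun V => quotmod (@R V)) tq_map _ _ _).
- move=> V W a f g; apply: qprojW => t.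
  by rewrite !tq_mapE -linearP.
- by move=> V; apply: qprojW => t; exact: tq_mapE.
- move=> U V W g f; apply: qprojW => t. 
  by rewrite (tq_mapE f t) (tq_mapE g (f t)) (tq_mapE (gcomp g f) t).
Defined.
End TensorQuotient.

(* S^d: the coinvariants of the symmetric group *)
Definition sym_rel V (x : tens V) := exists s t, x = t - tsact s t.

Lemma sym_stable V W (f : ghom V W) t : sym_rel t -> span (@sym_rel W) (f t).
Proof.
move=> [s [u ->]]; apply: span_gen; exists s, (f u).
by rewrite linearB /= ghom_sact.
Qed.
Definition sym_power : rep := tensor_quotient sym_stable.

(* Lambda^d: kill the decomposable tensors with a repeated factor *)
Definition alt_rel V (x : tens V) :=
  exists (v : 'I_d -> pkmod V) a b, [/\ a != b, v a = v b & x = tprod v].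

Lemma tprod2E (V : pk) (v : 'I_d -> pkmod V) a b j : a != b ->
  tval (tprod v) j = (v a : 'rV_ _) 0 (j a) * (v b : 'rV_ _) 0 (j b) *
    \prod_(c | (c != a) && (c != b)) (v c : 'rV_ _) 0 (j c).
Proof.
move=> ab; rewrite /= ffunE (bigD1 a)//= (bigD1 b)/=; last by rewrite eq_sym.
by rewrite mulrA.
Qed.

Lemma alt_invariant (V : pk) (t : tens V) a b : a != b ->
  tsact (tperm a b) t = t -> span (@alt_rel V) t.
Proof.
move=> ab tE; pose sw (i : {ffun 'I_d -> 'I_(pk_dim V)}) := [ffun c => i (tperm a b c)].
have swK : involutive sw.
  by move=> i; apply/ffunP => c; rewrite !ffunE tpermK.
have tsw i : tval t (sw i) = tval t i by rewrite -[in RHS]tE /= ffunE.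
rewrite [t]tens_tgen (bigID (fun i : {ffun 'I_d -> _} => i a == i b)) /=; apply: spanD.
  apply: span_sum => i /eqP iab; apply/spanZ/span_gen.
  by exists (fun c => pkgen (i c)), a, b; rewrite iab.
rewrite (bigID (fun i : {ffun 'I_d -> 'I_(pk_dim V)} => (i a < i b)%N)) /=.
have -> : \sum_(i : {ffun 'I_d -> 'I_(pk_dim V)} | (i a != i b) && ~~ (i a < i b)%N) (tval t i : k) *: tgen (V := V) i =
    \sum_(i : {ffun 'I_d -> 'I_(pk_dim V)} | (i a != i b) && (i a < i b)%N) (tval t (sw i) : k) *: tgen (V := V) (sw i).
  rewrite (reindex_inj (inv_inj swK)); apply: eq_bigl => i.
  rewrite !ffunE tpermL tpermR eq_sym -!val_eqE /=.
  by case: ltngtP.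
rewrite -big_split /=; apply: span_sum => i /andP[_ iab].
rewrite tsw -scalerDr; apply: spanZ.
pose x := pkgen (i a); pose y := pkgen (i b).
pose w z c := if (c == a) || (c == b) then z else pkgen (i c) : pkmod V.
have wP z : span (@alt_rel V) (tprod (w z)).
  by apply: span_gen; exists (w z), a, b; rewrite /w !eqxx orbT.
have -> : tgen i + tgen (sw i) = tprod (w (x + y)) - tprod (w x) - tprod (w y).
  apply/val_inj/ffunP => j.
  pose P := \prod_(c | (c != a) && (c != b)) (pkgen (i c) : 'rV_ _) 0 (j c).
  pose X c := (x : 'rV_ _) 0 (j c); pose Y c := (y : 'rV_ _) 0 (j c).
  have wE z : tval (tprod (w z)) j =
      (z : 'rV_ _) 0 (j a) * (z : 'rV_ _) 0 (j b) * P.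
    rewrite (tprod2E _ _ ab) /w !eqxx orbT; congr (_ * _).
    by apply: eq_bigr => c /andP[/negbTE-> /negbTE->].
  have iE : tval (tgen i) j = X a * Y b * P by rewrite (tprod2E _ _ ab).
  have siE : tval (tgen (sw i)) j = Y a * X b * P.
    rewrite (tprod2E _ _ ab) !ffunE tpermL tpermR; congr (_ * _).
    apply: eq_bigr => c /andP[ca cb]; rewrite ffunE tpermD//; first by rewrite eq_sym.
    by rewrite eq_sym.
  transitivity (tval (tgen i) j + tval (tgen (sw i)) j); first by rewrite ffunE.
  transitivity (tval (tprod (w (x + y))) j - tval (tprod (w x)) j - tval (tprod (w y)) j);
    last by rewrite !ffunE.
  rewrite iE siE !wE.
  have xyE c : ((x + y : pkmod V) : 'rV_ _) 0 (j c) = X c + Y c by rewrite mxE.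
  rewrite !xyE -!/(X _) -!/(Y _).
  transitivity ((X a * Y b + Y a * X b) * P); first by rewrite mulrDl.
  rewrite -!mulrBl; congr (_ * _).
  by rewrite mulrDl !mulrDr addrA [RHS]addrAC addrK -[X a * X b + _ + _]addrA addrAC subrr add0r.
by apply: spanB; [apply: spanB|]; exact: wP.
Qed.

Lemma alt_stable V W (f : ghom V W) t : alt_rel t -> span (@alt_rel W) (f t).
Proof.
move=> [v [a [b [ab vab ->]]]]; apply: (alt_invariant ab).
rewrite -ghom_sact; congr (f _); apply/val_inj/ffunP => i.
rewrite /= !ffunE [RHS](reindex_inj (@perm_inj _ (tperm a b))).
apply: eq_bigr => c _; rewrite ffunE.
suff -> : v (tperm a b c) = v c by [].
by case: tpermP => [->|->|].
Qed.
Definition ext_power : rep := tensor_quotient alt_stable.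

End StrictPolynomialFunctors.

Section InternalTensor.
Variables (k : comPzRingType) (d : nat).
Local Notation pk := (pk k).
Local Notation ghom := (@ghom k d).
Local Notation rep := (rep k d).
Local Notation Gamma := (@Gamma k d).

Section Values.
Variables (X Y : rep) (U : pk).

(* maps Gamma^{d,V} -> X and Gamma^{d,W} -> Y, with an element of
   Gamma^{d, V (x) W} U *)
Record day_gen := DayGen {
  day_V : pk; day_x : nat_trans (Gamma day_V) X;
  day_W : pk; day_y : nat_trans (Gamma day_W) Y;
  day_h : ghom (pktens day_V day_W) U }.
HB.instance Definition _ := gen_eqMixin day_gen.
HB.instance Definition _ := gen_choiceMixin day_gen.

Definition day_sym V x W y h : freemod k day_gen := delta k (@DayGen V x W y h).

(* The relations of colim_{Gamma^V -> X} colim_{Gamma^W -> Y} Gamma^{V (x) W},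
   taken in k-linear functors: day_colim identifies elements along the arrows
   of the two index categories, day_lin makes every Gamma^{V (x) W} U -> colim
   linear.  The colimit is the k-linear one (Day convolution), that is, linear
   in the two index maps as well (day_linl, day_linr).  The last two relations
   follow from the others for d > 0, since X and Y are then already the
   ordinary colimits of the representables above them; for d = 0 they do not. *)
Inductive day_rel : freemod k day_gen -> Prop :=
| day_colim V V' (f : ghom V' V) (x : nat_trans (Gamma V') X)
    W W' (g : ghom W' W) (y : nat_trans (Gamma W') Y) h :
    day_rel (day_sym (nt_comp x (Gamma_map f)) (nt_comp y (Gamma_map g)) h
             - day_sym x y (gcomp h (gtens f g)))
| day_lin V (x : nat_trans (Gamma V) X) W (y : nat_trans (Gamma W) Y) a h h' :
    day_rel (day_sym x y (a *: h + h') - (a *: day_sym x y h + day_sym x y h'))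
| day_linl V (x x1 x2 : nat_trans (Gamma V) X) W (y : nat_trans (Gamma W) Y) a h :
    (forall Z t, x Z t = a *: x1 Z t + x2 Z t) ->
    day_rel (day_sym x y h - (a *: day_sym x1 y h + day_sym x2 y h))
| day_linr V (x : nat_trans (Gamma V) X) W (y y1 y2 : nat_trans (Gamma W) Y) a h :
    (forall Z t, y Z t = a *: y1 Z t + y2 Z t) ->
    day_rel (day_sym x y h - (a *: day_sym x y1 h + day_sym x y2 h)).

Definition day_obj : lmodType k := quotmod day_rel.

Definition day_in V x W y h : day_obj := qproj day_rel (@day_sym V x W y h).

Lemma day_in_colim V V' (f : ghom V' V) (x : nat_trans (Gamma V') X)
    W W' (g : ghom W' W) (y : nat_trans (Gamma W') Y) h :
  day_in (nt_comp x (Gamma_map f)) (nt_comp y (Gamma_map g)) h =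
  day_in x y (gcomp h (gtens f g)).
Proof. by apply/qprojP/span_gen; exact: day_colim. Qed.

Lemma day_in_lin V (x : nat_trans (Gamma V) X) W (y : nat_trans (Gamma W) Y) a h h' :
  day_in x y (a *: h + h') = a *: day_in x y h + day_in x y h'.
Proof. by rewrite /day_in -linearP; apply/qprojP/span_gen; exact: day_lin. Qed.

Lemma day_in_linl V (x x1 x2 : nat_trans (Gamma V) X) W (y : nat_trans (Gamma W) Y) a h :
  (forall Z t, x Z t = a *: x1 Z t + x2 Z t) ->
  day_in x y h = a *: day_in x1 y h + day_in x2 y h.
Proof. by move=> xE; rewrite /day_in -linearP; apply/qprojP/span_gen; exact: day_linl. Qed.

Lemma day_in_linr V (x : nat_trans (Gamma V) X) W (y y1 y2 : nat_trans (Gamma W) Y) a h :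
  (forall Z t, y Z t = a *: y1 Z t + y2 Z t) ->
  day_in x y h = a *: day_in x y1 h + day_in x y2 h.
Proof. by move=> yE; rewrite /day_in -linearP; apply/qprojP/span_gen; exact: day_linr. Qed.

Section Desc.
Variables (N : lmodType k) (F : day_gen -> N).
Definition day_compat := forall r, day_rel r -> flift F r = 0.

Lemma day_compatP :
  (forall V V' (f : ghom V' V) (x : nat_trans (Gamma V') X)
      W W' (g : ghom W' W) (y : nat_trans (Gamma W') Y) h,
    F (DayGen (nt_comp x (Gamma_map f)) (nt_comp y (Gamma_map g)) h) =
    F (DayGen x y (gcomp h (gtens f g)))) ->
  (forall V (x : nat_trans (Gamma V) X) W (y : nat_trans (Gamma W) Y) a h h',
    F (DayGen x y (a *: h + h')) = a *: F (DayGen x y h) + F (DayGen x y h')) ->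
  (forall V (x x1 x2 : nat_trans (Gamma V) X) W (y : nat_trans (Gamma W) Y) a h,
    (forall Z t, x Z t = a *: x1 Z t + x2 Z t) ->
    F (DayGen x y h) = a *: F (DayGen x1 y h) + F (DayGen x2 y h)) ->
  (forall V (x : nat_trans (Gamma V) X) W (y y1 y2 : nat_trans (Gamma W) Y) a h,
    (forall Z t, y Z t = a *: y1 Z t + y2 Z t) ->
    F (DayGen x y h) = a *: F (DayGen x y1 h) + F (DayGen x y2 h)) ->
  day_compat.
Proof.
move=> c l ll lr r [V V' f x W W' g y h|V x W y a h h'|V x x1 x2 W y a h xE
  |V x W y y1 y2 a h yE]; rewrite linearB; apply/eqP; rewrite subr_eq0; apply/eqP;
  rewrite ?linearP /= !flift_delta.
- exact: c.
- exact: l.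
- exact: ll.
- exact: lr.
Qed.

Hypothesis FP : day_compat.
Definition day_desc : {linear day_obj -> N} := qlin FP.
Lemma day_descE V x W y h : day_desc (@day_in V x W y h) = F (DayGen x y h).
Proof. exact: etrans (qlift_proj FP _) (flift_delta _ _). Qed.
End Desc.

Lemma day_ind (P : day_obj -> Prop) : P 0 ->
  (forall a V x W y h u, P u -> P (a *: @day_in V x W y h + u)) -> forall u, P u.
Proof.
move=> P0 PD; apply: qprojW => t; rewrite [t]free_span /flift.
elim: (supp t) => [|[V x W y h] s IH]; first by rewrite big_nil linear0.
by rewrite big_cons linearP; exact: PD.
Qed.

End Values.

Section Functor.
Variables X Y : rep.

Definition day_push U U' (f : ghom U U') (g : day_gen X Y U) : day_obj X Y U' :=
  day_in (day_x g) (day_y g) (gcomp f (day_h g)).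

Lemma day_push_compat U U' (f : ghom U U') : day_compat (day_push f).
Proof.
apply: day_compatP => [V V' g x W W' g' y h|V x W y a h h'|V x x1 x2 W y a h xE
  |V x W y y1 y2 a h yE]; rewrite /day_push /=.
- by rewrite day_in_colim; congr day_in; exact: ghomP.
- by rewrite -day_in_lin; congr day_in; apply: ghomP => t /=; rewrite linearP.
- exact: day_in_linl.
- exact: day_in_linr.
Qed.

Definition day_rmap U U' (f : ghom U U') : {linear day_obj X Y U -> day_obj X Y U'} :=
  day_desc (day_push_compat f).

Lemma day_rmapE U U' (f : ghom U U') V x W y h :
  day_rmap f (@day_in X Y U V x W y h) = day_in x y (gcomp f h).
Proof. exact: (day_descE (day_push_compat f)). Qed.

Definition day : rep.
Proof.
refine (@Rep k d (day_obj X Y) day_rmap _ _ _).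
- move=> U U' a f g; apply: day_ind => [|b V x W y h u IH]; first by rewrite !linear0 ?scaler0 ?addr0.
  rewrite !linearP IH !day_rmapE.
  have -> : gcomp (a *: f + g) h = a *: gcomp f h + gcomp g h by exact: ghomP.
  by rewrite day_in_lin !scalerDr addrACA !scalerA mulrC.
- move=> U; apply: day_ind => [|b V x W y h u IH]; first by rewrite linear0.
  rewrite linearP IH day_rmapE; congr (_ *: _ + _); congr day_in; exact: ghomP.
- move=> U U' U'' g f; apply: day_ind => [|b V x W y h u IH]; first by rewrite !linear0.
  rewrite !linearP IH !day_rmapE; congr (_ *: _ + _); congr day_in; exact: ghomP.
Defined.

End Functor.

(* functoriality of X (x) - *)
Section FunctorMap.
Variables (X Y Y' : rep) (e : nat_trans Y Y').

Definition day_post U (g : day_gen X Y U) : day_obj X Y' U :=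
  day_in (day_x g) (nt_comp e (day_y g)) (day_h g).

Lemma nt_compA A B C D (h : @nat_trans k d C D) (g : @nat_trans k d B C) (f : @nat_trans k d A B) :
  nt_comp h (nt_comp g f) = nt_comp (nt_comp h g) f.
Proof. exact: nt_ext. Qed.

Lemma day_post_compat U : day_compat (@day_post U).
Proof.
apply: day_compatP => [V V' g x W W' g' y h|V x W y a h h'|V x x1 x2 W y a h xE
  |V x W y y1 y2 a h yE]; rewrite /day_post /=.
- by rewrite nt_compA day_in_colim.
- exact: day_in_lin.
- exact: day_in_linl.
- by apply: day_in_linr => Z t /=; rewrite yE linearP.
Qed.

Definition day_mapU U : {linear day_obj X Y U -> day_obj X Y' U} :=
  day_desc (@day_post_compat U).

Lemma day_mapUE U V x W y h :
  day_mapU U (@day_in X Y U V x W y h) = day_in x (nt_comp e y) h.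
Proof. exact: (day_descE (@day_post_compat U)). Qed.

Lemma day_map_nat U U' (f : ghom U U') (u : day X Y U) :
  day_mapU U' (rmap (day X Y) f u) = rmap (day X Y') f (day_mapU U u).
Proof.
elim/day_ind: u => [|b V x W y h u IH]; first by rewrite !linear0.
rewrite !linearP IH; congr (_ *: _ + _).
apply: etrans (congr1 (@day_mapU U') (day_rmapE f x y h)) _; rewrite !day_mapUE.
by apply: esym; exact: day_rmapE.
Qed.

Definition day_map : nat_trans (day X Y) (day X Y') :=
  @NatTrans k d (day X Y) (day X Y') day_mapU day_map_nat.
End FunctorMap.

Lemma day_map_comp0 X Y Y' Y'' (f : nat_trans Y Y') (g : nat_trans Y' Y'') :
  (forall U t, g U (f U t) = 0) -> forall U u, day_map X g U (day_map X f U u) = 0.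
Proof.
move=> gf0 U; apply: day_ind => [|b V x W y h u IH]; first by rewrite !linear0.
rewrite !linearP IH addr0 -[day_map X f U _]/(day_mapU X f U _) day_mapUE.
rewrite -[day_map X g U _]/(day_mapU X g U _) day_mapUE.
set z := nt_comp g _; have z0 Z t : z Z t = 1 *: z Z t + z Z t.
  by rewrite /z /= gf0 scaler0 addr0.
have := day_in_linr x h z0; rewrite scale1r => /(congr1 (fun v => v - day_in x z h)).
by rewrite subrr addrK => <-; rewrite scaler0.
Qed.

End InternalTensor.

Section DerivedCategory.
Variables (k : comPzRingType) (d : nat).
Local Notation rep := (rep k d).

(* Unbounded cochain complexes in Rep Gamma^d_k.  Every integer is of the form
   i + 1, so that stating conditions in degree i + 1 avoids transports. *)
Record cplx := Cplx {
  cob :> int -> rep;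
  cdiff : forall i, nat_trans (cob i) (cob (i + 1));
  cdiff2 : forall i V x, cdiff (i + 1) V (cdiff i V x) = 0 }.

Record chain_map (X Y : cplx) := ChainMap {
  cmap :> forall i, nat_trans (X i) (Y i);
  cmap_diff : forall i V x, cmap (i + 1) V (cdiff X i V x) = cdiff Y i V (cmap i V x) }.

Definition cm_id X : chain_map X X :=
  @ChainMap X X (fun i => nt_id (X i)) (fun _ _ _ => erefl).

Lemma cm_comp_subproof X Y Z (g : chain_map Y Z) (f : chain_map X Y) i V x :
  nt_comp (g (i + 1)) (f (i + 1)) V (cdiff X i V x) =
  cdiff Z i V (nt_comp (g i) (f i) V x).
Proof. by rewrite /= !cmap_diff. Qed.
Definition cm_comp X Y Z (g : chain_map Y Z) (f : chain_map X Y) : chain_map X Z :=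
  @ChainMap X Z (fun i => nt_comp (g i) (f i)) (cm_comp_subproof g f).

Definition is_cycle (X : cplx) i V (x : X i V) := cdiff X i V x = 0.
Definition is_boundary (X : cplx) i V (x : X (i + 1) V) := exists y : X i V, x = cdiff X i V y.

Definition acyclic (X : cplx) := forall i V (x : X (i + 1) V), is_cycle x -> is_boundary x.

(* The map induced on H^{i+1} = cycles / boundaries is injective, resp.
   surjective, in every degree. *)
Definition quasi_iso X Y (f : chain_map X Y) := forall i V,
  (forall x : X (i + 1) V, is_cycle x -> is_boundary (f (i + 1) V x) -> is_boundary x) /\
  (forall y : Y (i + 1) V, is_cycle y ->
     exists2 x : X (i + 1) V, is_cycle x & is_boundary (f (i + 1) V x - y)).

Definition null_homotopic X Y (f : chain_map X Y) :=
  exists s : forall i, nat_trans (X (i + 1)) (Y i), forall i V (x : X (i + 1) V),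
    f (i + 1) V x = cdiff Y i V (s i V x) + s (i + 1) V (cdiff X (i + 1) V x).

Definition K_projective (P : cplx) :=
  forall N (f : chain_map P N), acyclic N -> null_homotopic f.

(* D(Rep Gamma^d_k): the localization of the category of complexes at the
   quasi-isomorphisms.  Morphisms are formal composites of chain maps and
   formal inverses of quasi-isomorphisms, up to the congruence D_eq. *)
Inductive D_hom : cplx -> cplx -> Type :=
| D_loc X Y of chain_map X Y : D_hom X Y
| D_inv X Y (w : chain_map X Y) of quasi_iso w : D_hom Y X
| D_comp X Y Z of D_hom Y Z & D_hom X Y : D_hom X Z.

Definition D_id X := D_loc (cm_id X).

Inductive D_eq : forall X Y, D_hom X Y -> D_hom X Y -> Prop :=
| D_refl X Y (f : D_hom X Y) : D_eq f f
| D_sym X Y (f g : D_hom X Y) : D_eq f g -> D_eq g f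
| D_trans X Y (f g h : D_hom X Y) : D_eq f g -> D_eq g h -> D_eq f h
| D_congr X Y Z (g g' : D_hom Y Z) (f f' : D_hom X Y) :
    D_eq g g' -> D_eq f f' -> D_eq (D_comp g f) (D_comp g' f')
| D_assoc W X Y Z (h : D_hom Y Z) (g : D_hom X Y) (f : D_hom W X) :
    D_eq (D_comp h (D_comp g f)) (D_comp (D_comp h g) f)
| D_id_l X Y (f : D_hom X Y) : D_eq (D_comp (D_id Y) f) f
| D_id_r X Y (f : D_hom X Y) : D_eq (D_comp f (D_id X)) f
| D_loc_comp X Y Z (g : chain_map Y Z) (f : chain_map X Y) :
    D_eq (D_loc (cm_comp g f)) (D_comp (D_loc g) (D_loc f))
| D_inv_l X Y (w : chain_map X Y) (qw : quasi_iso w) :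
    D_eq (D_comp (D_inv qw) (D_loc w)) (D_id X)
| D_inv_r X Y (w : chain_map X Y) (qw : quasi_iso w) :
    D_eq (D_comp (D_loc w) (D_inv qw)) (D_id Y).

Definition D_iso X Y := exists (f : D_hom X Y) (g : D_hom Y X),
  D_eq (D_comp g f) (D_id X) /\ D_eq (D_comp f g) (D_id Y).

(* the complex X concentrated in degree 0 *)
Definition conc_obj (X : rep) (i : int) : rep := if i is Posz 0 then X else rep0 k d.
Definition conc (X : rep) : cplx :=
  @Cplx (conc_obj X) (fun i => nt_zero _ _) (fun _ _ _ => erefl).

Definition tensor_cplx (X : rep) (Y : cplx) : cplx :=
  @Cplx (fun i => day X (Y i)) (fun i => day_map X (cdiff Y i))
    (fun i => day_map_comp0 (@cdiff2 Y i)).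

Record K_projective_resolution (Y : cplx) := KProjRes {
  kp_cplx :> cplx;
  kp_map : chain_map kp_cplx Y;
  kp_projective : K_projective kp_cplx;
  kp_quasi_iso : quasi_iso kp_map }.

(* The derived tensor product X (x)^L Y = X (x) pY, computed with the resolution
   p of Y, for X concentrated in degree 0: the total tensor product of X and pY
   is then the termwise one. *)
Definition derived_tensor (X : rep) (Y : cplx) (p : K_projective_resolution Y) : cplx :=
  tensor_cplx X p.

End DerivedCategory.

(* Main.v *)
(* Lambda^d has a resolution P by direct sums of tensor products of divided powers (the
   bar construction): for a set J of adjacent transpositions, the summand of P of index J
   is the space of tensors invariant under the Young subgroup generated by J, it sits in
   degree - #|J|, and the differential is a signed sum of inclusions. Tensoring with
   Lambda^d turns this summand into the tensors alternating along J, and the result is the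
   analogous complex resolving S^d. Both complexes are exact for the same reason. On a free
   module the tensors are functions on words, and the functions in the summand J which
   vanish below a word w in the lexicographic order have a nonzero value at w only if w
   ascends (weakly for P, strictly for the other complex) at all positions of J; so, up to
   a triangular change of basis, the complex is a sum over w of augmented chain complexes
   of full simplices. A general projective module is a retract of a free one. *)
From HB Require Import structures.
From mathcomp Require Import all_boot all_order all_fingroup all_algebra.
From mathcomp Require Import boolp mxtens.
Require Import Defs.

Set Implicit Arguments.
Unset Strict Implicit.
Unset Printing Implicit Defensive.

Import Order.TTheory GRing.Theory Num.Theory.
Local Open Scope ring_scope.

(** * The bar complex of a distributive family *)

(** Hence the invariants are generated by orbit sums instead of sums over the group, and a tensor
    counts as alternating at a position when it has the form [z - s z] for the transposition [s]
    there; this makes it vanish on words that repeat a letter there, even if 2 = 0. With these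
    choices all leading coefficients are 1. The Day convolution with the exterior power is a
    colimit, in which elements are hard to tell apart. It is compared with concrete tensors by
    [day_bar], which antisymmetrizes the exterior factor and multiplies. Injectivity on free modules
    comes from straightening: the relations reduce every class to words ascending strictly along
    [J], and antisymmetrizing over the Young subgroup separates these. The theorem concerns every
    K-projective resolution. The functor [day X] preserves homotopies, being additive, but it need
    not preserve quasi-isomorphisms, so two resolutions are compared by homotopy equivalences. *)

Section BarDifferential.
Variables (k : comPzRingType) (m : nat).
Implicit Types (J K : {set 'I_m}).

Definition bar_sign (a : 'I_m) J : k := (-1) ^+ #|[set b in J | (b < a)%N]|.

Lemma bar_sign0 a : bar_sign a set0 = 1.
Proof.
rewrite /bar_sign (_ : [set b in _ | _] = set0) ?cards0//.
by apply/setP => b; rewrite !inE.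
Qed.

Lemma bar_signU1 a b J : a != b -> b \notin J ->
  bar_sign a (b |: J) = if (b < a)%N then - bar_sign a J else bar_sign a J.
Proof.
move=> ab bJ; rewrite /bar_sign; case: ltnP => ba.
  have -> : [set c in b |: J | (c < a)%N] = b |: [set c in J | (c < a)%N].
    by apply/setP => c; rewrite !inE; case: eqVneq => [->|].
  by rewrite cardsU1 inE (negbTE bJ) /= exprS mulN1r.
congr (_ ^+ #|pred_of_set _|); apply/setP => c; rewrite !inE.
by case: eqVneq => [->|//]; rewrite ltnNge ba (negbTE bJ).
Qed.

Variable M : lmodType k.
Implicit Types c : {set 'I_m} -> M.

(** The simplicial boundary of a chain with coefficients [c], read at the face [J]: every simplex
    [a |: J] that has [J] as a face contributes. *)
Definition bar_diff c J : M := \sum_(a | a \notin J) bar_sign a J *: c (a |: J).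

Lemma bar_diff_linear x c c' J :
  bar_diff (fun J => x *: c J + c' J) J = x *: bar_diff c J + bar_diff c' J.
Proof.
rewrite scaler_sumr -big_split; apply: eq_bigr => a _ /=.
by rewrite scalerDr !scalerA mulrC.
Qed.

Lemma eq_bar_diff c c' J : c =1 c' -> bar_diff c J = bar_diff c' J.
Proof. by move=> e; apply: eq_bigr => a _; rewrite e. Qed.

Lemma bar_diffB c c' J :
  bar_diff (fun J => c J - c' J) J = bar_diff c J - bar_diff c' J.
Proof.
rewrite -sumrB; apply: eq_bigr => a _ /=.
by rewrite scalerBr.
Qed.

(** The two ways of adding [a < b] to [J] cancel: inserting [a] first flips the sign of [b], whereas
    inserting [b] first leaves the sign of [a] unchanged. *)
Lemma bar_diffK c J : bar_diff (bar_diff c) J = 0.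
Proof.
pose F a b := bar_sign a J *: (bar_sign b (a |: J) *: c (b |: (a |: J))).
have E : bar_diff (bar_diff c) J = \sum_(a | a \notin J) \sum_(b | (b \notin J) && (b != a)) F a
  b.
  apply: eq_bigr => a aJ; rewrite scaler_sumr; apply: eq_bigl => b.
  by rewrite !inE negb_or andbC.
pose G a b := (a \notin J) && (b \notin J).
have {E}-> : bar_diff (bar_diff c) J =
    \sum_a \sum_(b | G a b && (a < b)%N) (F a b + F b a).
  rewrite E; under [RHS]eq_bigr do rewrite big_split /=.
  rewrite big_split /= [in X in _ = _ + X](exchange_big_dep predT) //= -big_split big_mkcond /=.
  apply: eq_bigr => a _; case: ifP => aJ; last first.
    by rewrite !big_pred0 ?addr0 // => b; rewrite /G aJ ?andbF.
  rewrite (bigID (fun b : 'I_m => (a < b)%N)) /=; congr (_ + _); apply: eq_bigl => b;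
    rewrite /G aJ ?andbT /= -!val_eqE /=; case: (b \notin J) => //=;
    by case: ltngtP.
rewrite big1// => a _; rewrite big1// => b /andP[/andP[aJ bJ] ab].
have nab : a != b by rewrite -val_eqE /= ltn_eqF.
rewrite /F !bar_signU1// 1?eq_sym// ab ltnNge ltnW //= setUCA !scalerA -scalerDl.
by rewrite mulrN [X in _ + X]mulrC addNr scale0r.
Qed.

End BarDifferential.

Lemma linear_bar_diff (k : comPzRingType) m (M N : lmodType k) (f : {linear M -> N})
  (c : {set 'I_m} -> M) J : f (bar_diff c J) = bar_diff (f \o c) J.
Proof. by rewrite linear_sum; apply: eq_bigr => a _; rewrite linearZ. Qed.

(** * Exactness for families controlled by leading words *)

Section BarExact.
Variables (k : comPzRingType) (m : nat) (T : finType) (lt : rel T).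
Implicit Types (J K : {set 'I_m}).
Hypothesis lt_trans : transitive lt.
Hypothesis lt_irr : irreflexive lt.
(** [A w] stands for the positions where [w] ascends. By [S_lead], a minimal word at which a
    function of [S J] is nonzero ascends along [J]; the last three hypotheses make every such word
    the leading word, with coefficient 1, of an element [gen J w] of [S J]. *)
Variable A : T -> {set 'I_m}.
Variable S : {set 'I_m} -> {ffun T -> k^o} -> Prop.
Variable gen : {set 'I_m} -> T -> {ffun T -> k^o}.
Hypothesis S_lin : forall J x f g, S J f -> S J g -> S J (x *: f + g).
Hypothesis S_anti : forall (J K : {set 'I_m}) f, K \subset J -> S J f -> S K f.
Hypothesis S_lead : forall (J : {set 'I_m}) f w, S J f -> (forall u, lt u w -> f u = 0) ->
  ~~ (J \subset A w) -> f w = 0.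
Hypothesis gen_S : forall (J : {set 'I_m}) w, J \subset A w -> S J (gen J w).
Hypothesis gen1 : forall (J : {set 'I_m}) w, J \subset A w -> gen J w w = 1.
Hypothesis gen0 : forall (J : {set 'I_m}) w u, J \subset A w -> u != w -> ~~ lt w u -> gen J w u
  = 0.

(** Strictly monotone for [lt], so words of equal rank are incomparable and can be treated
    together. *)
Let rk w := #|[set u | lt u w]|.

Let rk_lt u w : lt u w -> (rk u < rk w)%N.
Proof.
move=> uw; apply/proper_card/properP; split; last by exists u; rewrite !inE ?lt_irr.
by apply/subsetP => v; rewrite !inE => /lt_trans; apply.
Qed.

Let rk_ind (P : T -> Prop) : (forall w, (forall u, lt u w -> P u) -> P w) -> forall w, P w.
Proof.
move=> h w; have [n] := ubnP (rk w); elim: n w => // n IH w wn.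
by apply: h => u /rk_lt uw; apply: IH; exact: leq_trans uw wn.
Qed.

(** A minimal word at which [f - g] is nonzero would ascend along [J] by [S_lead], but there [f] and
    [g] agree. *)
Lemma lead_ext J f g : S J f -> S J g -> (forall w, J \subset A w -> f w = g w) -> f = g.
Proof.
move=> Sf Sg fg; have Sd := S_lin (-1) Sg Sf.
have d0 w : (-1 *: g + f) w = 0.
  elim/rk_ind: w => w IH; have [JA|nJA] := boolP (J \subset A w); last exact: S_lead Sd IH nJA.
  by rewrite !ffunE fg// scaleN1r addNr.
by apply/ffunP => w; have := d0 w; rewrite !ffunE scaleN1r addrC => /eqP;
  rewrite subr_eq0 => /eqP.
Qed.

(* At a word w of rank r the coefficients of a cycle vanishing at the words of smaller
   rank form a cycle in the augmented chain complex of the full simplex on A w, which is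
   contracted by the smallest vertex of A w. *)
Lemma bar_exact_step j r (c : {set 'I_m} -> {ffun T -> k^o}) :
    (forall J, S J (c J)) -> (forall J, #|J| != j.+1 -> c J = 0) ->
    (forall J, bar_diff c J = 0) ->
    (forall J w, (rk w < r)%N -> c J w = 0) ->
  exists b : {set 'I_m} -> {ffun T -> k^o},
    [/\ forall J, S J (b J), forall J, #|J| != j.+2 -> b J = 0 &
     forall J w, (rk w < r.+1)%N -> c J w = bar_diff b J w].
Proof.
move=> Sc cj cyc c0.
have cA J w : rk w = r -> ~~ (J \subset A w) -> c J w = 0.
  by move=> wr; apply: S_lead => // u /rk_lt; rewrite wr => /c0.
pose mn w := [pick a in A w | [forall b in A w, a <= b]%N].
pose be w J : k := if mn w is Some a then (if (a \in J) && (J \subset A w) then c (J :\ a) w else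
  0) else 0.
(* Only words of rank [r] are corrected: [gen J w] vanishes at smaller ranks and at the other words
   of rank [r], so at rank [r] the value of [b J] is exactly [be]. *)
pose b J := \sum_(w | rk w == r) be w J *: gen J w.
have S0 J : S J 0 by have := S_lin (-1) (Sc J) (Sc J); rewrite scaleN1r addNr.
exists b; split.
- move=> J; rewrite /b; elim/big_ind: _ => [||w _].
  + exact: S0.
  + by move=> f g Sf Sg; rewrite -[f]scale1r; exact: S_lin.
  + rewrite /be; case: (mn _) => [a|]; last by rewrite scale0r; exact: S0.
    case: ifP => [/andP[_ JA]|_]; last by rewrite scale0r; exact: S0.
    by rewrite -[_ *: _]addr0; apply: S_lin => //; exact: gen_S.
- move=> J Jj; rewrite /b big1// => w _; rewrite /be; case: (mn _) => [a|];
  last by rewrite scale0r.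
  case: ifP => [/andP[aJ _]|_]; last by rewrite scale0r.
  rewrite cj ?ffunE ?scale0r//; apply: contra Jj => /eqP e.
  by rewrite (cardsD1 a) aJ e.
move=> J u; rewrite ltnS leq_eqVlt => /orP[/eqP ur|ur]; last first.
  rewrite c0// sum_ffunE big1// => a _; rewrite ffunE /b sum_ffunE big1 ?scaler0// => w /eqP wr.
  rewrite ffunE /be; case: (mn _) => [a'|]; last by rewrite scale0r.
  case: ifP => [/andP[_ JA]|_]; last by rewrite scale0r.
  rewrite gen0 ?scaler0//; first by apply: contraTneq ur => ->; rewrite wr ltnn.
  by apply/negP => /rk_lt; rewrite wr ltnNge ltnW.
have bu K : b K u = be u K.
  rewrite /b sum_ffunE (bigD1 u) ?ur//= big1 ?addr0 => [|w /andP[/eqP wr wu]]; rewrite ffunE.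
    rewrite /be; case: (mn _) => [a|]; last by rewrite scale0r.
    by case: ifP => [/andP[_ KA]|_]; rewrite ?scale0r// gen1//; exact: mulr1.
  rewrite /be; case: (mn _) => [a'|]; last by rewrite scale0r.
  case: ifP => [/andP[_ JA]|_]; last by rewrite scale0r.
  rewrite gen0 ?scaler0//; first by rewrite eq_sym.
  by apply/negP => /rk_lt; rewrite ur wr ltnn.
have dE (c' : {set 'I_m} -> {ffun T -> k^o}) :
    bar_diff c' J u = \sum_(a | a \notin J) bar_sign k a J * c' (a |: J) u.
  by rewrite sum_ffunE; apply: eq_bigr => a _; rewrite ffunE.
rewrite dE; under eq_bigr do rewrite bu.
(* If [A u] is empty there is no apex to contract to. But a set of size [j.+1] is nonempty, hence
   not contained in [A u], and the coefficient is zero. *)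
rewrite /be /mn; case: pickP => [a0 /andP[a0A /forall_inP a0min]|none]; last first.
  rewrite [RHS]big1 => [|a _]; last by rewrite mulr0.
  have [/eqP Jc|/cj->] := boolP (#|J| == j.+1); last by rewrite ffunE.
  apply: cA => //; apply/negP => JA.
  have /card_gt0P[a aJ] : (0 < #|J|)%N by rewrite Jc.
  have aA := subsetP JA _ aJ.
  have [a1 a1A a1min] := arg_minnP (fun b : 'I_m => val b) aA.
  by have /negP[] := none a1; apply/andP; split=> //; apply/forall_inP.
have sub a K : a \in A u -> (a |: K \subset A u) = (K \subset A u).
  by move=> aA; rewrite subUset sub1set aA.
have nsub a K : a \notin A u -> (a |: K \subset A u) = false.
  by move=> /negbTE aA; rewrite subUset sub1set aA.
have [a0J|a0J] := boolP (a0 \in J); last first.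
  rewrite (bigD1 a0)//= big1 ?addr0 => [|a /andP[aJ aa0]]; last first.
    by rewrite !inE eq_sym (negbTE aa0) (negbTE a0J) mulr0.
  rewrite setU11 sub//= setU1K//.
  have [JA|JA] := boolP (J \subset A u); last by rewrite mulr0 cA.
  rewrite /bar_sign; have -> : [set b in J | (b < a0)%N] = set0.
    apply/setP => b'; rewrite !inE; apply/negP => /andP[/(subsetP JA)/a0min].
    by rewrite leqNgt => /negP.
  by rewrite cards0 expr0 mul1r.
have [JA|JA] := boolP (J \subset A u); last first.
  rewrite cA// big1// => a _; have [aA|aA] := boolP (a \in A u).
    by rewrite sub// (negbTE JA) andbF mulr0.
  by rewrite nsub// andbF mulr0.
(* The cycle condition at [K] expresses [c J u] through the values at the sets [a |: K], which are
   the other terms of the boundary of the cone. *)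
pose K := J :\ a0; have a0K : a0 \notin K by rewrite setD11.
have /ffunP/(_ u) := cyc K; rewrite ffunE.
rewrite sum_ffunE (bigD1 a0)//= setD1K// ffunE.
have -> : bar_sign k a0 K = 1.
  rewrite /bar_sign; have -> : [set b in K | (b < a0)%N] = set0.
    apply/setP => b'; rewrite !inE; apply/negP => /andP[/andP[_ /(subsetP JA)/a0min]].
    by rewrite leqNgt => /negP.
  by rewrite cards0 expr0.
rewrite scale1r => /eqP; rewrite addr_eq0 => /eqP ->; rewrite -sumrN.
apply: eq_big => a; first by rewrite !inE; case: eqVneq => [->|]; rewrite ?a0J ?andbT.
move=> /andP[aK aa0]; rewrite ffunE.
have aKE : (a |: J) :\ a0 = a |: K.
  by apply/setP => x; rewrite !inE; case: (eqVneq x a) => [->|]; rewrite ?aa0// andbC.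
rewrite aKE; have [aA|aA] := boolP (a \in A u); last first.
  rewrite nsub// andbF mulr0 cA ?scaler0 ?oppr0//.
  by rewrite nsub.
rewrite sub// JA !inE a0J orbT /= -[J](setD1K a0J) bar_signU1 ?setD11//.
have -> : (a0 < a)%N by rewrite ltn_neqAle eq_sym aa0 a0min.
by rewrite mulNr.
Qed.

Lemma bar_exact j (c : {set 'I_m} -> {ffun T -> k^o}) :
    (forall J, S J (c J)) -> (forall J, #|J| != j.+1 -> c J = 0) ->
    (forall J, bar_diff c J = 0) ->
  exists b : {set 'I_m} -> {ffun T -> k^o},
    [/\ forall J, S J (b J), forall J, #|J| != j.+2 -> b J = 0 &
     forall J, c J = bar_diff b J].
Proof.
(* The cycle vanishes below rank [r], and [n] bounds the number of ranks still to be cleared; no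
   rank exceeds [#|T|]. *)
suff H n r : (#|T|.+1 <= r + n)%N -> forall c : {set 'I_m} -> {ffun T -> k^o},
    (forall J, S J (c J)) -> (forall J, #|J| != j.+1 -> c J = 0) ->
    (forall J, bar_diff c J = 0) -> (forall J w, (rk w < r)%N -> c J w = 0) ->
  exists b : {set 'I_m} -> {ffun T -> k^o},
    [/\ forall J, S J (b J), forall J, #|J| != j.+2 -> b J = 0 &
     forall J, c J = bar_diff b J].
  by move=> Sc cj cyc; apply: (H #|T|.+1 0) => //; rewrite addn1.
elim: n r => [|n IH] r rn {}c Sc cj cyc c0.
  exists (fun => 0); split=> // J.
    by have := S_lin (-1) (Sc J) (Sc J); rewrite scaleN1r addNr.
  rewrite [RHS]big1 => [|a _]; last by rewrite scaler0.
  apply/ffunP => w; rewrite ffunE c0//; rewrite addn0 in rn.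
  by apply: leq_trans rn; rewrite ltnS max_card.
have [b [Sb bj bE]] := bar_exact_step Sc cj cyc c0.
have Sd J : S J (bar_diff b J).
  rewrite /bar_diff; elim/big_ind: _ => [||a _].
  - by have := S_lin (-1) (Sc J) (Sc J); rewrite scaleN1r addNr.
  - by move=> f g Sf Sg; rewrite -[f]scale1r; exact: S_lin.
  - have Sba : S J (b (a |: J)) by apply: S_anti (Sb _); exact: subsetUr.
    rewrite -[_ *: _]addr0; apply: S_lin => //.
    by have := S_lin (-1) Sba Sba; rewrite scaleN1r addNr.
have [|||||b' [Sb' bj' bE']] := IH r.+1 _ (fun J => c J - bar_diff b J).
- by rewrite addSnnS.
- by move=> J; rewrite addrC -scaleN1r; exact: S_lin.
- move=> J Jj; rewrite cj// sub0r [bar_diff _ _]big1 ?oppr0// => a aJ.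
  by rewrite bj ?scaler0// cardsU1 aJ.
- by move=> J; rewrite bar_diffB bar_diffK cyc subr0.
- by move=> J w wr; rewrite !ffunE bE// subrr.
exists (fun J => b J + b' J); split=> [J|J Jj|J].
- by rewrite -[b J]scale1r; exact: S_lin.
- by rewrite bj// bj'// addr0.
- transitivity (1 *: bar_diff b J + bar_diff b' J); last first.
    by rewrite -bar_diff_linear; apply: eq_bar_diff => K; rewrite scale1r.
  by rewrite -bE' scale1r addrC subrK.
Qed.

End BarExact.

(** * Resolutions and the derived tensor product *)

Definition linear_pack (k : comPzRingType) (M N : lmodType k) (f : M -> N) (fl : linear f) :
  {linear M -> N} := HB.pack_for {linear M -> N} f (GRing.isLinear.Build k M N *:%R f fl).

Section Homotopy.
Variables (k : comPzRingType) (d : nat).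
Local Notation rep := (rep k d).
Local Notation cplx := (cplx k d).

Section NatTransBuild.
Variables (X Y : rep) (f : forall V, X V -> Y V) (fl : forall V, linear (@f V)).
Hypothesis fn : forall V W (h : ghom d V W) x, f (rmap X h x) = rmap Y h (f x).
Definition nt_build : nat_trans X Y := @NatTrans k d X Y (fun V => linear_pack (@fl V)) fn.
End NatTransBuild.

Section RepProd.
Variables X Y : rep.
Definition prod_map V W (h : ghom d V W) (x : X V * Y V) : X W * Y W :=
  (rmap X h x.1, rmap Y h x.2).
Lemma prod_map_linear V W (h : ghom d V W) : linear (prod_map h).
Proof. by move=> a x y; rewrite /prod_map /= !linearP. Qed.
Definition rep_prod : rep.
Proof.
refine (@Rep k d (fun V => (X V * Y V)%type) (fun V W h => linear_pack (prod_map_linear h)) _ _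
  _).
- by move=> V W a f g x; rewrite /= /prod_map !rmap_linear.
- by move=> V [x y]; rewrite /= /prod_map !rmap_id.
- by move=> U V W g f [x y]; rewrite /= /prod_map !rmap_comp.
Defined.
End RepProd.

(** * Mapping cones and lifting from K-projective complexes *)

Section Cone.
Variables (P Y : cplx) (w : chain_map P Y).

Definition cone_obj (i : int) := rep_prod (P (i + 1)) (Y i).
Definition cone_fun i V (x : cone_obj i V) : cone_obj (i + 1) V :=
  (- cdiff P (i + 1) V x.1, w (i + 1) V x.1 + cdiff Y i V x.2).
Lemma cone_fun_linear i V : linear (@cone_fun i V).
Proof.
move=> a x y; congr pair; rewrite /= !linearP //=.
by rewrite scalerDr addrACA.
Qed.
Lemma cone_fun_nat i V W (h : ghom d V W) x :
  cone_fun (rmap (cone_obj i) h x) = rmap (cone_obj (i + 1)) h (cone_fun x).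
Proof.
by rewrite /cone_fun /= /prod_map /= !ntr_nat linearN linearD.
Qed.
Definition cone : cplx.
Proof.
refine (@Cplx k d cone_obj (fun i => nt_build (@cone_fun_linear i) (@cone_fun_nat i)) _).
move=> i V x; congr pair; rewrite /=.
  by rewrite [cdiff _ _ _ (- _)]linearN opprK cdiff2.
by rewrite [w _ _ _]linearN linearD /= cdiff2 addr0 cmap_diff addNr.
Defined.

Lemma cone_acyclic : quasi_iso w -> acyclic cone.
Proof.
move=> qw i V [p y] /= h.
have dp : cdiff P (i + 1 + 1) V p = 0 by apply/eqP; rewrite -oppr_eq0; apply/eqP/(congr1 fst h).
have wp : w (i + 1 + 1) V p = - cdiff Y (i + 1) V y.
  by apply/eqP; rewrite -addr_eq0; apply/eqP/(congr1 snd h).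
have [p' p'E] : is_boundary p.
  by apply: (qw (i + 1) V).1 dp _; exists (- y); rewrite wp linearN.
have cy : is_cycle (w (i + 1) V p' + y).
  by rewrite /is_cycle linearD /= -cmap_diff -p'E wp addNr.
have [q dq [z zE]] := (qw i V).2 _ cy.
exists (q - p', - z); congr pair; rewrite /=.
  by rewrite linearB /= dq sub0r opprK.
rewrite linearB [cdiff _ _ _ (- z)]linearN /= -zE opprB [RHS]addrC addrA subrK.
by rewrite addrC addKr.
Qed.
End Cone.

Definition homotopic (X Y : cplx) (f g : chain_map X Y) :=
  exists s : forall i, nat_trans (X (i + 1)) (Y i), forall i V (x : X (i + 1) V),
    f (i + 1) V x = g (i + 1) V x + (cdiff Y i V (s i V x) + s (i + 1) V (cdiff X (i + 1) V x)).

Lemma int_succ_ind (P : int -> Prop) : (forall i, P (i + 1)) -> forall i, P i.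
Proof. by move=> h i; rewrite -[i](subrK 1). Qed.

(** Homotopies provide data in degrees [i + 1] only, whereas a chain map needs them in every degree
    [i]. The transport along [i - 1 + 1 = i] is confined to this lemma. *)
Lemma int_succ_family (T : int -> Type) (a : forall i, T (i + 1)) :
  exists b : forall i, T i, forall i, b (i + 1) = a i.
Proof.
exists (fun i => eq_rect (i - 1 + 1) T (a (i - 1)) i (subrK 1 i)) => i.
move: (subrK _ _); move: (addrK 1 i : i + 1 - 1 = i).
by move: (i + 1 - 1) => j ji; subst j => e; rewrite (eq_irrelevance e erefl).
Qed.

(** The chain map [(0, f)] into the acyclic cone of [w] is null-homotopic. The first component of
    the homotopy is the chain map [g], the second one a homotopy between [f] and [w g]. *)
Lemma lift_quasi_iso (Q P Y : cplx) (w : chain_map P Y) (f : chain_map Q Y) :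
  K_projective Q -> quasi_iso w -> exists g : chain_map Q P, homotopic f (cm_comp w g).
Proof.
move=> KQ /cone_acyclic aw.
have Fl i V : linear (fun x => (0, f i V x) : cone w i V).
  by move=> a x y; congr pair; rewrite /= ?linearP// scaler0 addr0.
have Fn i V W (h : ghom d V W) x :
    (0, f i W (rmap (Q i) h x)) = rmap (cone w i) h (0, f i V x : Y i V) :> cone w i W.
  by rewrite /= /prod_map /= linear0 ntr_nat.
have Fd i V x : nt_build (@Fl (i + 1)) (@Fn (i + 1)) V (cdiff Q i V x) =
    cdiff (cone w) i V (nt_build (@Fl i) (@Fn i) V x).
  by congr pair; rewrite /= ?linear0 ?oppr0// add0r cmap_diff.
have [s sE] := KQ _ (ChainMap Fd) aw.
have [g gE] := int_succ_family (T := fun i => nat_trans (Q i) (P i)) (fun i => nt_build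
  (f := fun V x => (s i V x).1) (fun V a x y => congr1 fst (linearP (s i V) a x y))
  (fun V W h x => congr1 fst (ntr_nat (s i) h x))).
have gd i V x : g (i + 1) V (cdiff Q i V x) = cdiff P i V (g i V x).
  move: i V x; apply: int_succ_ind => i V x; rewrite !gE /=.
  have /(congr1 fst)/= := sE i V x.
  by move=> /esym/addr0_eq <-; rewrite opprK.
exists (ChainMap gd), (fun i => nt_build
  (f := fun V x => (s i V x).2) (fun V a x y => congr1 snd (linearP (s i V) a x y))
  (fun V W h x => congr1 snd (ntr_nat (s i) h x))) => i V x.
have /(congr1 snd)/= := sE i V x.
by rewrite gE /= => ->; rewrite addrA.
Qed.

Lemma quasi_iso_comp (X Y Z : cplx) (g : chain_map Y Z) (f : chain_map X Y) :
  quasi_iso g -> quasi_iso f -> quasi_iso (cm_comp g f).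
Proof.
move=> qg qf i V; split=> [x cx /= bx|z cz].
  by apply: (qf i V).1 => //; apply: (qg i V).1 => //; rewrite /is_cycle -cmap_diff cx linear0.
have [y cy [u uE]] := (qg i V).2 z cz; have [x cx [v vE]] := (qf i V).2 y cy.
exists x => //; exists (g i V v + u).
by rewrite linearD /= -uE -cmap_diff -vE linearB addrA subrK.
Qed.

Lemma quasi_iso_right (X Y Z : cplx) (g : chain_map Y Z) (f : chain_map X Y) (h : chain_map X Z) :
  homotopic h (cm_comp g f) -> quasi_iso g -> quasi_iso h -> quasi_iso f.
Proof.
move=> [s sE] qg qh i V.
have hE (x : X (i + 1) V) : is_cycle x ->
    h (i + 1) V x = g (i + 1) V (f (i + 1) V x) + cdiff Z i V (s i V x).
  by move=> cx; rewrite sE cx linear0 addr0.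
split=> [x cx [y yE]|y cy].
  apply: (qh i V).1 => //; rewrite hE// yE cmap_diff -linearD.
  by exists (g i V y + s i V x).
have cgy : is_cycle (g (i + 1) V y) by rewrite /is_cycle -cmap_diff cy linear0.
have [x cx [z zE]] := (qh i V).2 _ cgy; exists x => //.
apply: (qg i V).1; first by rewrite /is_cycle linearB /= cy -cmap_diff cx linear0 subrr.
exists (z - s i V x); rewrite !linearB /= -zE hE//.
by rewrite addrAC addrK.
Qed.

Lemma quasi_iso_id (X : cplx) : quasi_iso (cm_id X).
Proof. by move=> i V; split=> // y cy; exists y => //; exists 0; rewrite subrr linear0. Qed.

(** The left inverse gives injectivity on cohomology and the right inverse surjectivity. They will
    come from separate applications of K-projectivity, hence the two names. *)
Lemma homotopy_inverses_quasi_iso (X Y : cplx) (f : chain_map X Y) (g h : chain_map Y X) :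
  homotopic (cm_id X) (cm_comp g f) -> homotopic (cm_id Y) (cm_comp f h) -> quasi_iso f.
Proof.
move=> [s sE] [t tE] i V; split=> [x cx [y yE]|y cy].
  have := sE i V x; rewrite cx linear0 addr0 /= yE cmap_diff -linearD => ->.
  by eexists.
exists (h (i + 1) V y); first by rewrite /is_cycle -cmap_diff cy linear0.
exists (- t i V y); rewrite linearN.
have /= := tE i V y; rewrite cy linear0 addr0 => {2}->.
by rewrite opprD addrA subrr sub0r.
Qed.

Lemma quasi_iso_D_iso (X Y : cplx) (w : chain_map X Y) : quasi_iso w -> D_iso X Y.
Proof.
by move=> qw; exists (D_loc w), (D_inv qw); split; [exact: D_inv_l | exact: D_inv_r].
Qed.

(* By functoriality, the map on cohomology at V is a retract of the one at W. *)
Lemma quasi_iso_retract (X Y : cplx) (f : chain_map X Y) V W (a : ghom d V W) (b : ghom d W V) i :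
  gcomp b a = gidm d V ->
  ((forall x : X (i + 1) W, is_cycle x -> is_boundary (f (i + 1) W x) -> is_boundary x) /\
   (forall y : Y (i + 1) W, is_cycle y ->
     exists2 x : X (i + 1) W, is_cycle x & is_boundary (f (i + 1) W x - y))) ->
  ((forall x : X (i + 1) V, is_cycle x -> is_boundary (f (i + 1) V x) -> is_boundary x) /\
   (forall y : Y (i + 1) V, is_cycle y ->
     exists2 x : X (i + 1) V, is_cycle x & is_boundary (f (i + 1) V x - y))).
Proof.
move=> ba [inj sur].
have K (Z : rep) (z : Z V) : rmap Z b (rmap Z a z) = z by rewrite -rmap_comp ba rmap_id.
split=> [x cx [y yE]|y cy].
  have [||z zE] := inj (rmap _ a x).
  - by rewrite /is_cycle ntr_nat cx linear0.
  - by rewrite ntr_nat yE; exists (rmap _ a y); rewrite ntr_nat.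
  exists (rmap _ b z); rewrite ntr_nat -zE.
by rewrite K.
have [|x cx [z zE]] := sur (rmap _ a y); first by rewrite /is_cycle ntr_nat cy linear0.
exists (rmap _ b x); first by rewrite /is_cycle ntr_nat cx linear0.
exists (rmap _ b z); rewrite !ntr_nat -zE linearB /=.
by rewrite K.
Qed.

(** * Bounded complexes of projectives *)

Section BoundedProjective.
Variable P : cplx.
(** Projectivity for maps that land pointwise in the image of [e]. It will be applied to a
    differential of an acyclic complex, whose image consists of all cycles. *)
Hypothesis P_lift : forall i (A B : rep) (e : nat_trans A B) (g : nat_trans (P i) B),
  (forall V x, exists y, g V x = e V y) -> exists s : nat_trans (P i) A, forall V x,
    g V x = e V (s V x).
Variable n : nat.
Hypothesis P_above : forall i V (x : P i V), 0 < i -> x = 0.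
Hypothesis P_below : forall i V (x : P i V), i < - n%:Z -> x = 0.

Lemma bounded_projective_K_projective : K_projective P.
Proof.
move=> N f aN.
pose ok (s : forall i, nat_trans (P (i + 1)) (N i)) i := forall V (x : P (i + 1) V),
  f (i + 1) V x = cdiff N i V (s i V x) + s (i + 1) V (cdiff P (i + 1) V x).
(* The homotopy is built downwards, starting with zero in nonnegative degrees, where its source
   vanishes. *)
suff H m : exists s, forall i, - m%:Z <= i -> ok s i.
  have [s sE] := H n.+2; exists s => i V x; have [/sE//|im] := lerP (- n.+2%:Z) i.
  have i0 : i + 1 < - n%:Z by rewrite -ltrBrDr (lt_le_trans im)// -opprD lerN2 lez_nat addn1.
  by rewrite (P_below x i0) !linear0 addr0.
elim: m => [|m [s sE]].
  exists (fun i => nt_zero _ _) => i i0 V x.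
  by rewrite (P_above x) ?ltzD1// !linear0 addr0.
(* Quantified over [i], with the equation as a premise, so that [t i] has the right type in every
   degree without a transport. *)
have step i : exists t : nat_trans (P (i + 1)) (N i), i = - m.+1%:Z ->
    forall V (x : P (i + 1) V),
    f (i + 1) V x - s (i + 1) V (cdiff P (i + 1) V x) = cdiff N i V (t V x).
  have [ei|ni] := eqVneq i (- m.+1%:Z); last first.
    by exists (s i) => ei; rewrite ei eqxx in ni.
  have gl V : linear (fun x => f (i + 1) V x - s (i + 1) V (cdiff P (i + 1) V x)).
    by move=> a x y; rewrite !linearP /= scalerDr addrACA.
  have gn V W (h : ghom d V W) x : f (i + 1) W (rmap _ h x) - s (i + 1) W (cdiff P (i + 1) W
    (rmap _ h x)) =
      rmap (N (i + 1)) h (f (i + 1) V x - s (i + 1) V (cdiff P (i + 1) V x)).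
    by rewrite !ntr_nat linearB.
  have [|t tE] := @P_lift (i + 1) _ _ (cdiff N i) (nt_build gl gn); last first.
    by exists t => _ V x; exact: tE.
  move=> V x; apply: aN; rewrite /is_cycle /= linearB /= -cmap_diff sE; last first.
    by rewrite ei -addn1 PoszD opprD subrK.
  by rewrite cdiff2 linear0 addr0 subrr.
pose t i := projT1 (cid (step i)).
exists (fun i => if i == - m.+1%:Z then t i else s i) => i; rewrite /ok.
rewrite le_eqVlt => /orP[/eqP ei|mi] V x.
  have -> : i + 1 == - m.+1%:Z = false by rewrite -ei gt_eqF// ltzD1.
  have -> : (i == - m.+1%:Z) = true by rewrite -ei eqxx.
  have := projT2 (cid (step i)) (esym ei) V x; rewrite -/(t i) => <-.
  by rewrite subrK.
have mi' : - m%:Z <= i by rewrite -lezD1 -addn1 PoszD opprD subrK in mi.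
rewrite !gt_eqF//; first exact: sE.
by apply: lt_trans mi _; rewrite ltzD1.
Qed.
End BoundedProjective.

End Homotopy.

(** * Homotopy invariance of the tensor product *)

Section DayHomotopy.
Variables (k : comPzRingType) (d : nat).
Local Notation rep := (rep k d).
Local Notation cplx := (cplx k d).
Local Notation Gamma := (@Gamma k d).

Lemma day_mapE (X Y Y' : rep) (e : nat_trans Y Y') U V (x : nat_trans (Gamma V) X)
    W (y : nat_trans (Gamma W) Y) (h : ghom d (pktens V W) U) :
  day_map X e U (day_in x y h) = day_in x (nt_comp e y) h.
Proof. exact: day_mapUE. Qed.

Lemma day_map_add (X Y Y' : rep) (a b c : nat_trans Y Y') :
  (forall V y, a V y = b V y + c V y) ->
  forall U u, day_map X a U u = day_map X b U u + day_map X c U u.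
Proof.
move=> abc U; apply: day_ind => [|t V x W y h u IH]; first by rewrite !linear0 addr0.
rewrite !linearP IH !day_mapE.
rewrite (@day_in_linr k d X Y' U V x W _ (nt_comp b y) (nt_comp c y) 1); last first.
  by move=> Z z; rewrite /= abc scale1r.
by rewrite scale1r scalerDr addrACA.
Qed.

Lemma day_map_comp (X Y Y' Y'' : rep) (g : nat_trans Y' Y'') (f : nat_trans Y Y') U u :
  day_map X (nt_comp g f) U u = day_map X g U (day_map X f U u).
Proof.
elim/day_ind: u => [|t V x W y h u IH]; first by rewrite !linear0.
by rewrite !linearP IH !day_mapE nt_compA.
Qed.

Lemma day_map_id (X Y : rep) U u : day_map X (nt_id Y) U u = u.
Proof.
elim/day_ind: u => [|t V x W y h u IH]; first by rewrite !linear0.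
by rewrite linearP IH day_mapE; congr (_ *: day_in _ _ _ + _); exact: nt_ext.
Qed.

Section TensorChainMap.
Variables (X : rep) (Y Z : cplx) (f : chain_map Y Z).
Lemma tensor_chain_subproof i V u :
  day_map X (f (i + 1)) V (cdiff (tensor_cplx X Y) i V u) =
  cdiff (tensor_cplx X Z) i V (day_map X (f i) V u).
Proof.
rewrite -[LHS](day_map_comp (f (i + 1)) (cdiff Y i)) -[RHS](day_map_comp (cdiff Z i) (f i)).
by congr (ntr (day_map X _) V u); apply: nt_ext => W y /=; exact: cmap_diff.
Qed.
Definition tensor_chain_map : chain_map (tensor_cplx X Y) (tensor_cplx X Z) :=
  @ChainMap k d (tensor_cplx X Y) (tensor_cplx X Z) (fun i => day_map X (f i))
    tensor_chain_subproof.
End TensorChainMap.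

Lemma tensor_homotopic_id (X : rep) (Y Z : cplx) (f : chain_map Y Z) (g : chain_map Z Y) :
  homotopic (cm_id Y) (cm_comp g f) ->
  homotopic (cm_id (tensor_cplx X Y)) (cm_comp (tensor_chain_map X g) (tensor_chain_map X f)).
Proof.
move=> [s sE]; exists (fun i => day_map X (s i)) => i V x.
transitivity (day_map X (nt_id (Y (i + 1))) V x); first by rewrite day_map_id.
have -> : cm_comp (tensor_chain_map X g) (tensor_chain_map X f) (i + 1) V x =
    day_map X (nt_comp (g (i + 1)) (f (i + 1))) V x by rewrite day_map_comp.
have -> : cdiff (tensor_cplx X Y) i V (day_map X (s i) V x) =
    day_map X (nt_comp (cdiff Y i) (s i)) V x by rewrite day_map_comp.
have -> : day_map X (s (i + 1)) V (cdiff (tensor_cplx X Y) (i + 1) V x) =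
    day_map X (nt_comp (s (i + 1)) (cdiff Y (i + 1))) V x by rewrite day_map_comp.
have Sl W : linear (fun y => nt_comp (cdiff Y i) (s i) W y + nt_comp (s (i + 1)) (cdiff Y (i +
  1)) W y).
  by move=> a y z; rewrite !linearP addrACA scalerDr.
have Sn W W' (h : ghom d W W') y :
    nt_comp (cdiff Y i) (s i) W' (rmap _ h y) + nt_comp (s (i + 1)) (cdiff Y (i + 1)) W' (rmap _
      h y) =
    rmap _ h (nt_comp (cdiff Y i) (s i) W y + nt_comp (s (i + 1)) (cdiff Y (i + 1)) W y).
  by rewrite linearD !ntr_nat.
rewrite (@day_map_add _ _ _ _ (nt_comp (g (i + 1)) (f (i + 1))) (nt_build Sl Sn)) => [|W y].
  by congr (_ + _); apply: day_map_add.
exact: sE.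
Qed.

(** Three lifts, [b] from [q] to [p], then [a] with [b a] homotopic to the identity and [c] with
    [a c] homotopic to the identity, make [a] a homotopy equivalence. Its homotopies survive the
    additive functor [day X]. *)
Lemma derived_tensor_quasi_iso (X : rep) (Y : cplx) (p q : K_projective_resolution Y) :
  exists f : chain_map (derived_tensor X p) (derived_tensor X q), quasi_iso f.
Proof.
have [b bE] := lift_quasi_iso (kp_map q) (@kp_projective _ _ _ q) (@kp_quasi_iso _ _ _ p).
have qb := quasi_iso_right bE (@kp_quasi_iso _ _ _ p) (@kp_quasi_iso _ _ _ q).
have [a aE] := lift_quasi_iso (cm_id p) (@kp_projective _ _ _ p) qb.
have qa := quasi_iso_right aE qb (@quasi_iso_id _ _ p).
have [c cE] := lift_quasi_iso (cm_id q) (@kp_projective _ _ _ q) qa.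
exists (tensor_chain_map X a).
exact: homotopy_inverses_quasi_iso (tensor_homotopic_id X aE) (tensor_homotopic_id X cE).
Qed.

End DayHomotopy.

(** * Words and Young subgroups *)

Section Words.
Variable d : nat.
Implicit Types (J K : {set 'I_d.-1}) (s r : 'S_d).
Local Notation word n := {ffun 'I_d -> 'I_n}.

Definition wact n (w : word n) s : word n := [ffun a => w (s a)].

Lemma wactE n (w : word n) s a : wact w s a = w (s a).
Proof. exact: ffunE. Qed.

Lemma wact1 n (w : word n) : wact w 1%g = w.
Proof. by apply/ffunP => a; rewrite ffunE perm1. Qed.

Lemma wactM n (w : word n) s r : wact (wact w s) r = wact w (r * s)%g.
Proof. by apply/ffunP => a; rewrite !ffunE permM. Qed.

Lemma wactK n s : cancel (fun w : word n => wact w s) (fun w => wact w s^-1%g).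
Proof. by move=> w; rewrite wactM mulVg wact1. Qed.

Lemma wactVK n s : cancel (fun w : word n => wact w s^-1%g) (fun w => wact w s).
Proof. by move=> w; rewrite wactM mulgV wact1. Qed.

Definition adjl (a : 'I_d.-1) : 'I_d := widen_ord (leq_pred d) a.
Lemma adjr_subproof (a : 'I_d.-1) : (a.+1 < d)%N.
Proof. by rewrite -ltn_predRL. Qed.
Definition adjr (a : 'I_d.-1) : 'I_d := Ordinal (adjr_subproof a).
Definition adj (a : 'I_d.-1) : 'S_d := tperm (adjl a) (adjr a).

Lemma adj_neq a : adjl a != adjr a.
Proof. by rewrite -val_eqE /= ltn_eqF. Qed.

Lemma adjK a : ((adj a)^-1)%g = adj a.
Proof. exact: tpermV. Qed.

Lemma wact_adj_eq n (w : word n) a : w (adjl a) = w (adjr a) -> wact w (adj a) = w.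
Proof.
move=> e; apply/ffunP => p; rewrite ffunE /adj.
by case: tpermP => [->|->|].
Qed.

(* A set J of adjacent positions cuts 'I_d into the blocks whose neighbouring
   elements are joined by J; blk J numbers these blocks from the left. *)
Lemma blk_subproof J (p : 'I_d) : (#|[set a | (a \notin J) && (a < p)]| < d)%N.
Proof.
by apply: leq_ltn_trans (max_card _) _; rewrite card_ord ltn_predL (leq_ltn_trans _ (ltn_ord p)).
Qed.
Definition blk J : word d := [ffun p => Ordinal (blk_subproof J p)].

Lemma blk_eqP J (p q : 'I_d) : (p <= q)%N ->
  blk J p = blk J q <-> forall a : 'I_d.-1, (p <= a < q)%N -> a \in J.
Proof.
move=> pq; have sub : [set a | (a \notin J) && (a < p)%N] \subset [set a | (a \notin J) && (a <
  q)%N].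
  by apply/subsetP => a; rewrite !inE => /andP[-> /leq_trans]; apply.
rewrite !ffunE; split=> [/(congr1 val)/= e a /andP[pa aq]|h].
  have := subset_cardP e sub a.
  rewrite !inE aq ltnNge pa andbT andbF.
  by case: (a \in J).
apply: val_inj => /=; congr #|pred_of_set _|; apply/setP => a; rewrite !inE.
case: (boolP (a \in J)) => //= aJ; case: ltnP => ap; first by rewrite (leq_trans ap).
by apply/esym/negbTE; apply: contra aJ => aq; apply: h; rewrite ap.
Qed.

(** The Young subgroup of the blocks of [J], encoded as the stabilizer of the word [blk J]. Its
    invariant tensors are thereby the possible values at [blk J] of equivariant maps. *)
Definition young J : {set 'S_d} := [set s | wact (blk J) s == blk J].

Lemma youngP J s : reflect (forall p, blk J (s p) = blk J p) (s \in young J).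
Proof.
rewrite inE; apply: (iffP eqP) => [/ffunP e p|e]; first by have := e p; rewrite ffunE.
by apply/ffunP => p; rewrite ffunE.
Qed.

Lemma blk_sub J K p q : K \subset J -> blk K p = blk K q -> blk J p = blk J q.
Proof.
move=> /subsetP KJ; wlog pq : p q / (p <= q)%N => [wl e|].
  by case: (leqP p q) => [pq|/ltnW qp]; [exact: wl | exact/esym/wl/esym].
by move=> /(blk_eqP _ pq) h; apply/blk_eqP => // a /h /KJ.
Qed.

Lemma young_sub J K : K \subset J -> young K \subset young J.
Proof. by move=> KJ; apply/subsetP => s /youngP h; apply/youngP => p; exact/(blk_sub KJ)/h. Qed.

Lemma blk_adj J a : a \in J -> blk J (adjl a) = blk J (adjr a).
Proof.
move=> aJ; apply/blk_eqP => [|b]; first exact: leqnSn.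
by rewrite /= ltnS -eqn_leq => /eqP/val_inj <-.
Qed.

Lemma adj_young J a : a \in J -> adj a \in young J.
Proof. by move=> aJ; rewrite inE wact_adj_eq// blk_adj. Qed.

Lemma pred_adj (p q : 'I_d) : (p < q)%N -> exists2 a, q = adjr a & (p <= adjl a)%N.
Proof.
move=> pq; have q0 : (0 < q)%N by exact: leq_ltn_trans pq.
have qd : (q.-1 < d.-1)%N by rewrite ltn_predRL prednK.
by exists (Ordinal qd); [apply: val_inj; rewrite /= prednK | rewrite /= -ltnS prednK].
Qed.

Lemma blk_set1 a (p q : 'I_d) : (p < q)%N -> blk [set a] p = blk [set a] q -> p = adjl a /\ q =
  adjr a.
Proof.
move=> pq /(blk_eqP _ (ltnW pq)) h.
have pd : (p < d.-1)%N by rewrite ltn_predRL (leq_ltn_trans pq).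
have [b qb pb] := pred_adj pq.
have /h/set1P ea : (p <= Ordinal pd < q)%N by rewrite leqnn pq.
have /h/set1P eb : (p <= b < q)%N by rewrite pb qb leqnn.
by split; [apply: val_inj; rewrite /= -ea | rewrite qb eb].
Qed.

Lemma young_set1 a s : s \in young [set a] -> s = 1%g \/ s = adj a.
Proof.
move=> /youngP h.
have hs p : s p <> p -> (p = adjl a /\ s p = adjr a) \/ (p = adjr a /\ s p = adjl a).
  move=> spp; case: (ltngtP p (s p)) => [lt|lt|/val_inj/esym//].
    by left; exact: blk_set1 lt (esym (h p)).
  by right; have [] := blk_set1 lt (h p).
have [e|ne] := eqVneq (s (adjl a)) (adjl a).
  left; apply/permP => p; rewrite perm1; have [//|/eqP/hs[[pa]|[pa spa]]] := eqVneq (s p) p.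
    by rewrite pa e.
  by have := perm_inj (etrans spa (esym e)); rewrite pa => /eqP;
    rewrite eq_sym (negbTE (adj_neq a)).
right; have /eqP/hs[[_ e]|[]] := ne; last by move/eqP; rewrite (negbTE (adj_neq a)).
apply/permP => p; rewrite /adj; case: tpermP => [->//|->|pl pr].
  have : s (adjr a) <> adjr a.
    by rewrite -{2}e => /perm_inj/eqP; rewrite eq_sym (negbTE (adj_neq a)).
  by move=> /hs[[/eqP]|[]//]; rewrite eq_sym (negbTE (adj_neq a)).
by have [//|/eqP/hs[[]|[]]] := eqVneq (s p) p.
Qed.

Lemma young_set0 s : s \in young set0 -> s = 1%g.
Proof.
move=> /youngP h; apply/permP => p; rewrite perm1; apply/eqP/negPn/negP => /eqP sp.
wlog : / exists p q : 'I_d, (p < q)%N /\ blk set0 p = blk set0 q.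
  apply; case: (ltngtP p (s p)) => [lt|lt|/val_inj/esym//]; first by exists p, (s p).
  by exists (s p), p.
move=> [p' [q [pq /(blk_eqP _ (ltnW pq)) e]]]; have [b qb pb] := pred_adj pq.
by have := e b; rewrite qb pb leqnn inE => /(_ isT).
Qed.

(** * The lexicographic order and ascents *)

Definition lex n (u w : word n) :=
  [exists p, (u p < w p)%N && [forall q : 'I_d, (q < p)%N ==> (u q == w q)]].

Lemma lexP n (u w : word n) :
  reflect (exists p, (u p < w p)%N /\ forall q : 'I_d, (q < p)%N -> u q = w q) (lex u w).
Proof.
apply: (iffP existsP) => -[p]; last by case=> h1 h2; exists p; rewrite h1; apply/forallP => q;
  apply/implyP => /h2->.
by move=> /andP[h1 /forallP h2]; exists p; split=> // q qp; apply/eqP; have := h2 q; rewrite qp.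
Qed.

Lemma lex_irr n : irreflexive (@lex n).
Proof. by move=> w; apply/negbTE/negP => /lexP[p []]; rewrite ltnn. Qed.

Lemma lex_trans n : transitive (@lex n).
Proof.
move=> v u w /lexP[p [uv uvp]] /lexP[q [vw vwq]]; apply/lexP.
case: (ltngtP p q) => [pq|qp|/val_inj pq].
- exists p; split=> [|r rp]; first by rewrite -vwq.
  by rewrite uvp// vwq// (ltn_trans rp).
- exists q; split=> [|r rq]; first by rewrite uvp.
  by rewrite uvp ?vwq// (ltn_trans rq).
- subst q; exists p; split=> [|r rp]; first exact: ltn_trans uv vw.
  by rewrite uvp ?vwq.
Qed.

Lemma lex_first_diff n (u w : word n) : u != w ->
  exists2 p, u p != w p & forall q : 'I_d, (q < p)%N -> u q = w q.
Proof.
move=> uw; have [p pP] : exists p, u p != w p.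
  apply/existsP; apply: contraNT uw; rewrite negb_exists => /forallP h; apply/eqP/ffunP => p.
  by apply/eqP; have := h p; rewrite negbK.
have [q qP qmin] := @arg_minnP _ p (fun b => u b != w b) val pP.
exists q => // r rq; apply/eqP/negPn/negP => /qmin.
by rewrite leqNgt rq.
Qed.

Lemma lex_adj n (w : word n) a : (w (adjr a) < w (adjl a))%N -> lex (wact w (adj a)) w.
Proof.
move=> h; apply/lexP; exists (adjl a); rewrite ffunE tpermL; split=> // q qa.
rewrite ffunE tpermD// -val_eqE /=; first by rewrite gtn_eqF.
by rewrite gtn_eqF// (ltn_trans qa).
Qed.

(** Weak and strict ascents. The words with [J \subset wasc w] are the smallest elements of the
    orbits of [young J] and index a basis of the invariants; those with [J \subset sasc w] are the
    ones among them with distinct letters in each block, and index a basis of the exterior powers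
    along the blocks. *)
Definition wasc n (w : word n) : {set 'I_d.-1} := [set a | w (adjl a) <= w (adjr a)]%N.
Definition sasc n (w : word n) : {set 'I_d.-1} := [set a | w (adjl a) < w (adjr a)]%N.

Lemma sasc_wasc n (w : word n) : sasc w \subset wasc w.
Proof. by apply/subsetP => a; rewrite !inE; exact: ltnW. Qed.

Lemma wasc_mono n (w : word n) J (p q : 'I_d) :
  J \subset wasc w -> (p <= q)%N -> blk J p = blk J q -> (w p <= w q)%N.
Proof.
move=> /subsetP Jw; have [m] := ubnP (q : nat); elim: m q => // m IH q qm.
rewrite leq_eqVlt => /orP[/eqP/val_inj->//|pq] e.
have [a qa pa] := pred_adj pq.
have h := (blk_eqP _ (ltnW pq)).1 e.
have aJ : a \in J by apply: h; rewrite pa qa leqnn.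
have := Jw _ aJ; rewrite inE -qa; apply: leq_trans; apply: IH => //.
  by move: qm; rewrite qa.
by rewrite e qa blk_adj.
Qed.

Lemma sasc_mono n (w : word n) J (p q : 'I_d) :
  J \subset sasc w -> (p < q)%N -> blk J p = blk J q -> (w p < w q)%N.
Proof.
move=> Jw pq e; have [a qa pa] := pred_adj pq.
have aJ : a \in J by apply: ((blk_eqP _ (ltnW pq)).1 e); rewrite pa qa leqnn.
have := subsetP Jw _ aJ; rewrite inE -qa; apply: leq_ltn_trans.
apply: (wasc_mono (J := J)) => //; first exact: subset_trans Jw (sasc_wasc w).
by rewrite e qa blk_adj.
Qed.

Lemma sasc_free n (w : word n) J s :
  J \subset sasc w -> s \in young J -> wact w s = w -> s = 1%g.
Proof.
move=> Jw /youngP sJ /ffunP ws; apply/permP => p; rewrite perm1.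
have := ws p; rewrite ffunE => wp.
case: (ltngtP (s p) p) => [lt|lt|/val_inj//].
  by have := sasc_mono Jw lt (sJ p); rewrite wp ltnn.
by have := sasc_mono Jw lt (esym (sJ p)); rewrite wp ltnn.
Qed.

(* At the first difference p, if the permuted word were smaller, its block would have
   more letters <= its p-th letter than the block of w. *)
Lemma young_lex n (w : word n) J s :
  J \subset wasc w -> s \in young J -> wact w s != w -> lex w (wact w s).
Proof.
move=> Jw /youngP sJ ne; have [p np pP] := lex_first_diff ne.
apply/lexP; exists p; split=> [|q /pP//].
rewrite ltn_neqAle val_eqE eq_sym np leqNgt; apply/negP => lt.
pose v := wact w s p; pose B (u : word n) := [set q | (blk J q == blk J p) && (u q <= v)%N].
have cB : #|B (wact w s)| = #|B w|.
  rewrite -(card_imset (B (wact w s)) (@perm_inj _ s)); congr #|pred_of_set _|.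
  apply/setP => q; apply/imsetP/idP => [[r rB ->]|]; first by move: rB; rewrite !inE wactE sJ.
  rewrite inE => qB; exists ((s^-1)%g q); last by rewrite permKV.
  by rewrite inE wactE permKV -(sJ ((s^-1)%g q)) permKV.
have sub : B w \subset B (wact w s) :\ p.
  apply/subsetP => q; rewrite !inE => /andP[/eqP qp qv].
  have ltqp : (q < p)%N.
    rewrite ltnNge; apply/negP => pq; have := wasc_mono Jw pq (esym qp).
    by rewrite leqNgt (leq_ltn_trans qv).
  by rewrite pP// qv -val_eqE /= (ltn_eqF ltqp) qp eqxx.
have := subset_leq_card sub; rewrite -cB [X in (X <= _)%N](cardsD1 p).
by rewrite inE eqxx leqnn add1n ltnn.
Qed.

End Words.

(** * Morphisms of the divided power category given by words *)

Section OrbitMaps.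
Variables (k : comPzRingType) (d : nat).
Local Notation pk := (pk k).
Local Notation tens := (@tens k d).
Local Notation word n := {ffun 'I_d -> 'I_n}.
Local Notation tgen V i := (@tgen k d V i).

Implicit Types V U W : pk.

(** A property rather than the shape [kfree n], because a tensor product of two free objects is free
    without being syntactically of this shape. *)
Definition is_free V := pk_mx V = 1%:M.
Definition kfree n : pk := Pk (mul1mx (1%:M : 'M[k]_n)).

Lemma pktens_free V W : is_free V -> is_free W -> is_free (pktens V W).
Proof.
rewrite /is_free /= => -> ->; apply/matrixP => i j; rewrite !mxE -natrM mulnb -xpair_eqE.
by rewrite -!surjective_pairing (can_eq (@mxtens_unindexK _ _)).
Qed.

Lemma tgen_coord V (w u : word (pk_dim V)) : is_free V -> tval (tgen V w) u = (w == u)%:R.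
Proof.
move=> fV; rewrite ffunE; have [->|/eqP ne] := eqVneq w u.
  by apply: big1 => a _; rewrite /= fV !mxE eqxx.
have [a /negbTE wa] : exists a, w a != u a.
  apply/existsP; apply: contraT => /existsPn h; case: ne; apply/ffunP => a.
  by apply/eqP; have := h a; rewrite negbK.
by rewrite (bigD1 a)//= fV !mxE wa mul0r.
Qed.

Lemma tsact1 V (t : tens V) : tsact 1%g t = t.
Proof. by apply/val_inj/ffunP => w; rewrite ffunE; congr (tval t _); exact: wact1. Qed.

Lemma tsactM V s r (t : tens V) : tsact s (tsact r t) = tsact (r * s)%g t.
Proof. by apply/val_inj/ffunP => w; rewrite !ffunE; congr (tval t _); exact: wactM. Qed.

Lemma tgen_wact V (w : word (pk_dim V)) s : tgen V (wact w s) = tsact s^-1%g (tgen V w).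
Proof. by rewrite -(tsact_tgen (V := V) s w) tsactM mulgV tsact1. Qed.

Lemma tgen_wactK V (w : word (pk_dim V)) s : tsact s (tgen V (wact w s)) = tgen V w.
Proof. by rewrite tgen_wact tsactM mulVg tsact1. Qed.

Lemma tsact_coord V s (t : tens V) w : tval (tsact s t) w = tval t (wact w s).
Proof. by rewrite ffunE. Qed.

Lemma tens_coordD V a (t u : tens V) w : tval (a *: t + u) w = a * tval t w + tval u w.
Proof. by rewrite -[LHS]/((a *: tval t + tval u) w) tenDE. Qed.

Lemma tens_coordZ V a (t : tens V) w : tval (a *: t) w = a * tval t w.
Proof. by rewrite -[LHS]/((a *: tval t) w) ffunE. Qed.

Lemma tens_coord_sum V (I : Type) (r : seq I) (P : pred I) (F : I -> tens V) w :
  tval (\sum_(x <- r | P x) F x) w = \sum_(x <- r | P x) tval (F x) w.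
Proof. by rewrite -[tval _]/(val _) raddf_sum sum_ffunE. Qed.

Lemma tens_linear_ext V (M : lmodType k) (f g : {linear tens V -> M}) :
  (forall w, f (tgen V w) = g (tgen V w)) -> f =1 g.
Proof.
move=> fg t; rewrite (tens_tgen t) !linear_sum.
by apply: eq_bigr => w _; rewrite !linearZ /= fg.
Qed.

Lemma ghom_tgen_ext V U (f g : ghom d V U) : (forall w, f (tgen V w) = g (tgen V w)) -> f = g.
Proof. by move=> fg; apply: ghomP; exact: tens_linear_ext. Qed.

Section Build.
Variables (V U : pk) (u : word (pk_dim V) -> tens U).
Hypothesis u_act : forall w s, u (wact w s) = tsact s^-1%g (u w).
Definition word_fun (x : tens V) : tens U := \sum_w (tval x w : k) *: u w.
Lemma word_fun_subproof : word_fun \in @ghom_pred k d V U.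
Proof.
apply/asboolP; split=> [a x y|s x].
  rewrite /word_fun scaler_sumr -big_split /=; apply: eq_bigr => w _.
  by rewrite tens_coordD scalerDl scalerA.
rewrite /word_fun linear_sum [RHS](reindex (fun w => wact w s)) /=; last first.
  by exists (fun w => wact w s^-1%g) => w _; [exact: wactK | exact: wactVK].
apply: eq_bigr => w _; rewrite tsact_coord linearZ /= u_act tsactM mulVg.
by rewrite tsact1.
Qed.
Definition word_map : ghom d V U := GHom word_fun_subproof.

Lemma word_mapE x : word_map x = \sum_w (tval x w : k) *: u w. Proof. by []. Qed.

#[local] Opaque word_map.

Lemma word_map_tgen w : is_free V -> word_map (tgen V w) = u w.
Proof.
move=> fV; rewrite word_mapE (bigD1 w)//= tgen_coord// eqxx scale1r big1 ?addr0// => v vw.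
by rewrite tgen_coord// eq_sym (negbTE vw) scale0r.
Qed.
End Build.
#[local] Opaque word_map.

(** The condition for [t] to be the value at [w0] of an equivariant map: [t] is fixed by the
    stabilizer of [w0]. Extended by zero outside the orbit of [w0], the map is then determined by
    [t]. *)
Definition orbit_inv (V U : pk) (w0 : word (pk_dim V)) (t : tens U) :=
  forall s, wact w0 s = w0 -> tsact s t = t.

Section OrbitMap.
Variables (V U : pk) (w0 : word (pk_dim V)).

Definition orbit_val (t : tens U) (w : word (pk_dim V)) : tens U :=
  if [pick s | w == wact w0 s] is Some s then tsact s^-1%g t else 0.

Lemma orbit_val_on t s : orbit_inv w0 t -> orbit_val t (wact w0 s) = tsact s^-1%g t.
Proof.
move=> it; rewrite /orbit_val; case: pickP => [r /eqP e|/(_ s)]; last by rewrite eqxx.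
have /it h : wact w0 (r^-1 * s)%g = w0 by rewrite -wactM e wactK.
by rewrite -[in RHS]h tsactM mulgK.
Qed.

Lemma orbit_val_off t w : (forall s, w <> wact w0 s) -> orbit_val t w = 0.
Proof. by move=> h; rewrite /orbit_val; case: pickP => // s /eqP /h. Qed.

Lemma orbit_val_act t w s : orbit_inv w0 t ->
  orbit_val t (wact w s) = tsact s^-1%g (orbit_val t w).
Proof.
move=> it; have [[r ->]|nw] := pselect (exists r, w = wact w0 r).
  by rewrite wactM !orbit_val_on// tsactM invMg.
rewrite !orbit_val_off ?linear0// => r e; first by apply: nw; exists r.
by apply: nw; exists (s^-1 * r)%g; rewrite -wactM -e wactK.
Qed.

Definition orbit_map t (it : orbit_inv w0 t) : ghom d V U :=
  word_map (fun w s => orbit_val_act w s it).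

Lemma orbit_map_on t (it : orbit_inv w0 t) s : is_free V ->
  orbit_map it (tgen V (wact w0 s)) = tsact s^-1%g t.
Proof. by move=> fV; rewrite word_map_tgen// orbit_val_on. Qed.

Lemma orbit_map_tgen t (it : orbit_inv w0 t) : is_free V -> orbit_map it (tgen V w0) = t.
Proof. by move=> fV; rewrite -[w0 in LHS]wact1 orbit_map_on// invg1 tsact1. Qed.

Lemma orbit_map_off t (it : orbit_inv w0 t) w : is_free V ->
  (forall s, w <> wact w0 s) -> orbit_map it (tgen V w) = 0.
Proof. by move=> fV h; rewrite word_map_tgen// orbit_val_off. Qed.

Lemma orbit_map_linear a t u (it : orbit_inv w0 t) (iu : orbit_inv w0 u)
  (itu : orbit_inv w0 (a *: t + u)) : orbit_map itu = a *: orbit_map it + orbit_map iu.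
Proof.
apply: ghomP => x; rewrite -[RHS]/(a *: orbit_map it x + orbit_map iu x) !word_mapE.
rewrite scaler_sumr -big_split; apply: eq_bigr => w _ /=.
rewrite /orbit_val; case: pickP => [s _|_]; last by rewrite !scaler0 addr0.
by rewrite linearP scalerDr !scalerA mulrC.
Qed.

End OrbitMap.

Lemma orbit_map_comp V U W (w0 : word (pk_dim V)) (f : ghom d U W) (t : tens U) (it :
  orbit_inv w0 t) (ift : orbit_inv w0 (f t)) :
  orbit_map ift = gcomp f (orbit_map it).
Proof.
apply: ghomP => x; rewrite /= !word_mapE linear_sum; apply: eq_bigr => w _.
rewrite linearZ /= /orbit_val; case: pickP => [s _|_]; last by rewrite [f 0]linear0.
by rewrite ghom_sact.
Qed.

Lemma orbit_inv_image (V U W : pk) (w0 : word (pk_dim V)) (t : tens U) (f : ghom d U W) :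
  orbit_inv w0 t -> orbit_inv w0 (f t).
Proof. by move=> it s /it h; rewrite -ghom_sact h. Qed.

End OrbitMaps.

#[global] Opaque word_map.


(** * The divided power resolution of the exterior power *)

Section BarComplex.
Variables (k : comPzRingType) (d : nat).
Local Notation pk := (pk k).
Local Notation rep := (rep k d).
Local Notation tens := (@tens k d).
Local Notation tgen V i := (@tgen k d V i).
Local Notation kfree := (@kfree k).
Implicit Types (V W : pk) (J K : {set 'I_d.-1}).

(* The divided power functor attached to a composition of d, encoded by the set J of
   adjacent positions lying in the same part, is W |-> (W^{(x) d})^{young J}. The
   term of degree i is the direct sum of these functors over all J with #|J| = - i. *)
Definition bar_pred (i : int) W : {pred {ffun {set 'I_d.-1} -> tens W}} := fun c =>
  `[< forall J, (forall s, s \in young J -> tsact s (c J) = c J) /\ (#|J|%:Z + i != 0 -> c J = 0)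
    >].

Lemma bar_closed i W : submod_closed (@bar_pred i W).
Proof.
split=> [|a c c' /asboolP h /asboolP h']; apply/asboolP => J.
  by rewrite ffunE; split=> // s _; rewrite linear0.
have [iv z] := h J; have [iv' z'] := h' J; rewrite !ffunE; split=> [s sJ|Ji].
  by rewrite linearP /= iv// iv'.
by rewrite z// z'// scaler0 addr0.
Qed.
HB.instance Definition _ i W := GRing.isSubmodClosed.Build k {ffun {set 'I_d.-1} -> tens W}
  (@bar_pred i W) (@bar_closed i W).

Record bar i W := Bar { bar_fun :> {ffun {set 'I_d.-1} -> tens W}; barP :
  bar_fun \in @bar_pred i W }.
HB.instance Definition _ i W := [isSub for @bar_fun i W].
HB.instance Definition _ i W := [Choice of bar i W by <:].
HB.instance Definition _ i W := [SubChoice_isSubLmodule of bar i W by <:].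

Lemma bar_inv i W (c : bar i W) J s : s \in young J -> tsact s (c J) = c J.
Proof. by case/asboolP/(_ J): (barP c) => h _; exact: h. Qed.

Lemma bar_deg i W (c : bar i W) J : #|J|%:Z + i != 0 -> c J = 0.
Proof. by case/asboolP/(_ J): (barP c). Qed.

Lemma bar_ext i W (c c' : bar i W) : (forall J, c J = c' J) -> c = c'.
Proof. by move=> h; apply/val_inj/ffunP. Qed.

Lemma barDE i W a (c c' : bar i W) J : (a *: c + c') J = a *: c J + c' J.
Proof. by rewrite -[LHS]/((a *: val c + val c') J) !ffunE. Qed.

Lemma bar0E i W J : (0 : bar i W) J = 0.
Proof. by rewrite -[LHS]/(val (0 : bar i W) J) ffunE. Qed.

Lemma bar_sumE i W (I : Type) (r : seq I) (F : I -> bar i W) J :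
  (\sum_(x <- r) F x) J = \sum_(x <- r) F x J.
Proof.
elim: r => [|x r IH]; first by rewrite !big_nil bar0E.
by rewrite !big_cons -[F x]scale1r barDE IH !scale1r.
Qed.

Section Map.
Variables (i : int) (V W : pk) (f : ghom d V W).
Lemma bar_map_subproof (c : bar i V) : [ffun J => f (c J)] \in @bar_pred i W.
Proof.
apply/asboolP => J; rewrite ffunE; split=> [s sJ|Ji]; first by rewrite -ghom_sact bar_inv.
by rewrite bar_deg// linear0.
Qed.
Definition bar_map c := Bar (bar_map_subproof c).
Lemma bar_mapE c J : bar_map c J = f (c J). Proof. exact: ffunE. Qed.
#[local] Opaque bar_map.
Lemma bar_map_linear : linear bar_map.
Proof. by move=> a c c'; apply: bar_ext => J; rewrite barDE !bar_mapE barDE linearP. Qed.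
End Map.
#[local] Opaque bar_map.

Definition bar_rep (i : int) : rep.
Proof.
refine (@Rep k d (bar i) (fun V W f => linear_pack (@bar_map_linear i V W f)) _ _ _).
- by move=> V W a f g c; apply: bar_ext => J; rewrite barDE !bar_mapE.
- by move=> V c; apply: bar_ext => J; rewrite bar_mapE.
- by move=> U V W g f c; apply: bar_ext => J; rewrite !bar_mapE.
Defined.

Section Diff.
Variables (i : int) (W : pk).
Lemma bar_d_subproof (c : bar i W) : [ffun J => bar_diff c J] \in @bar_pred (i + 1) W.
Proof.
apply/asboolP => J; rewrite ffunE; split=> [s sJ|Ji].
  rewrite linear_sum; apply: eq_bigr => a aJ; rewrite linearZ /= bar_inv//.
  by apply: subsetP sJ; apply: young_sub; exact: subsetUr.
apply: big1 => a aJ; rewrite bar_deg ?scaler0// cardsU1 aJ.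
by move: Ji; rewrite add1n -addn1 PoszD addrAC addrA.
Qed.
Definition bar_d c := Bar (bar_d_subproof c).
Lemma bar_dE c J : bar_d c J = bar_diff c J. Proof. exact: ffunE. Qed.
#[local] Opaque bar_d.
Lemma bar_d_linear : linear bar_d.
Proof.
move=> a c c'; apply: bar_ext => J; rewrite barDE !bar_dE -bar_diff_linear.
by apply: eq_bar_diff => K; rewrite barDE.
Qed.
End Diff.
#[local] Opaque bar_d.

Lemma bar_d_nat i V W (f : ghom d V W) (c : bar_rep i V) :
  bar_d (rmap (bar_rep i) f c) = rmap (bar_rep (i + 1)) f (bar_d c).
Proof.
apply: bar_ext => J; rewrite bar_dE bar_mapE bar_dE linear_bar_diff.
by apply: eq_bar_diff => K; rewrite bar_mapE.
Qed.

Definition bar_cplx : cplx k d.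
Proof.
refine (@Cplx k d bar_rep (fun i => @nt_build k d (bar_rep i) (bar_rep (i + 1))
  (@bar_d i) (@bar_d_linear i) (@bar_d_nat i)) _).
move=> i V c; apply: bar_ext => J; rewrite bar_dE.
have -> : bar_diff (bar_d c) J = bar_diff (bar_diff c) J by apply: eq_bar_diff => K; exact:
  bar_dE.
by rewrite bar_diffK bar0E.
Defined.

Lemma bar_cdiffE i V (c : bar_cplx i V) J :
  (cdiff bar_cplx i V c : bar (i + 1) V) J = bar_diff (c : bar i V) J.
Proof. exact: bar_dE. Qed.

(** Hence the summand [J] consists of the maps out of [kfree d] supported on the orbit of [blk J], a
    direct summand of the representable functor of [kfree d]. *)
Lemma bar_orbit_inv i W (c : bar i W) J : orbit_inv (V := kfree d) (blk J) (c J).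
Proof. by move=> s sJ; apply: bar_inv; rewrite inE sJ. Qed.
Arguments bar_orbit_inv {i W} c J.

(** The universal element of the summand [J]: the basis tensor of [blk J]. It is set to zero when
    [J] does not belong to degree [i], so that sums over all [J] make sense. *)
Lemma bar_unit_subproof i J : [ffun K => if (K == J) && (#|J|%:Z + i == 0)
  then tgen (kfree d) (blk J) else 0] \in @bar_pred i (kfree d).
Proof.
apply/asboolP => K; rewrite ffunE; have [->|KJ] /= := eqVneq K J; last first.
  by split=> // s _; rewrite linear0.
case: eqP => [_|Ji]; split=> // s; last by rewrite linear0.
rewrite inE => /eqP sJ; rewrite -[X in tsact X _]invgK -tgen_wact.
by congr (tgen _ _); rewrite -[in LHS]sJ wactK.
Qed.
Definition bar_unit i J := Bar (bar_unit_subproof i J).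

Lemma bar_unitE i J K : bar_unit i J K =
  if (K == J) && (#|J|%:Z + i == 0) then tgen (kfree d) (blk J) else 0.
Proof. exact: ffunE. Qed.

#[local] Opaque bar_unit.

Lemma bar_decomp i W (c : bar i W) :
  c = \sum_J rmap (bar_rep i) (orbit_map (bar_orbit_inv c J)) (bar_unit i J :
    bar_rep i (kfree d)).
Proof.
apply: bar_ext => K; rewrite bar_sumE (bigD1 K)//= big1 => [|J JK]; rewrite bar_mapE bar_unitE.
  rewrite eqxx addr0 /=; case: eqP => [_|/eqP Ji]; first by rewrite orbit_map_tgen.
  by rewrite linear0 bar_deg.
by rewrite eq_sym (negbTE JK) linear0.
Qed.

Section FromBar.
Variables (i : int) (A : rep) (z : {set 'I_d.-1} -> A (kfree d)).

(** The family [z] is arbitrary: the unit of [J] is sent to the image of [z J] under the idempotent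
    of [kfree d] that projects to the orbit of [blk J]. *)
Definition from_bar W (c : bar i W) : A W :=
  \sum_J rmap A (orbit_map (bar_orbit_inv c J)) (z J).

Lemma from_bar_linear W : linear (@from_bar W).
Proof.
move=> a c c'; rewrite /from_bar scaler_sumr -big_split; apply: eq_bigr => J _ /=.
rewrite -rmap_linear; congr (rmap A _ (z J)).
have itu : orbit_inv (V := kfree d) (blk J) (a *: c J + c' J).
  by rewrite -barDE; exact: bar_orbit_inv.
rewrite -(orbit_map_linear (bar_orbit_inv c J) (bar_orbit_inv c' J) itu).
by apply: ghomP => x; rewrite !word_mapE barDE.
Qed.

Lemma from_bar_nat V W (f : ghom d V W) (c : bar_rep i V) :
  from_bar (rmap (bar_rep i) f c) = rmap A f (from_bar c).
Proof.
rewrite /from_bar linear_sum; apply: eq_bigr => J _ /=.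
rewrite -rmap_comp; congr (rmap A _ (z J)).
rewrite -(orbit_map_comp (bar_orbit_inv c J) (orbit_inv_image f (bar_orbit_inv c J))).
by apply: ghomP => x; rewrite !word_mapE bar_mapE.
Qed.

Definition bar_desc : nat_trans (bar_rep i) A :=
  @nt_build k d (bar_rep i) A from_bar from_bar_linear from_bar_nat.
End FromBar.

(** By [bar_decomp] a map out of [bar_rep i] is determined by its values at the units, so it
    suffices to choose preimages of these under [e]. *)
Lemma bar_rep_lift i (A B : rep) (e : nat_trans A B) (g : nat_trans (bar_rep i) B) :
  (forall V x, exists y, g V x = e V y) ->
  exists s : nat_trans (bar_rep i) A, forall V x, g V x = e V (s V x).
Proof.
move=> h; pose z J := projT1 (cid (h (kfree d) (bar_unit i J))).
have zE J : g (kfree d) (bar_unit i J) = e (kfree d) (z J) by exact: projT2 (cid (h _ _)).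
exists (bar_desc i z) => V c.
rewrite [c in LHS]bar_decomp linear_sum /= /from_bar linear_sum; apply: eq_bigr => J _ /=.
by rewrite !ntr_nat zE.
Qed.

Lemma bar_cplx_K_projective : K_projective bar_cplx.
Proof.
apply: (@bounded_projective_K_projective k d bar_cplx bar_rep_lift d) => i V c i0;
  apply: bar_ext => J; rewrite bar0E bar_deg//.
  by rewrite gt_eqF// ltr_wpDl.
have : #|J|%:Z + i < 0.
  rewrite -ltrBrDl sub0r; apply: lt_le_trans i0 _; rewrite lerN2 lez_nat.
  by rewrite (leq_trans (max_card _))// card_ord leq_pred.
by move/lt_eqF->.
Qed.

End BarComplex.

#[global] Opaque bar_map bar_d bar_unit.


Arguments bar_orbit_inv {k d i W} c J.

(** * Retracts of free objects *)

Section FreeRetract.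
Variables (k : comPzRingType) (d : nat).
Local Notation kfree := (@kfree k).

Lemma tpow1 n (t : ten k d n) : tpow 1%:M t = t.
Proof.
apply/ffunP => w; rewrite ffunE (bigD1 w)//= big1 ?mulr1 => [|a _]; last by rewrite mxE eqxx.
rewrite big1 ?addr0// => v /eqP vw.
have [a /negbTE va] : exists a, v a != w a.
  apply/existsP; apply: contraT => /existsPn h; case: vw; apply/ffunP => a.
  by apply/eqP; have := h a; rewrite negbK.
by rewrite (bigD1 a)//= mxE va mul0r mulr0.
Qed.

Lemma to_free_subproof n (t : ten k d n) : t \in @tens_pred k d (kfree n).
Proof. by rewrite unfold_in /= tpow1. Qed.
Definition to_free n (t : ten k d n) : tens d (kfree n) := Tens (to_free_subproof t).

Lemma free_inclusion_subproof (V : pk k) :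
  (fun t : tens d V => to_free (tval t)) \in @ghom_pred k d V (kfree (pk_dim V)).
Proof. by apply/asboolP; split=> [a t u|s t]; apply: val_inj. Qed.

Lemma free_projection_subproof (V : pk k) (t : tens d (kfree (pk_dim V))) :
  tpow (pk_mx V) (tval t) \in @tens_pred k d V.
Proof. by rewrite unfold_in -tpow_mul pk_idem. Qed.
Lemma free_projection_ghom (V : pk k) :
  (fun t => Tens (free_projection_subproof (V := V) t)) \in @ghom_pred k d (kfree (pk_dim V)) V.
Proof.
apply/asboolP; split=> [a t u|s t]; apply: val_inj => /=; first exact: linearP.
exact: esym (sact_tpow _ _ _).
Qed.

Lemma free_retract (V : pk k) : exists (a : ghom d V (kfree (pk_dim V))) (b :
  ghom d (kfree (pk_dim V)) V),
  gcomp b a = gidm d V.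
Proof.
exists (GHom (free_inclusion_subproof V)), (GHom (free_projection_ghom V)).
by apply: ghomP => t; apply: val_inj; exact: tensE.
Qed.

End FreeRetract.

(** * Augmentations to a functor in degree zero *)

Section MapToConc.
Variables (k : comPzRingType) (d : nat) (C : cplx k d) (X : rep k d).
Variable e : nat_trans (C 0) X.
Hypothesis e_d : forall V (x : C (-1) V), e V (cdiff C (-1) V x) = 0.

Lemma conc_obj_eq0 i V (x : conc_obj X i V) : i != 0 -> x = 0.
Proof. by case: i x => [[|n]|n] //= x _; exact: thinmx0 || (apply/rowP => -[]). Qed.

Definition conc_fun i : nat_trans (C i) (conc_obj X i) :=
  match i return nat_trans (C i) (conc_obj X i) with
  | Posz 0 => e
  | i' => nt_zero (C i') (conc_obj X i')
  end.

Lemma conc_fun_diff i V x : conc_fun (i + 1) V (cdiff C i V x) = cdiff (conc X) i V (conc_fun i V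
  x).
Proof.
rewrite [RHS]/(0); have [|i1] := eqVneq (i + 1) 0; last exact: conc_obj_eq0.
move/eqP; rewrite addr_eq0 => /eqP ei; move: x; rewrite ei => x.
exact: e_d.
Qed.

Definition conc_map : chain_map C (conc X) := @ChainMap k d C (conc X) conc_fun conc_fun_diff.

Hypothesis C_pos : forall V (x : C 1 V), x = 0.
Hypothesis C_exact : forall n i (x : C (i + 1) (kfree k n)),
  i + 1 != 0 -> is_cycle x -> is_boundary x.
Hypothesis C_ker : forall n (x : C 0 (kfree k n)), e (kfree k n) x = 0 -> exists y,
  x = cdiff C (-1) (kfree k n) y.
Hypothesis e_surj : forall n (z : X (kfree k n)), exists x, e (kfree k n) x = z.

Lemma conc_map_quasi_iso : quasi_iso conc_map.
Proof.
move=> i V; have [a [b ba]] := free_retract d V; apply: (quasi_iso_retract ba).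
move: (pk_dim V) => n; have [|i1] := eqVneq (i + 1) 0; last first.
  split=> [x cx _|y _]; first exact: C_exact.
  exists 0; first by rewrite /is_cycle linear0.
  by exists 0; exact: conc_obj_eq0.
move/eqP; rewrite addr_eq0 => /eqP ->; split=> [x _ [y yE]|y _].
  by have [z ->] := C_ker yE; exists z.
have [x xE] := e_surj y; exists x; first exact: C_pos.
by exists 0; apply: (etrans (congr1 (fun z : X _ => z - (y : X _)) xE)); exact: subrr.
Qed.

End MapToConc.

(** * Exactness of the resolution and its augmentation to the exterior power *)

Section BarResolution.
Variables (k : comPzRingType) (d : nat).
Local Notation pk := (pk k).
Local Notation tens := (@tens k d).
Local Notation kfree := (@kfree k).
Local Notation word n := {ffun 'I_d -> 'I_n}.
Implicit Types (V W : pk) (J K : {set 'I_d.-1}).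

Lemma young_mul J s r : s \in young J -> r \in young J -> (s * r)%g \in young J.
Proof. by move=> /youngP hs /youngP hr; apply/youngP => p; rewrite permM hr hs. Qed.

Lemma young1 J : 1%g \in young J.
Proof. by apply/youngP => p; rewrite perm1. Qed.

Lemma young_inv J s : s \in young J -> s^-1%g \in young J.
Proof. by move=> /youngP hs; apply/youngP => p; rewrite -[in RHS](permKV s p) hs. Qed.

Lemma bar_cplx_exact n i (x : bar_cplx k d (i + 1) (kfree n)) :
  i + 1 != 0 -> is_cycle x -> is_boundary x.
Proof.
move=> i1 cx; pose c := (x : bar d (i + 1) (kfree n)).
(* In the remaining case [i + 1] is positive and this term of the complex is zero. *)
have [[j ij]|ni] := pselect (exists j : nat, i + 1 = - j.+1%:Z); last first.
  exists 0; rewrite linear0; apply: bar_ext => J; rewrite bar0E bar_deg//.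
  apply: contra_notN ni => /eqP/eqP; rewrite addr_eq0 => /eqP e.
  case: #|J| e => [/esym/eqP|j e]; last by exists j; rewrite e opprK.
  by rewrite oppr_eq0 (negbTE i1).
have ii : i = - j.+2%:Z by rewrite -[i](addrK 1) ij -opprD -PoszD addn1.
(* The generator is the indicator of the orbit of [w]. A sum over the group would have the order of
   a stabilizer as leading coefficient instead of 1. *)
pose orb J (w u : word n) := [exists s, (s \in young J) && (u == wact w s)].
have orbP J w u : reflect (exists2 s, s \in young J & u = wact w s) (orb J w u).
  apply: (iffP existsP) => [[s /andP[sJ /eqP->]]|[s sJ ->]]; exists s => //.
  by rewrite sJ eqxx.
have [|||||||b [Sb bj bE]] := @bar_exact k _ (word n) (@lex d n) (@lex_trans d n) (@lex_irr d n)
  (@wasc d n) (fun J f => forall s, s \in young J -> sact s f = f)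
  (fun J w => [ffun u => (orb J w u)%:R : k^o])
  (fun J a f g Sf Sg s sJ => etrans (linearP _ _ _ _) (congr2 (fun f g => a *:
    f + g) (Sf s sJ) (Sg s sJ)))
  (fun J K f KJ Sf s sK => Sf s (subsetP (young_sub KJ) s sK))
  _ _ _ _ j (fun J => tval (c J)) _ _ _; last first.
- have bP : [ffun J => to_free (b J)] \in @bar_pred k d i (kfree n).
    apply/asboolP => J; rewrite ffunE; split=> [s sJ|Ji]; apply: val_inj; first exact: Sb.
    by apply: bj; apply: contraNneq Ji => ->; rewrite ii subrr.
  exists (Bar bP); apply: bar_ext => J; apply: val_inj.
  apply: etrans (bE J) _; rewrite bar_cdiffE [RHS](linear_bar_diff (val :
    {linear tens (kfree n) -> _})).
  by apply: eq_bar_diff => K; rewrite /= ffunE.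
- move=> J; have /(congr1 (fun z : bar d (i + 1 + 1) (kfree n) => tval (z J))) := cx.
  rewrite bar_cdiffE bar0E [LHS](linear_bar_diff (val : {linear tens (kfree n) -> _})).
  exact.
- move=> J Jj; rewrite bar_deg//; apply: contra Jj; rewrite ij subr_eq0.
  by rewrite eqz_nat.
- by move=> J s sJ; rewrite -[in RHS](bar_inv c sJ).
- move=> J w u Jw uw nl; rewrite ffunE; have [/orbP[s sJ e]|//] := boolP (orb J w u).
  by case/negP: nl; rewrite e; apply: young_lex Jw sJ _; rewrite -e.
- move=> J w _; rewrite ffunE; have -> // : orb J w w.
  by apply/orbP; exists 1%g; rewrite ?young1 ?wact1.
- move=> J w _ s sJ; apply/ffunP => u; rewrite !ffunE; congr (_%:R); congr nat_of_bool.
  apply/orbP/orbP => -[r rJ e].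
    by exists (s^-1 * r)%g; rewrite ?young_mul ?young_inv// -wactM -(e : wact u s = _) wactK.
  by exists (s * r)%g; rewrite ?young_mul// -[LHS]/(wact u s) e wactM.
(* At a descent the transposition gives a lexicographically smaller word, and an invariant function
   has the same value there. *)
- move=> J f w Sf f0 /subsetPn[a aJ]; rewrite inE -ltnNge => /lex_adj/f0 <-.
  by rewrite -[in LHS](Sf _ (adj_young aJ)) ffunE.
Qed.

Lemma bar_single_boundary W a (t : tens W) : tsact (adj a) t = t ->
  exists y : bar d (-1) W, bar_d y set0 = t.
Proof.
move=> ta; have yP : [ffun J => if J == [set a] then t else 0] \in @bar_pred k d (-1) W.
  apply/asboolP => J; rewrite ffunE; case: eqP => [->|_]; split=> // s.
  - by move=> /young_set1[->|->]; rewrite ?tsact1.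
  - by move: s; rewrite cards1 subrr eqxx.
  - by rewrite linear0.
exists (Bar yP); rewrite bar_dE /bar_diff (bigD1 a) ?inE//= big1 ?addr0.
  by rewrite ffunE setU0 eqxx bar_sign0 scale1r.
move=> b /andP[_ ba]; rewrite ffunE setU0; case: eqP => [/set1_inj e|_]; last by rewrite scaler0.
by rewrite e eqxx in ba.
Qed.

Lemma tsact_tprod V s (v : 'I_d -> pkmod V) : tsact s (tprod v) = tprod (fun p => v (s^-1%g p)).
Proof.
apply/val_inj/ffunP => w; rewrite /= !ffunE [RHS](reindex_inj (@perm_inj _ s)).
by apply: eq_bigr => p _; rewrite ffunE permK.
Qed.

(** Equal factors in neighbouring positions give a tensor fixed by an adjacent transposition, which
    is a boundary. Otherwise the right one of the equal factors is moved leftwards; each swap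
    changes [t] into [- tsact (adj c) t] up to [t + tsact (adj c) t], which is itself fixed. *)
Lemma alt_rel_boundary W (t : tens W) : span (@alt_rel k d W) t ->
  exists y : bar d (-1) W, bar_d y set0 = t.
Proof.
have dP a (y z : bar d (-1) W) t' u : bar_d y set0 = t' -> bar_d z set0 = u ->
    exists x : bar d (-1) W, bar_d x set0 = a *: t' + u.
  by move=> yt zu; exists (a *: y + z); rewrite -yt -zu -barDE; congr (bar_fun _ set0); exact:
    bar_d_linear.
suff gen (v : 'I_d -> pkmod W) (a b : 'I_d) : (a < b)%N -> v a = v b ->
    exists y : bar d (-1) W, bar_d y set0 = tprod v.
  elim=> [|a x y [v [p [q [pq vpq ->]]]] _ [z zy]].
    by exists 0; rewrite bar_dE /bar_diff big1// => a _; rewrite bar0E scaler0.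
  have [z' z'E] : exists z' : bar d (-1) W, bar_d z' set0 = tprod v; last exact: dP z'E zy.
  move: pq; rewrite -val_eqE neq_ltn => /orP[pq|qp]; first exact: gen pq vpq.
  exact: gen qp (esym vpq).
have [m] := ubnP (b : nat); elim: m v b => // m IH v b bm ab vab.
have [c bc] := pred_adj ab; rewrite leq_eqVlt => /orP[/eqP/val_inj ac|ac].
  apply: (@bar_single_boundary _ c); rewrite tsact_tprod adjK; congr tprod; apply/funext => p.
  rewrite /adj; case: tpermP => [->|->|//]; first by rewrite -bc -ac vab.
  by rewrite -bc -ac vab.
have [y yE] : exists y : bar d (-1) W, bar_d y set0 = tprod v + tsact (adj c) (tprod v).
  by apply: (@bar_single_boundary _ c); rewrite linearD /= tsactM -[X in (X * _)%g]adjK mulVg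
    tsact1 addrC.
have [|||z zE] := IH (fun p => v ((adj c)^-1%g p)) (adjl c).
- by move: bm; rewrite bc.
- exact: ac.
- rewrite adjK {2}/adj tpermL -bc -vab /adj tpermD//; first by rewrite -val_eqE /= gtn_eqF.
  by rewrite -val_eqE /= gtn_eqF// ltnW.
rewrite -tsact_tprod in zE; have [x xE] := dP (-1) z y _ _ zE yE.
by exists x; rewrite xE scaleN1r addrC addrK.
Qed.

Definition bar_to_ext_fun W (c : bar d 0 W) : ext_power k d W := qproj (@alt_rel k d W) (c set0).
Lemma bar_to_ext_linear W : linear (@bar_to_ext_fun W).
Proof. by move=> a c c'; rewrite /bar_to_ext_fun barDE linearP. Qed.
Lemma bar_to_ext_nat V W (f : ghom d V W) (c : bar_rep k d 0 V) :
  bar_to_ext_fun (rmap (bar_rep k d 0) f c) = rmap (ext_power k d) f (bar_to_ext_fun c).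
Proof. by rewrite /bar_to_ext_fun bar_mapE; exact: esym (tq_mapE (@alt_stable k d) f _). Qed.
Definition bar_to_ext : nat_trans (bar_rep k d 0) (ext_power k d) :=
  @nt_build k d (bar_rep k d 0) (ext_power k d) bar_to_ext_fun bar_to_ext_linear bar_to_ext_nat.

Lemma bar_to_ext_d W (y : bar_cplx k d (-1) W) : bar_to_ext W (cdiff (bar_cplx k d) (-1) W y) = 0.
Proof.
rewrite /= /bar_to_ext_fun -(linear0 (qproj (@alt_rel k d W))); apply/qprojP; rewrite subr0.
rewrite bar_dE; apply: span_sum => a _; apply: spanZ; apply: (alt_invariant (adj_neq a)).
by apply: bar_inv; apply: adj_young; rewrite !inE eqxx.
Qed.

Definition bar_ext_map : chain_map (bar_cplx k d) (conc (ext_power k d)) := conc_map bar_to_ext_d.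

Lemma bar0_ext W (c c' : bar d 0 W) : c set0 = c' set0 -> c = c'.
Proof.
move=> e; apply: bar_ext => J; have [->//|J0] := eqVneq J set0.
by rewrite !bar_deg// addr0 eqz_nat cards_eq0.
Qed.

Lemma bar_pos V (x : bar_rep k d 1 V) : x = 0.
Proof. by apply: bar_ext => J; rewrite bar0E bar_deg// -PoszD addn1. Qed.

Lemma bar_ext_map_quasi_iso : quasi_iso bar_ext_map.
Proof.
apply: conc_map_quasi_iso.
- exact: bar_pos.
- exact: bar_cplx_exact.
- move=> n x; rewrite /= /bar_to_ext_fun -(linear0 (qproj _)) => /qprojP; rewrite subr0.
  by move=> /alt_rel_boundary[y yE]; exists y; apply: bar0_ext.
- move=> n; apply: qprojW => t.
  have xP : [ffun J => if J == set0 then t else 0] \in @bar_pred k d 0 (kfree n).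
    apply/asboolP => J; rewrite ffunE; case: eqP => [->|_]; split=> // s; last by rewrite linear0.
      by move/young_set0 ->; rewrite tsact1.
    by move: s; rewrite cards0 eqxx.
  by exists (Bar xP : bar_rep k d 0 (kfree n)); rewrite /= /bar_to_ext_fun ffunE eqxx.
Qed.

Definition bar_resolution : K_projective_resolution (conc (ext_power k d)) :=
  KProjRes (@bar_cplx_K_projective k d) bar_ext_map_quasi_iso.

End BarResolution.

(** * The tensor product of the resolution with the exterior power *)

Section Antisymmetrizer.
Variables (k : comPzRingType) (d : nat).
Local Notation pk := (pk k).
Local Notation tens := (@tens k d).
Local Notation Lambda := (ext_power k d).
Implicit Types (V W U : pk) (J K : {set 'I_d.-1}) (s : 'S_d).

Definition sgn s : k := (-1) ^+ odd_perm s.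

Definition asym V (t : tens V) : tens V := \sum_s sgn s *: tsact s t.

Lemma asym_linear V : linear (@asym V).
Proof.
move=> a t u; rewrite /asym scaler_sumr -big_split; apply: eq_bigr => s _ /=.
by rewrite linearP scalerDr !scalerA mulrC.
Qed.
HB.instance Definition _ V := GRing.isLinear.Build k (tens V) (tens V) *:%R (@asym V)
  (@asym_linear V).

Lemma asym_nat V W (f : ghom d V W) t : f (asym t) = asym (f t).
Proof. by rewrite linear_sum; apply: eq_bigr => s _; rewrite linearZ /= ghom_sact. Qed.

Definition even_sum V (t : tens V) : tens V := \sum_(s | ~~ odd_perm s) tsact s t.

(** The odd permutations are the even ones times a transposition, on either side. The first form
    kills tensors fixed by the transposition without dividing by 2; the second form is the shape
    [z - s z] that defines alternating tensors later on. *)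
Lemma asym_even V (t : tens V) (a b : 'I_d) : a != b ->
  asym t = even_sum t - even_sum (tsact (tperm a b) t) /\
  asym t = even_sum t - tsact (tperm a b) (even_sum t).
Proof.
move=> ab; have oddE (h : 'S_d -> 'S_d) : injective h -> (forall s,
  odd_perm (h s) = ~~ odd_perm s) ->
    asym t = even_sum t - \sum_(s | ~~ odd_perm s) tsact (h s) t.
  move=> hI hodd; rewrite /asym (bigID (fun s => ~~ odd_perm s)) /=; congr (_ + _).
    by apply: eq_bigr => s /negbTE; rewrite /sgn => ->; rewrite scale1r.
  rewrite (reindex_inj hI) -sumrN; apply: eq_big => s; first by rewrite hodd negbK.
  by rewrite hodd negbK /sgn hodd => ->; rewrite scaleN1r.
split.
  rewrite (oddE (mulg (tperm a b)) (mulgI _)) => [|s]; last by rewrite odd_mul_tperm ab.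
  by congr (_ - _); apply: eq_bigr => s _; rewrite tsactM.
rewrite (oddE (fun s => s * tperm a b)%g (mulIg _)) => [|s].
  by congr (_ - _); rewrite linear_sum; apply: eq_bigr => s _; rewrite /= tsactM.
by rewrite odd_permM odd_tperm ab addbT.
Qed.

Lemma asym_alt_rel V (t : tens V) : alt_rel t -> asym t = 0.
Proof.
move=> [v [a [b [ab vab ->]]]]; rewrite (asym_even _ ab).1.
rewrite [X in even_sum X - _](_ : _ = tsact (tperm a b) (tprod v)) ?subrr//.
rewrite tsact_tprod; congr tprod; apply/funext => p; rewrite tpermV.
by case: tpermP => [->|->|].
Qed.

Definition ext_asym V : {linear Lambda V -> tens V} := qlin (@asym_alt_rel V).

Lemma ext_asymE V (t : tens V) : ext_asym V (qproj (@alt_rel k d V) t) = asym t.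
Proof. exact: (qlift_proj (@asym_alt_rel V)). Qed.

Lemma ext_asym_nat V W (f : ghom d V W) (z : Lambda V) :
  ext_asym W (rmap Lambda f z) = f (ext_asym V z).
Proof.
move: z; apply: qprojW => t; rewrite ext_asymE asym_nat -ext_asymE; congr (ext_asym W _).
exact: (tq_mapE (@alt_stable k d) f t).
Qed.

Lemma ext_sgn V (t : tens V) s :
  qproj (@alt_rel k d V) (tsact s t) = sgn s *: qproj (@alt_rel k d V) t.
Proof.
have [ts -> {s}] := prod_tpermP s; elim: ts t => [|[a b] ts IH] t /=.
  by rewrite big_nil tsact1 /sgn odd_perm1 scale1r.
move=> /andP[ab /IH h]; rewrite big_cons /= -tsactM h.
have -> : qproj (@alt_rel k d V) (tsact (tperm a b) t) = - qproj (@alt_rel k d V) t.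
  apply/eqP; rewrite -addr_eq0 -linearD -(linear0 (qproj (@alt_rel k d V))); apply/eqP/qprojP.
  rewrite subr0; apply: (alt_invariant ab).
  by rewrite linearD /= tsactM tperm2 tsact1 addrC.
by rewrite /sgn odd_mul_tperm (ab : a != b) /= signrN scalerN scaleNr.
Qed.

End Antisymmetrizer.

(** * The Yoneda lemma and sums in the Day convolution *)

Section Yoneda.
Variables (k : comPzRingType) (d : nat) (X : rep k d) (V : pk k).
Local Notation Gamma := (@Gamma k d).

Definition yoneda_fun (z : X V) W (g : Gamma V W) : X W := rmap X g z.
Lemma yoneda_linear z W : linear (@yoneda_fun z W).
Proof. by move=> a g h; exact: rmap_linear. Qed.
Lemma yoneda_nat z W W' (f : ghom d W W') (g : Gamma V W) :
  yoneda_fun z (rmap (Gamma V) f g) = rmap X f (yoneda_fun z g).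
Proof. exact: rmap_comp. Qed.
Definition yoneda z : nat_trans (Gamma V) X := nt_build (yoneda_linear z) (yoneda_nat z).

Lemma nt_yoneda (x : nat_trans (Gamma V) X) W (g : Gamma V W) : x W g = rmap X g (x V (gidm d V)).
Proof. by rewrite -ntr_nat; congr (x W _); exact: ghomP. Qed.

Lemma yoneda_ext (x y : nat_trans (Gamma V) X) : x V (gidm d V) = y V (gidm d V) -> x = y.
Proof. by move=> e; apply: nt_ext => W g; rewrite nt_yoneda e -nt_yoneda. Qed.

End Yoneda.

Section DaySums.
Variables (k : comPzRingType) (d : nat) (X Y : rep k d) (U : pk k).
Local Notation Gamma := (@Gamma k d).

Lemma day_in_eq0r V (x : nat_trans (Gamma V) X) W (y : nat_trans (Gamma W) Y)
    (h : ghom d (pktens V W) U) : (forall Z z, y Z z = 0) -> day_in x y h = 0.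
Proof.
move=> y0; have := @day_in_linr k d X Y U V x W y y y 1 h; rewrite scale1r => /(_ _)/eqP.
rewrite -[X in X == _]addr0 (inj_eq (addrI _)) => e; apply/eqP; rewrite eq_sym; apply: e => Z z.
by rewrite y0 scaler0 addr0.
Qed.

Lemma day_in_eq0l V (x : nat_trans (Gamma V) X) W (y : nat_trans (Gamma W) Y)
    (h : ghom d (pktens V W) U) : (forall Z z, x Z z = 0) -> day_in x y h = 0.
Proof.
move=> x0; have := @day_in_linl k d X Y U V x x x W y 1 h; rewrite scale1r => /(_ _)/eqP.
rewrite -[X in X == _]addr0 (inj_eq (addrI _)) => e; apply/eqP; rewrite eq_sym; apply: e => Z z.
by rewrite x0 scaler0 addr0.
Qed.

Lemma day_in_sumr V (x : nat_trans (Gamma V) X) W (h : ghom d (pktens V W) U)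
    (I : Type) (r : seq I) (F : I -> nat_trans (Gamma W) Y) (y : nat_trans (Gamma W) Y) :
  (forall Z z, y Z z = \sum_(j <- r) F j Z z) -> day_in x y h = \sum_(j <- r) day_in x (F j) h.
Proof.
elim: r y => [|j r IH] y yE.
  by rewrite big_nil day_in_eq0r// => Z z; rewrite yE big_nil.
(* Natural transformations carry no addition here, so the sum of the tail is formed on the universal
   element. *)
pose y' := yoneda (\sum_(j <- r) F j W (gidm d W)).
have y'E Z z : y' Z z = \sum_(j <- r) F j Z z.
  rewrite /= /yoneda_fun linear_sum; apply: eq_bigr => i _.
  exact: esym (nt_yoneda _ _).
rewrite big_cons -(IH y')//.
rewrite (@day_in_linr k d X Y U V x W y (F j) y' 1) ?scale1r// => Z z.
by rewrite scale1r yE big_cons y'E.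
Qed.

Lemma day_in_linearh V (x : nat_trans (Gamma V) X) W (y : nat_trans (Gamma W) Y) :
  linear (fun h => @day_in k d X Y U V x W y h).
Proof. by move=> a h h'; exact: day_in_lin. Qed.

Lemma day_in_sumh V (x : nat_trans (Gamma V) X) W (y : nat_trans (Gamma W) Y)
    (I : Type) (r : seq I) (F : I -> ghom d (pktens V W) U) :
  day_in x y (\sum_(j <- r) F j) = \sum_(j <- r) day_in x y (F j).
Proof. exact: (linear_sum (linear_pack (day_in_linearh x y))). Qed.

Lemma day_in_eq0h V (x : nat_trans (Gamma V) X) W (y : nat_trans (Gamma W) Y) :
  day_in x y (0 : ghom d (pktens V W) U) = 0.
Proof. exact: (linear0 (linear_pack (day_in_linearh x y))). Qed.

End DaySums.

Lemma gcompE (k : comPzRingType) d U V W (g : @ghom k d V W) (f : ghom d U V) t :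
  gcomp g f t = g (f t).
Proof. by []. Qed.

(** * Words of pairs and maps out of a tensor square *)

Section PairWords.
Variables (k : comPzRingType) (d : nat).
Local Notation word n := {ffun 'I_d -> 'I_n}.
Local Notation kfree := (@kfree k).
Local Notation tgen V i := (@tgen k d V i).
Local Notation VV := (pktens (kfree d) (kfree d)).

(** Its basis tensor generates the tensor power functor, hence also the exterior power. Its
    stabilizer is trivial, so every tensor is an admissible value there. *)
Definition idw : word d := [ffun p => p].

Lemma idw_free s : wact idw s = idw -> s = 1%g.
Proof. by move=> /ffunP e; apply/permP => p; have := e p; rewrite !ffunE perm1. Qed.

Lemma wact_pair n m (v : word n) (w : word m) s :
  wact (pair_idx (v, w)) s = pair_idx (wact v s, wact w s).
Proof. by apply/ffunP => a; rewrite !ffunE. Qed.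

Lemma pair_idx_inj n m (v v' : word n) (w w' : word m) :
  pair_idx (v, w) = pair_idx (v', w') -> v = v' /\ w = w'.
Proof.
by move=> e; split; [rewrite -(fst_pair_idx v w) e fst_pair_idx | rewrite -(snd_pair_idx v w) e
  snd_pair_idx].
Qed.

Lemma word_pairE n m (K : word (n * m)) : K = pair_idx (fst_idx K, snd_idx K).
Proof. by apply/ffunP => a; rewrite !ffunE -surjective_pairing mxtens_unindexK. Qed.

Lemma tenstens0l V W (u : tens d W) : tenstens (0 :
  tens d V) u = 0 :> tens d (pktens (k := k) V W).
Proof. by apply/val_inj/ffunP => K; rewrite /= !ffunE mul0r. Qed.

Lemma tenstens0r V W (t : tens d V) : tenstens t (0 :
  tens d W) = 0 :> tens d (pktens (k := k) V W).
Proof. by apply/val_inj/ffunP => K; rewrite /= !ffunE mulr0. Qed.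

Lemma VV_free : is_free VV. Proof. exact: pktens_free. Qed.

Lemma tgen_pair (v w : word d) :
  tgen VV (pair_idx (v, w)) = tenstens (tgen (kfree d) v) (tgen (kfree d) w).
Proof.
apply/val_inj/ffunP => K; apply: etrans (tgen_coord _ _ VV_free) _;
  rewrite [RHS]ffunE !tgen_coord//.
rewrite -natrM mulnb; congr (_%:R); congr nat_of_bool.
apply/eqP/andP => [<-|[/eqP-> /eqP->]]; first by rewrite fst_pair_idx snd_pair_idx !eqxx.
exact: esym (word_pairE K).
Qed.

(** If [v] is a permutation of [idw], equivariance moves the pair [(v, w)] to a pair with first
    component [idw]. *)
Lemma ghom_pair_ext U (f g : ghom d VV U) :
  (forall w, f (tenstens (tgen (kfree d) idw) (tgen (kfree d) w)) =
             g (tenstens (tgen (kfree d) idw) (tgen (kfree d) w))) ->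
  (forall v w, (forall s, v <> wact idw s) ->
     f (tenstens (tgen (kfree d) v) (tgen (kfree d) w)) =
     g (tenstens (tgen (kfree d) v) (tgen (kfree d) w))) -> f = g.
Proof.
move=> h1 h2; apply: ghom_tgen_ext => K; rewrite (word_pairE K).
move: (fst_idx K) (snd_idx K) => v w; rewrite tgen_pair.
have [[s ->]|nv] := pselect (exists s, v = wact idw s); last by apply: h2 => s vs; apply: nv;
  exists s.
rewrite -[w](wactVK s); move: (wact w s^-1%g) => w'.
by rewrite !tgen_wact -tsact_tenstens !ghom_sact h1.
Qed.

Lemma pair_orbit_inv U (w : word d) (t : tens d U) : orbit_inv (V := VV) (pair_idx (idw, w)) t.
Proof. by move=> s; rewrite wact_pair => /pair_idx_inj[/idw_free-> _]; rewrite tsact1. Qed.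

Lemma idw_orbit_inv U (t : tens d U) : orbit_inv (V := kfree d) idw t.
Proof. by move=> s /idw_free->; rewrite tsact1. Qed.

End PairWords.

Arguments pair_orbit_inv {k d U} w t.
Arguments idw_orbit_inv {k d U} t.

(** * The Day convolution with the exterior power, in terms of tensors *)

Section DayBar.
Variables (k : comPzRingType) (d : nat).
Local Notation pk := (pk k).
Local Notation tens := (@tens k d).
Local Notation kfree := (@kfree k).
Local Notation word n := {ffun 'I_d -> 'I_n}.
Local Notation tgen V i := (@tgen k d V i).
Local Notation Lambda := (ext_power k d).
Local Notation Gamma := (@Gamma k d).
Local Notation VV := (pktens (kfree d) (kfree d)).
Local Notation idw := (idw d).
Local Notation blk := (@blk d).
Local Notation bar := (@bar k d).
Implicit Types (U V W : pk) (J K : {set 'I_d.-1}).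
Implicit Type i : int.

Section Phi.
Variables (i : int) (U : pk).

(** By Yoneda a generator consists of an element of the exterior power of [V], an element of
    [bar_rep k d i W] and a map [h]. Antisymmetrizing turns the first into a tensor, which is
    multiplied factorwise with each component of the second and pushed along [h]. *)
Definition day_bar_gen (g : day_gen Lambda (bar_rep k d i) U) : {ffun {set 'I_d.-1} -> tens U} :=
  [ffun J => day_h g (tenstens (ext_asym d _ (day_x g _ (gidm d _)))
                               ((day_y g _ (gidm d _) : bar i _) J))].

Lemma day_bar_compat : day_compat day_bar_gen.
Proof.
apply: day_compatP => [V V' f x W W' g y h|V x W y a h h'|V x x1 x2 W y a h xE
  |V x W y y1 y2 a h yE]; apply/ffunP => J; rewrite !ffunE.
- rewrite -[RHS]/(h (gtens f g (tenstens (ext_asym d V' (x V' (gidm d V'))) ((y W' (gidm d W') :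
  bar i W') J)))).
  rewrite gtensE -ext_asym_nat -bar_mapE.
  have xf : nt_comp x (Gamma_map f) V (gidm d V) = rmap Lambda f (x V' (gidm d V')).
    by apply: etrans (nt_yoneda x (gcomp (gidm d V) f)) _; congr (rmap _ _ _); exact: ghomP.
  have yg : nt_comp y (Gamma_map g) W (gidm d W) = rmap (bar_rep k d i) g (y W' (gidm d W')).
    by apply: etrans (nt_yoneda y (gcomp (gidm d W) g)) _; congr (rmap _ _ _); exact: ghomP.
  rewrite -[LHS]/(h (tenstens (ext_asym d V (nt_comp x (Gamma_map f) V (gidm d V)))
    ((nt_comp y (Gamma_map g) W (gidm d W) : bar i W) J))).
  by rewrite xf yg.
- by [].
- rewrite -[LHS]/(h (tenstens (ext_asym d V (x V (gidm d V))) ((y W (gidm d W) : bar i W) J))).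
  by rewrite xE linearP tenstensPl linearP.
- rewrite -[LHS]/(h (tenstens (ext_asym d V (x V (gidm d V))) ((y W (gidm d W) : bar i W) J))).
  by rewrite yE barDE tenstensPr linearP.
Qed.

Definition day_bar : {linear day_obj Lambda (bar_rep k d i) U -> {ffun {set 'I_d.-1} -> tens U}}
  :=
  day_desc day_bar_compat.

Lemma day_barE V x W y h J : day_bar (@day_in k d Lambda (bar_rep k d i) U V x W y h) J =
  h (tenstens (ext_asym d V (x V (gidm d V))) ((y W (gidm d W) : bar i W) J)).
Proof. by rewrite /day_bar day_descE ffunE. Qed.

Lemma day_barD a u v J : day_bar (a *: u + v) J = a *: day_bar u J + day_bar v J.
Proof. by rewrite linearP !ffunE. Qed.

Lemma day_barB u v J : day_bar (u - v) J = day_bar u J - day_bar v J.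
Proof. by rewrite linearB !ffunE. Qed.

Lemma day_bar0 J : day_bar 0 J = 0.
Proof. by rewrite linear0 ffunE. Qed.

Lemma day_bar_deg u J : #|J|%:Z + i != 0 -> day_bar u J = 0.
Proof.
move=> Ji; elim/day_ind: u => [|a V x W y h u IH]; first exact: day_bar0.
rewrite day_barD IH addr0 day_barE bar_deg//.
by rewrite tenstens0r linear0 scaler0.
Qed.

(** The component at [J] of the second factor is fixed by [adj a], so the shape
    [z - tsact (adj a) z] of an antisymmetrized tensor passes to the product. *)
Lemma day_bar_alt u J a : a \in J -> exists z, day_bar u J = z - tsact (adj a) z.
Proof.
move=> aJ; elim/day_ind: u => [|b V x W y h u [z zE]].
  by exists 0; rewrite day_bar0 linear0 subrr.
have [z' z'E] : exists z', day_bar (day_in x y h) J = z' - tsact (adj a) z'.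
  rewrite day_barE; move: (x V _) => l; move: l; apply: qprojW => t; rewrite ext_asymE.
  rewrite (asym_even _ (adj_neq a)).2; set e := even_sum t; set c := (y W _ : bar i W).
  exists (h (tenstens e (c J))); rewrite -ghom_sact tsact_tenstens (bar_inv c (adj_young aJ))
    -linearB.
  congr (h _); have := tenstensPl (-1) (tsact (adj a) e) e (c J).
  by rewrite !scaleN1r addrC => ->; rewrite addrC.
exists (b *: z' + z); rewrite day_barD z'E zE linearP /= scalerBr.
by rewrite opprD addrACA.
Qed.

End Phi.

Lemma day_bar_nat i U U' (f : ghom d U U') u J :
  day_bar i U' (rmap (day Lambda (bar_rep k d i)) f u) J = f (day_bar i U u J).
Proof.
elim/day_ind: u => [|a V x W y h u IH]; first by rewrite linear0 !day_bar0 linear0.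
rewrite [rmap _ _ _]linearP !day_barD IH linearP; congr (_ *: _ + _).
rewrite -[rmap _ _ _]/(day_rmap Lambda (bar_rep k d i) f _) day_rmapE.
by rewrite !day_barE.
Qed.

Lemma day_bar_diff i U u J :
  day_bar (i + 1) U (day_map Lambda (cdiff (bar_cplx k d) i) U u) J = bar_diff (day_bar i U u) J.
Proof.
elim/day_ind: u => [|a V x W y h u IH].
  by rewrite linear0 day_bar0 [RHS]big1// => a _; rewrite day_bar0 scaler0.
rewrite linearP day_barD IH day_mapE day_barE.
transitivity (a *: bar_diff (day_bar i U (day_in x y h)) J + bar_diff (day_bar i U u) J);
  last first.
  by rewrite -bar_diff_linear; apply: eq_bar_diff => K; rewrite day_barD.
congr (_ *: _ + _); set z := ext_asym d V _; set c := (y W (gidm d W) : bar i W).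
have zl : linear (fun t => h (tenstens z t)) by move=> b t t'; rewrite tenstensPr linearP.
rewrite -[LHS]/(linear_pack zl _) bar_cdiffE linear_bar_diff.
by apply: eq_bar_diff => K; rewrite day_barE.
Qed.

Lemma day_bar_pos i U (u : day Lambda (bar_rep k d i) U) : 0 < i -> u = 0.
Proof.
move=> i0; elim/day_ind: u => // a V x W y h u ->.
rewrite day_in_eq0r ?scaler0 ?addr0// => Z z; apply: bar_ext => J; rewrite bar0E bar_deg//.
by rewrite gt_eqF// ltr_wpDl.
Qed.

Definition ext_unit : Lambda (kfree d) := qproj (@alt_rel k d (kfree d)) (tgen (kfree d) idw).
Definition ext_gen : nat_trans (Gamma (kfree d)) Lambda := yoneda ext_unit.
Definition bar_gen i J : nat_trans (Gamma (kfree d)) (bar_rep k d i) :=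
  yoneda (bar_unit k i J : bar_rep k d i (kfree d)).
Definition pair_map U J (t : tens U) : ghom d VV U := orbit_map (pair_orbit_inv (blk J) t).

(* Under the identification of Lambda^d (x) Gamma^J with the exterior powers along the
   blocks of J, this is the image of t in the quotient of U^{(x) d}. *)
Definition day_cls i U J (t : tens U) : day Lambda (bar_rep k d i) U :=
  day_in ext_gen (bar_gen i J) (pair_map J t).

Lemma day_cls_linear i U J : linear (@day_cls i U J).
Proof.
move=> a t t'; rewrite /day_cls -day_in_lin; congr day_in.
exact: orbit_map_linear.
Qed.
HB.instance Definition _ i U J := GRing.isLinear.Build k (tens U) (day Lambda (bar_rep k d i) U)
  *:%R (@day_cls i U J) (@day_cls_linear i U J).

Lemma pair_map_id U J (t : tens U) w :
  pair_map J t (tenstens (tgen (kfree d) idw) (tgen (kfree d) w)) = if w == blk J then t else 0.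
Proof.
rewrite -tgen_pair; case: eqP => [->|wJ]; first by rewrite orbit_map_tgen//; exact: VV_free.
rewrite orbit_map_off//; first exact: VV_free.
by move=> s; rewrite wact_pair => /pair_idx_inj[/esym/idw_free->]; rewrite wact1.
Qed.

Lemma pair_map_off U J (t : tens U) v w : (forall s, v <> wact idw s) ->
  pair_map J t (tenstens (tgen (kfree d) v) (tgen (kfree d) w)) = 0.
Proof.
move=> nv; rewrite -tgen_pair orbit_map_off//; first exact: VV_free.
by move=> s; rewrite wact_pair => /pair_idx_inj[/nv].
Qed.

Definition id_map U (t : tens U) : ghom d (kfree d) U := orbit_map (idw_orbit_inv t).

Lemma id_map_id U (t : tens U) : id_map t (tgen (kfree d) idw) = t.
Proof. exact: orbit_map_tgen. Qed.

Lemma id_map_off U (t : tens U) v : (forall s, v <> wact idw s) -> id_map t (tgen (kfree d) v) =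
  0.
Proof. by move=> nv; rewrite orbit_map_off. Qed.

Lemma ext_gen_map V (t : tens V) (x : nat_trans (Gamma V) Lambda) :
  x V (gidm d V) = qproj (@alt_rel k d V) t -> x = nt_comp ext_gen (Gamma_map (id_map t)).
Proof.
move=> xt; apply: yoneda_ext; rewrite xt.
rewrite -[RHS]/(rmap Lambda (gcomp (gidm d V) (id_map t)) ext_unit).
apply: esym; apply: etrans (tq_mapE (@alt_stable k d) _ _) _.
by congr (qproj _ _); exact: id_map_id.
Qed.

Lemma blk_unit_inv J : orbit_inv (V := kfree d) (blk J) (tgen (kfree d) (blk J)).
Proof. by move=> s sJ; rewrite -[in LHS](invgK s) -tgen_wact -[in LHS]sJ wactK. Qed.
Arguments blk_unit_inv : clear implicits.

Lemma bar_gen_map i J :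
  bar_gen i J = nt_comp (bar_gen i J) (Gamma_map (orbit_map (blk_unit_inv J))).
Proof.
apply: yoneda_ext; rewrite -[LHS]/(rmap (bar_rep k d i) (gidm d _) (bar_unit k i J :
  bar_rep k d i _)).
rewrite -[RHS]/(rmap (bar_rep k d i) (gcomp (gidm d _) (orbit_map (blk_unit_inv J))) (bar_unit k
  i J : bar_rep k d i _)).
apply: bar_ext => K; rewrite !bar_mapE bar_unitE /=.
by case: ifP => _; rewrite ?linear0// orbit_map_tgen.
Qed.

Lemma nt_comp_gidm (X : rep k d) V (x : nat_trans (Gamma V) X) :
  nt_comp x (Gamma_map (gidm d V)) = x.
Proof. by apply: nt_ext => Z z /=; congr (x Z _); exact: ghomP. Qed.

(** The generators are unchanged by the projections to the orbits of [idw] and [blk J], so only the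
    values of [h] at pairs [(idw, v)] with [v] in the orbit of [blk J] matter. If [v] is [blk J]
    permuted by [s], the permutation is moved to the exterior factor, where it becomes [sgn k s]. *)
Lemma day_gens_span i U J h : exists t,
  day_in ext_gen (bar_gen i J) h = day_cls i J t :> day Lambda (bar_rep k d i) U.
Proof.
pose T (v : word d) := h (tenstens (tgen (kfree d) idw) (tgen (kfree d) v)).
pose r s := id_map (tgen (kfree d) (wact idw s)).
(* The part of [h] at [(idw, v)], written through [r s], so that the colimit relation can move [s]
   into the exterior factor. *)
pose H (v : word d) : ghom d VV U := if [pick s | v == wact (blk J) s] is Some s
  then gcomp (pair_map J (tsact s (T v))) (gtens (r s) (gidm d _)) else 0.
have rs s : nt_comp ext_gen (Gamma_map (id_map (tgen (kfree d) (wact idw s)))) =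
    yoneda (sgn k s *: ext_unit).
  rewrite -(ext_gen_map (x := yoneda (sgn k s *: ext_unit)))//.
  rewrite -[LHS]/(rmap Lambda (gidm d _) _) rmap_id tgen_wact ext_sgn.
  by rewrite /sgn odd_permV.
have -> : day_in ext_gen (bar_gen i J) h =
    \sum_v day_in ext_gen (bar_gen i J) (H v) :> day Lambda (bar_rep k d i) U.
  rewrite -day_in_sumh [ext_gen in LHS](ext_gen_map (t := tgen (kfree d) idw)); last first.
    by rewrite -[LHS]/(rmap Lambda (gidm d _) _) rmap_id.
  rewrite [bar_gen i J in LHS]bar_gen_map day_in_colim; congr day_in.
  have sumE x : (\sum_v H v) x = \sum_v H v x.
    have l : linear (fun g : ghom d VV U => g x) by [].
    exact: (linear_sum (linear_pack l)).
  apply: ghom_pair_ext => [w|v w nv]; rewrite sumE gcompE !gtensE.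
    rewrite id_map_id (bigD1 w)//= big1 ?addr0 => [|v vw].
      rewrite /H /r; case: pickP => [s /eqP ws|none].
        rewrite gcompE gtensE id_map_id [in LHS]ws orbit_map_on// -tgen_wact -ws.
        rewrite {1}tgen_wact -[gidm d _ _]/(tgen (kfree d) w) {3}ws tgen_wact -tsact_tenstens
          ghom_sact.
        by rewrite pair_map_id eqxx tsactM mulgV tsact1.
      rewrite orbit_map_off// => [|s ws]; last by have := none s; rewrite ws eqxx.
      by rewrite tenstens0r linear0.
    rewrite /H /r; case: pickP => [s /eqP vs|_]; last by [].
    rewrite gcompE gtensE id_map_id {1}tgen_wact -[gidm d _ _]/(tgen (kfree d) w).
    rewrite -[w](wactVK s) [tgen _ (wact _ s)]tgen_wact -tsact_tenstens ghom_sact pair_map_id.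
    case: eqP => [e|_]; last by rewrite linear0.
    by move: vw; rewrite vs -e wactVK eqxx.
  rewrite id_map_off// [RHS]big1 => [|v' _].
    by rewrite tenstens0l linear0.
  rewrite /H /r; case: pickP => [s _|_]; last by [].
  rewrite gcompE gtensE id_map_off//.
  by rewrite tenstens0l linear0.
exists (\sum_v if [pick s | v == wact (blk J) s] is Some s then sgn k s *: tsact s (T v) else 0).
rewrite linear_sum; apply: eq_bigr => v _; rewrite /H /r; case: pickP => [s _|_]; last first.
  by rewrite linear0 day_in_eq0h.
rewrite -day_in_colim nt_comp_gidm rs linearZ /=.
have -> := @day_in_linl k d Lambda (bar_rep k d i) U _ (yoneda (sgn k s *: ext_unit)) ext_gen
  (yoneda 0) _ (bar_gen i J) (sgn k s) (pair_map J (tsact s (T v))).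
  rewrite [X in _ + X]day_in_eq0l ?addr0// => Z z.
  exact: linear0.
move=> Z z; rewrite /= /yoneda_fun linearZ.
by rewrite linear0 addr0.
Qed.

Lemma day_span i U (u : day Lambda (bar_rep k d i) U) :
  exists t : {set 'I_d.-1} -> tens U, u = \sum_J day_cls i J (t J).
Proof.
elim/day_ind: u => [|a V x W y h u [t ->]].
  by exists (fun => 0); rewrite big1// => J _; rewrite linear0.
suff [t' ->] : exists t' : {set 'I_d.-1} -> tens U, day_in x y h = \sum_J day_cls i J (t' J).
  exists (fun J => a *: t' J + t J); rewrite scaler_sumr -big_split; apply: eq_bigr => J _.
  by rewrite linearP.
pose c := (y W (gidm d W) : bar i W).
have [z xz] : exists z, x V (gidm d V) = qproj (@alt_rel k d V) z.
  by move: (x V _); apply: qprojW => z; exists z.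
have yE Z g : y Z g = \sum_J nt_comp (bar_gen i J) (Gamma_map (orbit_map (bar_orbit_inv c J))) Z
  g.
  rewrite nt_yoneda -/c [c in LHS]bar_decomp linear_sum; apply: eq_bigr => J _.
  exact: esym (rmap_comp _ _ _).
rewrite (day_in_sumr _ _ yE) (ext_gen_map xz).
have := fun J => day_gens_span i J (gcomp h (gtens (id_map z) (orbit_map (bar_orbit_inv c J)))).
move=> /choice[t' t'E]; exists t'; apply: eq_bigr => J _.
by rewrite day_in_colim t'E.
Qed.

(** The invariance of [t] lets the map with value [t] factor through a word in the first factor that
    repeats a letter, and the exterior power kills such a word. *)
Lemma day_cls_eq0 i U J a (t : tens U) : a \in J -> tsact (adj a) t = t -> day_cls i J t = 0.
Proof.
(* This word repeats a letter exactly at the two positions of [a]; its stabilizer is generated by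
   [adj a], which fixes both [t] and [blk J]. *)
move=> aJ ta; pose v := blk [set a].
have it : orbit_inv (V := VV) (pair_idx (v, blk J)) t.
  move=> s; rewrite wact_pair => /pair_idx_inj[/eqP vs _].
  have /young_set1[->|->//] : s \in young [set a] by rewrite inE.
  exact: tsact1.
pose c := id_map (tgen (kfree d) v).
have -> : day_cls i J t = day_in ext_gen (bar_gen i J) (gcomp (orbit_map it) (gtens c (gidm d
  _))).
  congr day_in; apply: ghom_pair_ext => [w|v' w nv']; rewrite gcompE gtensE.
    rewrite pair_map_id id_map_id -[gidm d _ _]/(tgen (kfree d) w) -tgen_pair.
    case: eqP => [->|wJ]; first by rewrite orbit_map_tgen//; exact: VV_free.
    rewrite orbit_map_off//; first exact: VV_free.
    move=> s; rewrite wact_pair => /pair_idx_inj[/esym/eqP vs ws].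
    have sJ : s \in young J.
      by apply: (subsetP (young_sub (K := [set a]) _)); rewrite ?sub1set ?inE.
    by apply: wJ; rewrite ws; move: sJ; rewrite inE => /eqP.
  rewrite pair_map_off// id_map_off//.
  by rewrite tenstens0l linear0.
rewrite -day_in_colim day_in_eq0l// => Z z.
rewrite nt_yoneda -[nt_comp _ _ _ _]/(rmap Lambda (gcomp (gidm d _) c) ext_unit).
have -> : rmap Lambda (gcomp (gidm d _) c) ext_unit = 0; last by rewrite linear0.
apply: etrans (tq_mapE (@alt_stable k d) _ _) _; rewrite /= id_map_id.
apply: qproj_gen; exists (fun p => pkgen (V := kfree d) (v p)), (adjl a), (adjr a).
by split=> //; [exact: adj_neq | rewrite /v (@blk_adj _ _ a)// inE eqxx].
Qed.

End DayBar.

(** * Straightening, exactness and the augmentation to the symmetric power *)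

Section DayBarExact.
Variables (k : comPzRingType) (d : nat).
Local Notation pk := (pk k).
Local Notation tens := (@tens k d).
Local Notation kfree := (@kfree k).
Local Notation word n := {ffun 'I_d -> 'I_n}.
Local Notation tgen V i := (@tgen k d V i).
Local Notation Lambda := (ext_power k d).
Local Notation day_bar := (@day_bar k d).
Local Notation dayL i := (day Lambda (bar_rep k d i)).
Implicit Types (U V W : pk) (J K : {set 'I_d.-1}).
Implicit Type i : int.

Definition young_asym U J (t : tens U) : tens U := \sum_(s in young J) sgn k s *: tsact s t.

Lemma young_asym_linear U J : linear (@young_asym U J).
Proof.
move=> a t u; rewrite /young_asym scaler_sumr -big_split; apply: eq_bigr => s _ /=.
by rewrite linearP scalerDr !scalerA mulrC.
Qed.
HB.instance Definition _ U J := GRing.isLinear.Build k (tens U) (tens U) *:%R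
  (@young_asym U J) (@young_asym_linear U J).

(** In the antisymmetrization of [idw] the term of [s] amounts, up to [tsact s], to permuting
    [blk J] by [s], and [pair_map J t] is zero there unless [s] stabilizes [blk J]. *)
Lemma day_bar_cls i U J (t : tens U) K :
  day_bar i U (day_cls i J t) K = if (K == J) && (#|J|%:Z + i == 0) then young_asym J t else 0.
Proof.
rewrite day_barE.
have -> : ext_gen k d (kfree d) (gidm d (kfree d)) = ext_unit k d by exact: rmap_id.
have -> : bar_gen k i J (kfree d) (gidm d (kfree d)) = bar_unit k i J by apply: bar_ext => L;
  rewrite bar_mapE.
rewrite bar_unitE ext_asymE; case: ifP => _; last by rewrite tenstens0r linear0.
have zl : linear (fun z => pair_map J t (tenstens z (tgen (kfree d) (blk J)))).
  by move=> b z z'; rewrite tenstensPl linearP.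
rewrite -[LHS]/(linear_pack zl _) linear_sum /young_asym [RHS]big_mkcond; apply: eq_bigr => s _.
rewrite linearZ; set z := linear_pack zl _.
have -> : z = if s \in young J then tsact s t else 0.
  rewrite /z /= -[X in tenstens _ X](tgen_wactK (V := kfree d) (blk J) s) -tsact_tenstens
    ghom_sact.
  by rewrite pair_map_id inE; case: eqP => _; rewrite ?linear0.
by case: ifP => _ /=; rewrite ?scaler0.
Qed.

Definition asc_part n J (f : tens (kfree n)) : tens (kfree n) :=
  \sum_(w : word n | J \subset sasc w) (tval f w : k) *: tgen (kfree n) w.

Lemma young_asym_coord n J (w u : word n) :
  tval (young_asym J (tgen (kfree n) w)) u = \sum_(s in young J) sgn k s * (w == wact u s)%:R.
Proof.
rewrite tens_coord_sum; apply: eq_bigr => s _.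
by rewrite tens_coordZ tsact_coord (tgen_coord (V := kfree n)).
Qed.

Lemma young_asym_lead n J (w : word n) : J \subset sasc w ->
  tval (young_asym J (tgen (kfree n) w)) w = 1.
Proof.
move=> Jw; rewrite young_asym_coord (bigD1 1%g) ?young1//= wact1 eqxx /sgn odd_perm1 mulr1.
rewrite big1 ?addr0// => s /andP[sJ s1]; case: eqP => [e|]; last by rewrite mulr0.
by rewrite (sasc_free Jw sJ (esym e)) eqxx in s1.
Qed.

Lemma young_asym_lower n J (w u : word n) : J \subset sasc w -> u != w -> ~~ lex w u ->
  tval (young_asym J (tgen (kfree n) w)) u = 0.
Proof.
move=> Jw uw nl; rewrite young_asym_coord big1// => s sJ.
case: eqP => [e|]; last by rewrite mulr0.
have ue : u = wact w s^-1%g by rewrite e wactK.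
case/negP: nl; rewrite ue; apply: (young_lex (J := J)).
- exact: subset_trans Jw (sasc_wasc w).
- exact: young_inv.
- by rewrite -ue.
Qed.

(** Each of the two words is the smallest in its orbit under [young J], so distinct ones lie in
    different orbits. *)
Lemma young_asym_asc n J (w u : word n) : J \subset sasc w -> J \subset sasc u ->
  tval (young_asym J (tgen (kfree n) w)) u = (u == w)%:R.
Proof.
move=> Jw Ju; case: eqVneq => [->|uw]; first exact: young_asym_lead.
have [wu|] := boolP (lex w u); last exact: young_asym_lower.
rewrite young_asym_coord big1// => s sJ; case: eqP => [e|]; last by rewrite mulr0.
have := young_lex (subset_trans Ju (sasc_wasc u)) sJ; rewrite -e eq_sym => /(_ uw) uw'.
by have := lex_trans wu uw'; rewrite lex_irr.
Qed.

(** Straightening: a word with equal letters at a position of [J] has class zero, and a word with a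
    descent there is minus a smaller word. So every class has a normal form on strictly ascending
    words, with coefficients read off from [young_asym]. *)
Lemma day_cls_asc i n J (t : tens (kfree n)) : #|J|%:Z + i = 0 ->
  day_cls i J t = day_cls i J (asc_part J (young_asym J t)).
Proof.
move=> Ji; have al : linear (@asc_part n J).
  move=> a f g; rewrite /asc_part scaler_sumr -big_split; apply: eq_bigr => w _.
  by rewrite tens_coordD scalerDl -scalerA.
pose F := linear_pack al.
(* Relations between classes pass to [young_asym], so both sides can be rewritten in parallel. *)
have cls0 (u : tens (kfree n)) : day_cls i J u = 0 -> young_asym J u = 0.
  move=> u0; have := day_bar_cls i J u J; rewrite u0 day_bar0 eqxx Ji eqxx.
  by move=> /esym.
apply: (tens_linear_ext (f := day_cls i J) (g := day_cls i J \o F \o young_asym J)) => w {t}.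
change (day_cls i J (tgen (kfree n) w) = day_cls i J (F (young_asym J (tgen (kfree n) w)))).
have [m] := ubnP #|[set u | lex u w]|; elim: m w => // m IH w wm.
have [Jw|/subsetPn[a aJ]] := boolP (J \subset sasc w).
  congr day_cls; rewrite -[RHS]/(asc_part J _) /asc_part (bigD1 w)//= young_asym_lead// scale1r.
  rewrite big1 ?addr0// => u /andP[Ju uw].
  by rewrite young_asym_asc// (negbTE uw) scale0r.
rewrite inE -leqNgt leq_eqVlt => /orP[/eqP/val_inj e|lt].
  have w0 : day_cls i J (tgen (kfree n) w) = 0.
    by apply: (day_cls_eq0 i aJ); rewrite -adjK -tgen_wact wact_adj_eq.
  by rewrite w0 (cls0 _ w0) !linear0.
have lexw := lex_adj lt; set w' := wact w (adj a) in lexw.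
have sum0 : day_cls i J (tgen (kfree n) w + tgen (kfree n) w') = 0.
  apply: (day_cls_eq0 i aJ).
  by rewrite linearD /w' tgen_wact adjK /= tsactM -[X in (X * _)%g]adjK mulVg tsact1 addrC.
have wE : day_cls i J (tgen (kfree n) w) = - day_cls i J (tgen (kfree n) w').
  by apply/eqP; rewrite -addr_eq0 -(linearD (day_cls i J)) [X in X == _]sum0.
have wE' : young_asym J (tgen (kfree n) w) = - young_asym J (tgen (kfree n) w').
  by apply/eqP; rewrite -addr_eq0 -(linearD (young_asym J)) [X in X == _](cls0 _ sum0).
rewrite wE wE' !linearN; congr (- _); apply: IH.
rewrite -ltnS; apply: leq_trans wm; rewrite ltnS; apply/proper_card/properP; split.
  by apply/subsetP => u; rewrite !inE => /lex_trans; apply.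
by exists w'; rewrite !inE// lex_irr.
Qed.

Lemma day_cls_deg i U J (t : tens U) : #|J|%:Z + i != 0 -> day_cls i J t = 0.
Proof.
move=> Ji; rewrite /day_cls day_in_eq0r// => Z z; rewrite nt_yoneda.
have -> : bar_gen k i J (kfree d) (gidm d (kfree d)) = bar_unit k i J by apply: bar_ext => L;
  rewrite bar_mapE.
have -> : bar_unit k i J = 0; last by rewrite linear0.
by apply: bar_ext => K; rewrite bar_unitE (negbTE Ji) andbF bar0E.
Qed.

(** [day_bar] recovers [young_asym J (t J)], and this determines the class of [t J] by
    [day_cls_asc]. *)
Lemma day_bar_inj i n (u : dayL i (kfree n)) : (forall J, day_bar i _ u J = 0) -> u = 0.
Proof.
have [t ->] := day_span u => h; rewrite big1// => J _.
have [Ji|/day_cls_deg->//] := eqVneq (#|J|%:Z + i) 0.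
rewrite day_cls_asc//; have := h J; rewrite linear_sum sum_ffunE (bigD1 J)//= big1 ?addr0 => [|K
  KJ].
  rewrite day_bar_cls eqxx Ji eqxx /= => ->; rewrite -[RHS](linear0 (day_cls i J)); congr day_cls.
  by rewrite /asc_part big1// => w _; rewrite ffunE scale0r.
by rewrite day_bar_cls eq_sym (negbTE KJ).
Qed.

Lemma day_bar_sum_cls i U (t : {set 'I_d.-1} -> tens U) J :
  day_bar i U (\sum_K day_cls i K (t K)) J = if #|J|%:Z + i == 0 then young_asym J (t J) else 0.
Proof.
rewrite linear_sum sum_ffunE (bigD1 J)//= big1 ?addr0 => [|K KJ]; rewrite day_bar_cls ?eqxx//.
by rewrite eq_sym (negbTE KJ).
Qed.

(** Read off from [day_bar_alt] in the degree [- #|J|] of the summand [J], which replaces a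
    decomposition of [young J] into cosets. *)
Lemma young_asym_alt n J a (t : tens (kfree n)) : a \in J ->
  exists z, young_asym J t = z - tsact (adj a) z.
Proof.
move=> aJ; have [z] := day_bar_alt (day_cls (- #|J|%:Z) J t) aJ.
by rewrite day_bar_cls eqxx subrr eqxx => zE; exists z.
Qed.

Lemma day_bar_exact i n (u : dayL (i + 1) (kfree n)) : i + 1 != 0 ->
  day_map Lambda (cdiff (bar_cplx k d) (i + 1)) _ u = 0 ->
  exists u' : dayL i (kfree n), u = day_map Lambda (cdiff (bar_cplx k d) i) _ u'.
Proof.
(* Here [z] may depend on [a]. Skew-invariance would be too weak: for 2 = 0 it does not force [f] to
   vanish at words with equal letters at [a]. *)
move=> i1 cu; pose S J (f : ten k d n) := forall a, a \in J -> exists z, f = z - sact (adj a) z.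
have [[j ij]|ni] := pselect (exists j : nat, i + 1 = - j.+1%:Z); last first.
  exists 0; rewrite linear0; apply: day_bar_inj => J; rewrite day_bar_deg//.
  apply: contra_notN ni => /eqP/eqP; rewrite addr_eq0 => /eqP e.
  case: #|J| e => [/esym/eqP|j e]; last by exists j; rewrite e opprK.
  by rewrite oppr_eq0 (negbTE i1).
have ii : i = - j.+2%:Z by rewrite -[i](addrK 1) ij -opprD -PoszD addn1.
have S_lin J x f g : S J f -> S J g -> S J (x *: f + g).
  move=> Sf Sg a aJ; have [z ->] := Sf a aJ; have [z' ->] := Sg a aJ.
  by exists (x *: z + z'); rewrite linearP /= scalerBr opprD addrACA.
have S_anti J K f : K \subset J -> S J f -> S K f.
  by move=> KJ Sf a aK; apply: Sf; exact: subsetP KJ a aK.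
have S_lead J f (w : word n) : S J f -> (forall u,
  lex u w -> f u = 0) -> ~~ (J \subset sasc w) -> f w = 0.
  move=> Sf f0 /subsetPn[a aJ]; rewrite inE -leqNgt leq_eqVlt; have [z zE] := Sf a aJ.
  have fE v : f v = z v - z (wact v (adj a)) by rewrite zE !ffunE.
  move=> /orP[/eqP/val_inj e|lt]; first by rewrite fE wact_adj_eq ?subrr.
  have := f0 _ (lex_adj lt); rewrite !fE wactM -[X in (X * _)%g]adjK mulVg wact1.
  by move=> /eqP; rewrite subr_eq0 => /eqP->; rewrite subrr.
have S_asym J (t : tens (kfree n)) : S J (tval (young_asym J t)).
  by move=> a /young_asym_alt-/(_ _ t)[z ->]; exists (tval z).
have [||||||b [Sb bj bE]] := @bar_exact k _ (word n) (@lex d n) (@lex_trans d n) (@lex_irr d n)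
  (@sasc d n) S (fun J w => tval (young_asym J (tgen (kfree n) w))) S_lin S_anti S_lead
  _ _ _ j (fun J => tval (day_bar _ _ u J)) _ _ _.
- by move=> J w _; exact: S_asym.
- by move=> J w; exact: young_asym_lead.
- by move=> J w v; exact: young_asym_lower.
- by move=> J a aJ; have [z ->] := day_bar_alt u aJ; exists (tval z).
- move=> J Jj; rewrite day_bar_deg//; apply: contra Jj; rewrite ij subr_eq0.
  by rewrite eqz_nat.
- move=> J; have := day_bar_diff u J; rewrite cu day_bar0 => /esym/(congr1 val).
  by rewrite [LHS](linear_bar_diff (val : {linear tens (kfree n) -> _})).
(* The primitive found by [bar_exact] must come from the Day convolution. Being alternating, it is
   determined by its values at ascending words, hence equals the antisymmetrization of its ascending
   part. *)
have asymb J : young_asym J (asc_part J (to_free (b J))) = to_free (b J).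
  apply: val_inj; apply: (lead_ext (@lex_trans d n) (@lex_irr d n) S_lin S_lead (J := J)).
  - exact: S_asym.
  - exact: Sb.
  move=> v Jv; rewrite /asc_part (linear_sum (young_asym J)); apply:
    etrans (tens_coord_sum _ _ _ _) _.
  have E c (w : word n) : tval (young_asym J (c *: tgen (kfree n) w)) v =
      c * tval (young_asym J (tgen (kfree n) w)) v by rewrite linearZ tens_coordZ.
  rewrite (bigD1 v Jv) big1 => [|w /andP[Jw vw]]; first by apply: etrans (addr0 _) _;
    rewrite E young_asym_lead// mulr1.
  by rewrite E young_asym_asc// eq_sym (negbTE vw) mulr0.
pose u' : dayL i (kfree n) := \sum_J day_cls i J (asc_part J (to_free (b J))).
have u'E J : day_bar i _ u' J = to_free (b J).
  rewrite day_bar_sum_cls asymb; case: eqP => // /eqP Ji; apply: val_inj => /=.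
  by apply/esym/bj; apply: contraNneq Ji => ->; rewrite ii subrr.
exists u'; apply/eqP; rewrite -subr_eq0; apply/eqP/day_bar_inj => J.
rewrite day_barB day_bar_diff; apply/eqP; rewrite subr_eq0; apply/eqP.
apply: val_inj; apply: etrans (bE J) _.
rewrite [RHS](linear_bar_diff (val : {linear tens (kfree n) -> _})).
by apply: eq_bar_diff => K; rewrite /= u'E.
Qed.

Definition day_to_sym_fun U (u : dayL 0 U) : sym_power k d U :=
  qproj (@sym_rel k d U) (day_bar 0 U u set0).
Lemma day_to_sym_linear U : linear (@day_to_sym_fun U).
Proof. by move=> a u v; rewrite /day_to_sym_fun day_barD linearP. Qed.
Lemma day_to_sym_nat U U' (f : ghom d U U') u :
  day_to_sym_fun (rmap (dayL 0) f u) = rmap (sym_power k d) f (day_to_sym_fun u).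
Proof. by rewrite /day_to_sym_fun day_bar_nat; exact: esym (tq_mapE (@sym_stable k d) f _). Qed.
Definition day_to_sym : nat_trans (dayL 0) (sym_power k d) :=
  nt_build day_to_sym_linear day_to_sym_nat.

Lemma day_to_sym_d U (u : dayL (-1) U) :
  day_to_sym U (day_map Lambda (cdiff (bar_cplx k d) (-1)) U u) = 0.
Proof.
rewrite /= /day_to_sym_fun -(linear0 (qproj (@sym_rel k d U))); apply/qprojP; rewrite subr0.
rewrite (day_bar_diff (i := -1)); apply: span_sum => a _; apply: spanZ.
have [|z ->] := day_bar_alt u (J := a |: set0) (a := a); first by rewrite !inE eqxx.
by apply: span_gen; exists (adj a), z.
Qed.

Lemma young_asym_adj U a (t : tens U) : young_asym [set a] t = t - tsact (adj a) t.
Proof.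
have yE : young [set a] = [set 1%g; adj a].
  apply/setP => s; rewrite in_set2; apply/idP/orP => [/young_set1[]->|]; rewrite ?eqxx;
    [by left|by right|].
  by case=> /eqP->; rewrite ?young1 ?adj_young ?inE.
have a1 : adj a != 1%g.
  by apply/eqP => /(congr1 (@odd_perm _)); rewrite odd_tperm odd_perm1 adj_neq.
rewrite /young_asym yE big_setU1 ?inE 1?eq_sym// big_set1 /=.
by rewrite /sgn odd_perm1 odd_tperm adj_neq tsact1 scale1r scaleN1r.
Qed.

(** The permutations [s] for which all [z - tsact s z] are boundaries are closed under products, and
    the summands [[set a]] provide the adjacent transpositions. *)
Lemma sym_rel_boundary U (t : tens U) : span (@sym_rel k d U) t ->
  exists u : dayL (-1) U, bar_diff (day_bar (-1) U u) set0 = t.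
Proof.
have dP a (u v : dayL (-1) U) t' t'' : bar_diff (day_bar (-1) U u) set0 = t' ->
    bar_diff (day_bar (-1) U v) set0 = t'' ->
    exists w : dayL (-1) U, bar_diff (day_bar (-1) U w) set0 = a *: t' + t''.
  move=> <- <-; exists (a *: u + v); rewrite -bar_diff_linear.
  by apply: eq_bar_diff => J; exact: day_barD.
have d0 : exists w : dayL (-1) U, bar_diff (day_bar (-1) U w) set0 = 0.
  by exists 0; rewrite /bar_diff big1// => a _; rewrite day_bar0 scaler0.
pose B z := exists w : dayL (-1) U, bar_diff (day_bar (-1) U w) set0 = z.
have BD z z' : B z -> B z' -> B (z + z').
  by move=> [u uz] [v vz]; rewrite -[z]scale1r; exact: dP uz vz.
have Badj a z : B (z - tsact (adj a) z).
  pose w : dayL (-1) U := \sum_J day_cls (-1) J (if J == [set a] then z else 0).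
  have wE b : day_bar (-1) U w (b |: set0) = if b == a then z - tsact (adj a) z else 0.
    rewrite /w day_bar_sum_cls setU0 cards1 subrr eqxx (inj_eq set1_inj).
    by case: eqP => [->|_]; [exact: young_asym_adj | exact: linear0].
  exists w; rewrite /bar_diff (bigD1 a) ?inE//= big1 => [|b /andP[_ ba]].
    by rewrite addr0 wE eqxx bar_sign0 scale1r.
  by rewrite wE (negbTE ba) scaler0.
pose G s := forall z : tens U, B (z - tsact s z).
have G1 : G 1%g by move=> z; rewrite tsact1 subrr.
have GM s r : G s -> G r -> G (s * r)%g.
  move=> Gs Gr z; rewrite -tsactM.
  have -> : z - tsact r (tsact s z) = (z - tsact s z) + (tsact s z - tsact r (tsact s z)).
    by rewrite addrA subrK.
  by apply: BD; [exact: Gs | exact: Gr].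
have Gt (a b : 'I_d) : (a < b)%N -> G (tperm a b).
  have [m] := ubnP (b : nat); elim: m b => // m IH b bm ab.
  have [c bc] := pred_adj ab; rewrite leq_eqVlt => /orP[/eqP/val_inj ->|ac].
    by rewrite bc => z; exact: Badj.
  (* Conjugation by [adj c] moves the right end of the transposition one step to the left. *)
  have -> : tperm a b = (adj c * tperm a (adjl c) * adj c)%g.
    rewrite -[X in (X * _ * _)%g]adjK -mulgA -conjgE tpermJ /adj tpermL -bc tpermD//.
      by rewrite -val_eqE /= gtn_eqF.
    by rewrite -val_eqE /= gtn_eqF.
  by apply: (GM _ _); [apply: (GM _ _); [exact: Badj | apply: IH => //; move: bm;
    rewrite bc] | exact: Badj].
have Gall s : G s.
  have [ts -> {s}] := prod_tpermP s; elim: ts => [|[a b] ts IH] /=; first by rewrite big_nil.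
  move=> /andP[ab /IH h]; rewrite big_cons /=; apply: GM => //.
  move: ab; rewrite -val_eqE neq_ltn => /orP[/Gt//|/Gt].
  by rewrite tpermC.
by elim=> // a x y [s [z ->]] _ [v vy]; have [w wE] := Gall s z; exact: dP wE vy.
Qed.

Definition day_sym_map : chain_map (tensor_cplx Lambda (bar_cplx k d)) (conc (sym_power k d)) :=
  @conc_map k d (tensor_cplx Lambda (bar_cplx k d)) (sym_power k d) day_to_sym day_to_sym_d.

Lemma day_sym_map_quasi_iso : quasi_iso day_sym_map.
Proof.
apply: conc_map_quasi_iso.
- by move=> V x; apply: day_bar_pos.
- by move=> n i x i1 cx; exact: day_bar_exact.
- move=> n x; rewrite /= /day_to_sym_fun -(linear0 (qproj _)) => /qprojP; rewrite subr0.
  move=> /sym_rel_boundary[u uE]; exists u; apply/eqP; rewrite -subr_eq0;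
    apply/eqP/(day_bar_inj (i := 0)) => J.
  have [->|J0] := eqVneq J set0; last by rewrite day_bar_deg// addr0 eqz_nat cards_eq0.
  by rewrite (day_barB (i := 0)) (day_bar_diff (i := -1)) uE subrr.
- move=> n; apply: qprojW => t; exists (day_cls 0 set0 t : dayL 0 (kfree n)).
  rewrite /= /day_to_sym_fun day_bar_cls eqxx cards0 /=; congr (qproj _ _).
  rewrite /young_asym (bigD1 1%g) ?young1//= big1 ?addr0 => [|s /andP[/young_set0-> /eqP//]].
  by rewrite /sgn odd_perm1 scale1r tsact1.
Qed.

End DayBarExact.

(** The existence of a K-projective resolution keeps the quantification over [p] from being
    vacuous. *)
Theorem proposition4p8 (k : comPzRingType) (d : nat) :
  inhabited (K_projective_resolution (conc (ext_power k d))) /\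
  forall p : K_projective_resolution (conc (ext_power k d)),
    D_iso (derived_tensor (ext_power k d) p) (conc (sym_power k d)).
Proof.
split=> [|p]; first exact: inhabits (bar_resolution k d).
have [f qf] := derived_tensor_quasi_iso (ext_power k d) p (bar_resolution k d).
exact: quasi_iso_D_iso (quasi_iso_comp (@day_sym_map_quasi_iso k d) qf).
Qed.
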